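(* Let $q>1$, $\alpha>-1$, $\sigma>1$, and let $\mu$ be a positive Borel measure on $\mathbb{D}$. Fix $t>0$. Then the following conditions are equivalent: (a) There is a constant $C>0$ such that for every analytic function $f$ on $\mathbb{D}$, $$\Big\| \xi\mapsto \int_{\Gamma_\sigma(\xi)} \frac{|f(z)|}{1-|z|}\, d\mu(z) \Big\|_{L^{q,\infty}(\mathbb{T})} \le C \Big\| \xi\mapsto\int_{\Gamma_\sigma(\xi)} |f(z)|(1-|z|)^{\alpha-1}\, dm_2(z) \Big\|_{L^{q,\infty}(\mathbb{T})}.$$ (b) There is $C>0$ such that $\mu(D(z,t)) \le C(1-|z|)^{\alpha+2}$ for all $z\in\mathbb{D}$. (c) There is $C>0$ such that $\mu(\square I)\le C|I|^{\alpha+2}$ for every arc $I\subset\mathbb{T}$.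
   Context: $\mathbb{D}$ is the unit disk, $\mathbb{T}$ the unit circle, $dm_2$ normalized area measure on $\mathbb{D}$, $dm$ Lebesgue arc-length measure on $\mathbb{T}$, and $|I|$ the length of an arc $I$. The Lusin cone is $\Gamma_\sigma(\xi)=\{z\in\mathbb{D}: |1-\bar\xi z|<\sigma(1-|z|)\}$ for $\xi\in\mathbb{T}$, $\sigma>1$. The Carleson box of an arc $I\subset\mathbb{T}$ is $\square I=\{re^{i\varphi}: 1-|I|<r<1,\ e^{i\varphi}\in I\}$. $L^{q,\infty}(\mathbb{T})$ is the weak $L^q$ (Lorentz) space with quasinorm $\|g\|_{L^{q,\infty}}=\sup_{\lambda>0}\lambda\, m(\{\xi\in\mathbb{T}:|g(\xi)|>\lambda\})^{1/q}$. For $a\in\mathbb{D}$, $\varphi_a(z)=\frac{a-z}{1-\bar a z}$; the Bergman distance is $d(z,w)=\frac12\log\frac{1+|\varphi_w(z)|}{1-|\varphi_w(z)|}$, and the Bergman disk is $D(a,t)=\{w\in\mathbb{D}: d(w,a)<t\}$ for $t>0$. *)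

(* Defs.v *)
From HB Require Import structures.
From mathcomp Require Import all_boot all_order all_algebra.
From mathcomp Require Import all_classical all_reals all_analysis.
Set Implicit Arguments. Unset Strict Implicit. Unset Printing Implicit Defensive.
Import Order.TTheory GRing.Theory Num.Theory.
Local Open Scope classical_set_scope.
Local Open Scope ring_scope.

Section Complex.
Variable R : realType.
Notation C := (R * R)%type.

Definition cadd (z w : C) : C := (z.1 + w.1, z.2 + w.2).
Definition csub (z w : C) : C := (z.1 - w.1, z.2 - w.2).
Definition cmul (z w : C) : C := (z.1 * w.1 - z.2 * w.2, z.1 * w.2 + z.2 * w.1).
Definition cconj (z : C) : C := (z.1, - z.2).
Definition cabs (z : C) : R := Num.sqrt (z.1 ^+ 2 + z.2 ^+ 2).
Definition cinv (z : C) : C := (z.1 / (cabs z ^+ 2), - z.2 / (cabs z ^+ 2)).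
Definition cdiv (z w : C) : C := cmul z (cinv w).
Definition cone : C := (1, 0).
Definition cexpi (phi : R) : C := (cos phi, sin phi).

Definition disk : set C := [set z | cabs z < 1].

Definition cdifferentiable_at (f : C -> C) (z : C) : Prop :=
  exists c : C, forall e : R, 0 < e -> exists2 d : R, 0 < d &
    forall h : C, 0 < cabs h < d ->
      cabs (csub (csub (f (cadd z h)) (f z)) (cmul c h)) <= e * cabs h.

Definition analytic_on_disk (f : C -> C) : Prop :=
  forall z, disk z -> cdifferentiable_at f z.

Definition lusin_cone (sigma : R) (xi : C) : set C :=
  [set z | disk z /\ cabs (csub cone (cmul (cconj xi) z)) < sigma * (1 - cabs z)].

(* Carleson box of the open arc I = {e^{i phi} : a < phi < a + l}, |I| = l *)
Definition carleson_box (a l : R) : set C :=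
  [set z | exists r phi : R, [/\ 0 <= r, 1 - l < r, r < 1, a < phi < a + l &
                              z = (r * cos phi, r * sin phi)]].

Definition mobius (a z : C) : C := cdiv (csub a z) (csub cone (cmul (cconj a) z)).
Definition bergman_dist (z w : C) : R :=
  2^-1 * ln ((1 + cabs (mobius w z)) / (1 - cabs (mobius w z))).
Definition bergman_disk (a : C) (t : R) : set C :=
  [set w | disk w /\ bergman_dist w a < t].

Definition circle_measure (E : set C) : \bar R :=
  (@lebesgue_measure R) [set th : R | 0 <= th < 2 * pi /\ E (cexpi th)].

Definition weakLq_norm (q : R) (g : C -> \bar R) : \bar R :=
  ereal_sup [set ((lam%:E * (circle_measure [set xi | (lam%:E < `|g xi|)%E]) `^ q^-1)%E)
            | lam in [set lam : R | 0 < lam]].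

(* normalized area measure integral over the Lusin cone *)
Definition area_cone_integral (sigma alpha : R) (f : C -> C) (xi : C) : \bar R :=
  (\int[((@lebesgue_measure R) \x (@lebesgue_measure R))%E]_(z in lusin_cone sigma xi)
     ((cabs (f z) * (1 - cabs z) `^ (alpha - 1) / pi)%:E))%E.

Definition mu_cone_integral (mu : {measure set C -> \bar R}) (sigma : R) (f : C -> C)
    (xi : C) : \bar R :=
  (\int[mu]_(z in lusin_cone sigma xi) ((cabs (f z) / (1 - cabs z))%:E))%E.

End Complex.

(* Main.v *)
(* Everything is compared with the ball condition mu(B(a, e h)) <= K h^(alpha+2), h = 1 - |a|,
   which (b) implies since a Bergman disk contains such a ball.

   Balls to boxes: a Carleson box is cut into layers of geometrically decreasing height, and
   each layer into pieces contained in one ball; the sum converges because alpha + 2 > 1.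
   Conversely a Bergman disk lies in a box of comparable size.

   (a) to (b): for f(w) = (1 - conj(a) w)^(-n) the area integral over the cone at xi is at most
   a multiple of |xi - a|^(alpha+1-n), which bounds its weak norm. The Bergman disk is covered by
   boundedly many small squares, each contained in all the cones of an arc of length about h,
   and there f is of size h^(-n).

   Balls to (a): the sub-mean value property of |f| and Tonelli's theorem bound the mu-integral
   over a cone by the area integral A' over a wider cone. The aperture is reduced by a duality
   argument: for E = {A' > lam}, the arc from which z is seen by the wide cone meets E in
   measure at most a multiple of 2^-k times the measure of the part of the narrow arc inside
   {M 1_E > 2^-k-1}, for some k, where M is the Hardy-Littlewood maximal function. Hence
   lam |E| is at most a multiple of the sum of 2^-k times the integral of A over
   {M 1_E > 2^-k-1}, and Kolmogorov's inequality bounds this by the weak norm of A times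
   |E|^(1-1/q). *)
From HB Require Import structures.
From mathcomp Require Import all_boot all_order all_algebra.
From mathcomp Require Import complex.
From mathcomp Require Import all_classical all_reals all_analysis.
From mathcomp Require Import measurable_realfun ring lra.
Require Import Defs.
Set Implicit Arguments.
Unset Strict Implicit.
Unset Printing Implicit Defensive.
Import Order.TTheory GRing.Theory Num.Theory.
Import numFieldNormedType.Exports.
Local Open Scope classical_set_scope.
Local Open Scope ring_scope.

(** * The plane in complex notation *)

(** Both sides of (a) carry the same aperture, while averaging over a neighbourhood of [z] always
    leaves the cone; this mismatch forces the maximal function argument. The level set of the
    wide-cone integral serves as its own dual test function. Analyticity is only pointwise complex
    differentiability, so the sub-mean value property is built up from Goursat's theorem. Squares
    replace disks there, because planar area is a product measure and Tonelli in the two coordinates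
    suffices. Exponents: the weight 1/(1-|z|) and the area of a square of side about 1-|z| produce
    (1-|w|)^(-3); the measure of a ball adds alpha+2, which leaves the alpha-1 of the right-hand
    side. Tonelli for [mu] needs [mu] of the disk finite, and this is why boxes are treated before
    (a). In the test function n >= alpha+2, so n-alpha-1 >= 1 > 1/q: its weak norm is then governed
    by the level set of size 1-|a|. In the aperture argument the level k contributes 2^(-k) (2^k
    |E|)^(1-1/q), a geometric series of ratio 2^(-1/q). *)

Section ComplexModulus.
Variable R : realType.
Notation C := (R * R)%type.
Implicit Types (z w : C).

Lemma cabs_ge0 z : 0 <= cabs z.
Proof. exact: sqrtr_ge0. Qed.

Lemma sqr_cabs z : cabs z ^+ 2 = z.1 ^+ 2 + z.2 ^+ 2.
Proof. by rewrite sqr_sqrtr// addr_ge0 ?sqr_ge0. Qed.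

Lemma cabs_le z (r : R) : 0 <= r -> (cabs z <= r) = (z.1 ^+ 2 + z.2 ^+ 2 <= r ^+ 2).
Proof. by move=> r0; rewrite -sqr_cabs ler_sqr// nnegrE cabs_ge0. Qed.

Lemma cabsM z w : cabs (cmul z w) = cabs z * cabs w.
Proof.
rewrite /cabs -sqrtrM ?addr_ge0 ?sqr_ge0//; congr Num.sqrt.
rewrite /cmul/=; ring.
Qed.

Lemma cabs_triangle z w : cabs (cadd z w) <= cabs z + cabs w.
Proof.
rewrite cabs_le ?addr_ge0 ?cabs_ge0// /cadd/=.
have := sqr_cabs z; have := sqr_cabs w.
(* Cauchy-Schwarz for the scalar product, proved through Lagrange's identity. *)
suff : z.1 * w.1 + z.2 * w.2 <= cabs z * cabs w by nra.
rewrite -cabsM; apply: (le_trans (ler_norm _)).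
rewrite -sqrtr_sqr /cabs ler_sqrt ?addr_ge0 ?sqr_ge0//.
rewrite /cmul/= -subr_ge0.
suff -> : (z.1 * w.1 - z.2 * w.2) ^+ 2 + (z.1 * w.2 + z.2 * w.1) ^+ 2 -
  (z.1 * w.1 + z.2 * w.2) ^+ 2 = (z.1 * w.2 - z.2 * w.1) ^+ 2 by exact: sqr_ge0.
ring.
Qed.

Lemma csubC z w : cabs (csub z w) = cabs (csub w z).
Proof. by congr Num.sqrt; rewrite /csub/=; ring. Qed.

Lemma csub_triangle z w (v : C) : cabs (csub z v) <= cabs (csub z w) + cabs (csub w v).
Proof.
suff -> : csub z v = cadd (csub z w) (csub w v) by exact: cabs_triangle.
by rewrite /csub /cadd/=; congr pair; ring.
Qed.

Lemma cabs_le_csub z w : cabs z <= cabs w + cabs (csub z w).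
Proof.
suff {1}-> : z = cadd w (csub z w) by exact: cabs_triangle.
by case: z w => [x y] [x' y']; rewrite /csub /cadd/=; congr pair; ring.
Qed.

Lemma normr_fst_cabs z : `|z.1| <= cabs z.
Proof. by rewrite -sqrtr_sqr ler_wsqrtr// lerDl sqr_ge0. Qed.

Lemma normr_snd_cabs z : `|z.2| <= cabs z.
Proof. by rewrite -sqrtr_sqr ler_wsqrtr// lerDr sqr_ge0. Qed.

Lemma cabs_le_norms z : cabs z <= `|z.1| + `|z.2|.
Proof.
rewrite cabs_le ?addr_ge0// sqrrD !real_normK ?num_real//.
by rewrite -addrA lerD2l lerDr mulrn_wge0// mulr_ge0.
Qed.

Lemma cabs_eq0 z : (cabs z == 0) = (z == (0, 0)).
Proof.
rewrite sqrtr_eq0 le_eqVlt ltNge addr_ge0 ?sqr_ge0// orbF paddr_eq0 ?sqr_ge0//.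
by rewrite !sqrf_eq0 -pair_eqE.
Qed.

Lemma cabs0 : cabs ((0, 0) : C) = 0.
Proof. by apply/eqP; rewrite cabs_eq0. Qed.

Lemma cabs_conj z : cabs (cconj z) = cabs z.
Proof. by rewrite /cabs/= sqrrN. Qed.

Lemma cabs_one : cabs (cone R) = 1.
Proof. by rewrite /cabs/= expr1n expr0n addr0 sqrtr1. Qed.

Lemma cabs_expi (a : R) : cabs (cexpi a) = 1.
Proof. by rewrite /cabs/= cos2Dsin2 sqrtr1. Qed.

Lemma cabs_polar (r a : R) : 0 <= r -> cabs (r * cos a, r * sin a) = r.
Proof.
move=> r0; rewrite /cabs/= !exprMn -mulrDr cos2Dsin2 mulr1 sqrtr_sqr.
by rewrite ger0_norm.
Qed.

Lemma cabs_inv z : cabs (cinv z) = (cabs z)^-1.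
Proof.
have [/eqP|z0] := eqVneq (cabs z) 0.
  rewrite cabs_eq0 => /eqP ->; rewrite cabs0 invr0.
  by rewrite /cinv/= oppr0 !mul0r cabs0.
rewrite {1}/cabs /cinv/= !exprMn sqrrN -mulrDl -sqr_cabs exprVn -exprM.
have -> : cabs z ^+ 2 / cabs z ^+ (2 * 2) = (cabs z)^-1 ^+ 2 by field.
by rewrite sqrtr_sqr ger0_norm// invr_ge0 cabs_ge0.
Qed.

Lemma cmul_inv z : cabs z != 0 -> cmul (cinv z) z = cone R.
Proof.
move=> z0; have : cabs z ^+ 2 != 0 by rewrite expf_neq0.
rewrite /cmul /cinv/= !sqr_cabs => n0.
by rewrite /cone; congr pair; field.
Qed.

(** Multiply by the unimodular [xi]. The Lusin cone thereby becomes a condition on the Euclidean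
    distance to its vertex, the form in which cones are handled below. *)
Lemma cdist_unit (xi z : C) : cabs xi = 1 ->
  cabs (csub (cone R) (cmul (cconj xi) z)) = cabs (csub xi z).
Proof.
move=> x1; rewrite -[RHS]mul1r -{1}x1 -(cabs_conj xi) -cabsM.
have := sqr_cabs xi; rewrite x1 expr1n => e.
have -> : cone R = cmul (cconj xi) xi.
  by rewrite /cone /cmul /cconj/= {1}e; congr pair; ring.
by congr cabs; rewrite /csub /cmul/=; congr pair; ring.
Qed.

Lemma csub_conj_le a z : cabs a <= 1 -> cabs z <= 1 ->
  1 - cabs a <= cabs (csub (cone R) (cmul (cconj a) z)).
Proof.
move=> a1 z1; have := cabs_le_csub (cone R) (cmul (cconj a) z).
rewrite cabs_one cabsM cabs_conj => h.
have : cabs a * cabs z <= cabs a by rewrite ler_piMr ?cabs_ge0.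
lra.
Qed.

Lemma csub_conj_sym a z : cabs (csub (cone R) (cmul (cconj a) z)) =
  cabs (csub (cone R) (cmul (cconj z) a)).
Proof.
by rewrite -cabs_conj; congr cabs; rewrite /csub /cmul /cconj/=; congr pair; ring.
Qed.

Lemma csub_conj_upper a z : cabs a <= 1 ->
  cabs (csub (cone R) (cmul (cconj a) z)) <= 2 * (1 - cabs a) + cabs (csub z a).
Proof.
move=> a1.
have -> : csub (cone R) (cmul (cconj a) z) =
   cadd ((1 - cabs a ^+ 2, 0)) (cmul (cconj a) (csub a z)).
  by rewrite sqr_cabs /csub /cadd /cmul /cconj /cone/=; congr pair; ring.
apply: (le_trans (cabs_triangle _ _)); rewrite cabsM cabs_conj csubC.
have h0 := cabs_ge0 a; have h1 := cabs_ge0 (csub z a).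
have -> : cabs (1 - cabs a ^+ 2, 0) = 1 - cabs a ^+ 2.
  rewrite {1}/cabs/= expr0n addr0 sqrtr_sqr ger0_norm//; nra.
have : cabs a * cabs (csub z a) <= cabs (csub z a) by rewrite ler_piMl.
nra.
Qed.

End ComplexModulus.

(** * Polar coordinates, chords and arcs *)

Section PolarCoordinates.
Variable R : realType.
Notation C := (R * R)%type.
Implicit Types (z w : C).

Lemma polar_decomposition z : exists2 a : R, 0 <= a < 2 * pi &
  z = (cabs z * cos a, cabs z * sin a).
Proof.
have pi0 := pi_gt0 R.
have [/eqP|z0] := eqVneq (cabs z) 0.
  rewrite cabs_eq0 => /eqP ->; exists 0; last by rewrite cabs0 !mul0r.
  by rewrite lexx/=; lra.
have zp : 0 < cabs z by rewrite lt_neqAle eq_sym z0 cabs_ge0.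
pose x := z.1 / cabs z; pose y := z.2 / cabs z.
have xy : x ^+ 2 + y ^+ 2 = 1.
  by rewrite /x /y !expr_div_n -mulrDl -sqr_cabs divff// expf_neq0.
have x1 : -1 <= x <= 1 by apply/andP; split; nra.
have a0 := acos_ge0 x1; have api := acos_lepi x1.
have cx : cos (acos x) = x by apply: acosK; rewrite in_itv.
have sx : sin (acos x) = `|y|.
  by rewrite sin_acos// -xy addrAC subrr add0r sqrtr_sqr.
have zE : z = (cabs z * x, cabs z * y).
  by rewrite /x /y !mulrA ![cabs z * _]mulrC !mulfK//; case: (z).
have [y0|y0] := leP 0 y.
  exists (acos x); first by rewrite a0/=; lra.
  by rewrite cx sx ger0_norm.
have a_gt0 : 0 < acos x.
  rewrite lt_neqAle a0 andbT eq_sym; apply: contraTneq y0 => e.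
  by move: sx; rewrite e sin0 => /esym/eqP; rewrite normr_eq0 => /eqP ->; rewrite ltxx.
exists (2 * pi - acos x); first by apply/andP; split; lra.
have -> : 2 * pi - acos x = (- acos x) + pi *+ 2 by rewrite mulr2n; ring.
by rewrite cosD2pi sinD2pi cosN sinN cx sx ltr0_norm// opprK.
Qed.

Lemma sin_le_id (x : R) : 0 <= x -> sin x <= x.
Proof.
move=> x0; have [c _ e] := @MVT_segment R (@sin R) (@cos R) 0 x x0
  (fun y _ => is_derive_sin y)
  (continuous_subspaceT (@continuous_sin R)).
move: e; rewrite sin0 !subr0 => ->.
by rewrite ler_piMl// cos_le1.
Qed.

Lemma normr_sin_le (x : R) : `|sin x| <= `|x|.
Proof.
wlog x0 : x / 0 <= x.
  move=> h; have [/h//|x0] := leP 0 x.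
  by have := h (- x); rewrite sinN !normrN; apply; lra.
rewrite (ger0_norm x0) ler_norml sin_le_id// andbT.
have [x1|x1] := leP 1 x; first by rewrite (le_trans _ (sin_geN1 x)); lra.
have p2 := pi_ge2 R.
have : 0 <= sin x by apply: sin_ge0_pi; apply/andP; split; lra.
lra.
Qed.

(** On [0, 1] the cosine is at least 1/2, so the mean value theorem gives x/2. Beyond 1 the sine
    increases, and [sin 1] >= 1/2 suffices because x <= pi/2 < 2. *)
Lemma sin_ge_quarter (x : R) : 0 <= x <= pi / 2 -> x / 4 <= sin x.
Proof.
move=> /andP[x0 xp].
have half (y : R) : 0 <= y <= 1 -> y / 2 <= sin y.
  move=> /andP[y0 y1].
  have [c] := @MVT_segment R (@sin R) (@cos R) 0 y y0
    (fun y _ => is_derive_sin y)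
    (continuous_subspaceT (@continuous_sin R)).
  rewrite in_itv/= => /andP[c0 cy]; rewrite sin0 !subr0 => ->.
  have ce : cos c = 1 - 2 * sin (c / 2) ^+ 2.
    have -> : c = (c / 2) *+ 2 by rewrite mulr2n; field.
    rewrite cos_mulr2n cos2sin2 mulr2n mulr2n.
    have -> : (c / 2 + c / 2) / 2 = c / 2 by field.
    ring.
  have s1 : sin (c / 2) <= c / 2 by apply: sin_le_id; lra.
  have s0 : 0 <= sin (c / 2).
    by have p2 := pi_ge2 R; apply: sin_ge0_pi; apply/andP; split; lra.
  suff : 2^-1 <= cos c by nra.
  rewrite ce; nra.
have [x1|x1] := leP x 1.
  by apply: (le_trans _ (half x _)); [lra | rewrite x0 x1].
have /ltW h : sin 1 < sin x.
  by rewrite ltr_sin// in_itv/=; apply/andP; split; lra.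
have := half 1; rewrite ler01 lexx => /(_ isT).
have := pihalf_lt2 R; lra.
Qed.

Lemma cdist_expi (a b : R) : cabs (csub (cexpi a) (cexpi b)) = 2 * `|sin ((a - b) / 2)|.
Proof.
rewrite /cabs /csub /cexpi/=.
have -> : (cos a - cos b) ^+ 2 + (sin a - sin b) ^+ 2 = (2 * sin ((a - b) / 2)) ^+ 2.
  have ce : cos (a - b) = 1 - 2 * sin ((a - b) / 2) ^+ 2.
    have {1}-> : a - b = ((a - b) / 2) *+ 2 by rewrite mulr2n; field.
    by rewrite cos_mulr2n cos2sin2 mulr2n; ring.
  have := ce; rewrite cosB.
  have := cos2Dsin2 a; have := cos2Dsin2 b; nra.
by rewrite sqrtr_sqr normrM ger0_norm.
Qed.

Lemma cdist_expi_le (a b : R) : cabs (csub (cexpi a) (cexpi b)) <= `|a - b|.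
Proof.
rewrite cdist_expi; have := normr_sin_le ((a - b) / 2).
rewrite normrM (@ger0_norm _ 2^-1)//; lra.
Qed.

(** A chord determines the angle only modulo a full turn, hence three cases. The factor 4 comes from
    chord = 2 |sin((a-b)/2)| and [sin_ge_quarter]. *)
Lemma arc_le_chord (a b r : R) : 0 <= a < 2 * pi -> 0 <= b < 2 * pi ->
  cabs (csub (cexpi a) (cexpi b)) <= r ->
  [\/ `|a - b| <= 4 * r, `|a - b - 2 * pi| <= 4 * r | `|a - b + 2 * pi| <= 4 * r].
Proof.
move=> /andP[a0 a1] /andP[b0 b1]; rewrite cdist_expi.
wlog ab : a b a0 a1 b0 b1 / b <= a.
  move=> h; have [ba|/ltW ab] := leP b a; first exact: h.
  move=> hr; have := h b a b0 b1 a0 a1 ab.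
  have -> : (b - a) / 2 = - ((a - b) / 2) by field.
  rewrite sinN normrN => /(_ hr) [e|e|e].
  - by apply: Or31; rewrite distrC.
  - by apply: Or33; rewrite -normrN (_ : - (a - b + 2 * pi) = b - a - 2 * pi)//; ring.
  - by apply: Or32; rewrite -normrN (_ : - (a - b - 2 * pi) = b - a + 2 * pi)//; ring.
have [h|h] := leP ((a - b) / 2) (pi / 2) => hr.
  apply: Or31; rewrite ger0_norm ?subr_ge0//.
  have := @sin_ge_quarter ((a - b) / 2); have := ler_norm (sin ((a - b) / 2)).
  move=> h1 /(_ _)h2; have : 0 <= (a - b) / 2 <= pi / 2 by apply/andP; split; lra.
  move=> /h2; lra.
apply: Or32; rewrite ler0_norm; last lra.
have := @sin_ge_quarter (pi - (a - b) / 2).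
have -> : sin (pi - (a - b) / 2) = sin ((a - b) / 2).
  by rewrite sinB cospi sinpi; ring.
have := ler_norm (sin ((a - b) / 2)).
move=> h1 /(_ _)h2; have : 0 <= pi - (a - b) / 2 <= pi / 2 by apply/andP; split; lra.
move=> /h2; lra.
Qed.

End PolarCoordinates.

(** * Goursat's theorem on rectangles *)

Section SegmentIntegrals.
Variable R : realType.
Notation leb := (@lebesgue_measure R).
Implicit Types (g : R -> R) (a b : R).

(** Continuity is two-sided even at the end points, so it passes to subsegments without one-sided
    limits. *)
Definition cont_seg g a b := forall x, a <= x <= b -> {for x, continuous g}.

Lemma cont_seg_integrable g a b : cont_seg g a b ->
  leb.-integrable `[a, b] (EFin \o g).
Proof.
move=> cg; apply: continuous_compact_integrable; first exact: segment_compact.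
apply: continuous_in_subspaceT => x; rewrite inE/= in_itv/=; exact: cg.
Qed.

Lemma cont_segS g a b a' b' : a <= a' -> b' <= b -> cont_seg g a b -> cont_seg g a' b'.
Proof.
move=> aa bb h x /andP[ax xb]; apply: h.
by rewrite (le_trans aa ax) (le_trans xb bb).
Qed.

Lemma cont_segB g g' a b : cont_seg g a b -> cont_seg g' a b ->
  cont_seg (fun x => g x - g' x) a b.
Proof. by move=> h h' x xab; apply: continuousB; [exact: h|exact: h']. Qed.

Lemma Rintegral_seg_split g a m b : a <= m -> m <= b -> cont_seg g a b ->
  \int[leb]_(x in `[a, b]) g x =
  \int[leb]_(x in `[a, m]) g x + \int[leb]_(x in `[m, b]) g x.
Proof.
move=> am mb cg; have ig := cont_seg_integrable cg.
have := @Rintegral_itvB R g (BLeft a) (BRight b) m ig.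
rewrite !bnd_simp => /(_ am mb).
rewrite Rintegral_itv_obnd_cbnd; last first.
  apply: integrableS ig => //; apply: subset_itvr; rewrite bnd_simp//.
by move=> <-; rewrite addrC subrK.
Qed.

Lemma Rintegral_seg_cst a b (m : R) : a <= b -> \int[leb]_(_ in `[a, b]) m = m * (b - a).
Proof.
move=> ab; rewrite Rintegral_cst//=; congr (_ * _).
rewrite lebesgue_measure_itv/= lte_fin; case: ltP => //= ba.
by apply/esym/eqP; rewrite subr_eq0 eq_le ab ba.
Qed.

Lemma cont_seg_cst (m : R) a b : cont_seg (fun=> m) a b.
Proof. by move=> x _; exact: cst_continuous. Qed.

Lemma Rintegral_seg_le g g' a b : cont_seg g a b -> cont_seg g' a b ->
  (forall x, a <= x <= b -> g x <= g' x) ->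
  \int[leb]_(x in `[a, b]) g x <= \int[leb]_(x in `[a, b]) g' x.
Proof.
move=> cg cg' h; apply: le_Rintegral => //; try exact: cont_seg_integrable.
Qed.

Lemma Rintegral_seg_bound g a b (m M : R) : a <= b -> cont_seg g a b ->
  (forall x, a <= x <= b -> `|g x - m| <= M) ->
  `|\int[leb]_(x in `[a, b]) g x - m * (b - a)| <= M * (b - a).
Proof.
move=> ab cg h.
have h1 := @Rintegral_seg_le g _ a b cg (@cont_seg_cst (m + M) a b).
have h2 := @Rintegral_seg_le _ g a b (@cont_seg_cst (m - M) a b) cg.
move: h1 h2; rewrite !Rintegral_seg_cst// => h1 h2.
rewrite ler_norml; apply/andP; split.
  suff : (m - M) * (b - a) <= \int[leb]_(x in `[a, b]) g x by lra.
  by apply: h2 => x /h; rewrite ler_norml => /andP[]; lra.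
suff : \int[leb]_(x in `[a, b]) g x <= (m + M) * (b - a) by lra.
by apply: h1 => x /h; rewrite ler_norml => /andP[]; lra.
Qed.

Lemma Rintegral_segB g g' a b : cont_seg g a b -> cont_seg g' a b ->
  \int[leb]_(x in `[a, b]) (g x - g' x) =
  \int[leb]_(x in `[a, b]) g x - \int[leb]_(x in `[a, b]) g' x.
Proof.
by move=> cg cg'; rewrite RintegralB//; exact: cont_seg_integrable.
Qed.

End SegmentIntegrals.

(** * Repeated bisection of a rectangle *)

Section Bisection.
Variable R : realType.

(** Nested rectangles obtained by dependent choice; the common point has as coordinates the suprema
    of the left and of the lower ends. The booleans [i] and [j] select the right and the upper
    half. *)
Lemma rectangle_bisection (bad : R -> R -> R -> R -> Prop) (a b c d : R) :
  a <= b -> c <= d -> bad a b c d ->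
  (forall a b c d, a <= b -> c <= d -> bad a b c d ->
    let m := (a + b) / 2 in let n := (c + d) / 2 in
    exists i j : bool, bad (if i then m else a) (if i then b else m)
                           (if j then n else c) (if j then d else n)) ->
  exists x y : R, forall k : nat, exists a' b' c' d',
    [/\ bad a' b' c' d', a' <= x <= b', c' <= y <= d',
        b' - a' = (b - a) / 2 ^+ k & d' - c' = (d - c) / 2 ^+ k].
Proof.
move=> ab cd bad0 step.
pose good (p : (R * R) * (R * R)) := [/\ bad p.1.1 p.1.2 p.2.1 p.2.2,
   p.1.1 <= p.1.2 & p.2.1 <= p.2.2].
(* Stated as an implication, so that choice yields a successor function [f] defined on all
   rectangles. *)
pose rl (p p' : (R * R) * (R * R)) := good p -> [/\ good p',
   p'.1.2 - p'.1.1 = (p.1.2 - p.1.1) / 2, p'.2.2 - p'.2.1 = (p.2.2 - p.2.1) / 2,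
   p.1.1 <= p'.1.1 /\ p'.1.2 <= p.1.2 & p.2.1 <= p'.2.1 /\ p'.2.2 <= p.2.2].
have [f fP] : {f & forall p, rl p (f p)}.
  apply: choice => -[[a1 b1] [c1 d1]]; rewrite /rl.
  have [[/= bd1 ab1 cd1]|ng] := pselect (good ((a1, b1), (c1, d1))); last first.
    by exists ((a1, b1), (c1, d1)).
  have [i [j bd]] := step _ _ _ _ ab1 cd1 bd1.
  exists ((if i then (a1 + b1) / 2 else a1, if i then b1 else (a1 + b1) / 2),
          (if j then (c1 + d1) / 2 else c1, if j then d1 else (c1 + d1) / 2)).
  move=> _; split => //=.
  - by split => //=; [case: (i)|case: (j)]; lra.
  - by case: (i); lra.
  - by case: (j); lra.
  - by split; case: (i); lra.
  - by split; case: (j); lra.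
pose s k := iter k f ((a, b), (c, d)).
have gs k : good (s k).
  by elim: k => [|k ih]; [split|rewrite /s iterS; have [] := fP _ ih].
have w1 k : (s k).1.2 - (s k).1.1 = (b - a) / 2 ^+ k.
  elim: k => [|k ih]; first by rewrite expr0 divr1.
  have [_ e _ _ _] := fP _ (gs k); rewrite /s iterS e -/(s k) ih.
  by rewrite exprS; field.
have w2 k : (s k).2.2 - (s k).2.1 = (d - c) / 2 ^+ k.
  elim: k => [|k ih]; first by rewrite expr0 divr1.
  have [_ _ e _ _] := fP _ (gs k); rewrite /s iterS e -/(s k) ih.
  by rewrite exprS; field.
have mono k n : [/\ (s k).1.1 <= (s (n + k)%N).1.1, (s (n + k)%N).1.2 <= (s k).1.2,
   (s k).2.1 <= (s (n + k)%N).2.1 & (s (n + k)%N).2.2 <= (s k).2.2].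
  elim: n => [|n [i1 i2 i3 i4]]; first by split.
  have [_ _ _ [e1 e2] [e3 e4]] := fP _ (gs (n + k)%N).
  rewrite addSn /s iterS -/(s (n + k)%N).
  by split; [exact: le_trans e1|exact: le_trans i2|exact: le_trans e3|exact: le_trans i4].
(* Both rectangles contain the later one of index [k + n], through which the ends are compared. *)
have cross k n : (s k).1.1 <= (s n).1.2 /\ (s k).2.1 <= (s n).2.2.
  have [h1 h2 h3 h4] := mono k n; have [h5 h6 h7 h8] := mono n k.
  rewrite addnC in h1 h2 h3 h4; have [_ g1 g2] := gs (k + n)%N; split.
    exact: (le_trans h1 (le_trans g1 h6)).
  exact: (le_trans h3 (le_trans g2 h8)).
exists (sup (range (fun k => (s k).1.1))), (sup (range (fun k => (s k).2.1))) => k.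
exists (s k).1.1, (s k).1.2, (s k).2.1, (s k).2.2.
have [bk _ _] := gs k; split => //.
- apply/andP; split.
    apply: ub_le_sup; last by exists k.
    by exists ((s 0%N).1.2) => _ [n _ <-]; exact: (cross n 0%N).1.
  apply: ge_sup; first by exists ((s 0%N).1.1), 0%N.
  by move=> _ [n _ <-]; exact: (cross n k).1.
- apply/andP; split.
    apply: ub_le_sup; last by exists k.
    by exists ((s 0%N).2.2) => _ [n _ <-]; exact: (cross n 0%N).2.
  apply: ge_sup; first by exists ((s 0%N).2.1), 0%N.
  by move=> _ [n _ <-]; exact: (cross n k).2.
Qed.

End Bisection.

Section Goursat.
Variable R : realType.
Notation leb := (@lebesgue_measure R).
Implicit Types (P Q : R -> R -> R) (a b c d x y : R).

(* P and Q are differentiable at (x, y) and the form P dx + Q dy is closed there: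
   the y-derivative of P and the x-derivative of Q are the same number B. *)
Definition closed_form_at P Q x y := exists A B D : R, forall e : R, 0 < e ->
  exists2 r : R, 0 < r & forall h k, `|h| <= r -> `|k| <= r ->
    `|P (x + h) (y + k) - P x y - A * h - B * k| <= e * (`|h| + `|k|) /\
    `|Q (x + h) (y + k) - Q x y - B * h - D * k| <= e * (`|h| + `|k|).

(** The counterclockwise line integral of P dx + Q dy, with opposite sides paired under one integral
    so that differences across the rectangle can be estimated directly. *)
Definition boundary_integral P Q a b c d : R :=
  \int[leb]_(x in `[a, b]) (P x c - P x d) + \int[leb]_(y in `[c, d]) (Q b y - Q a y).

Lemma continuous_of_affine_bound (g : R -> R) x (A : R) : 
  (exists2 r : R, 0 < r & forall h, `|h| <= r ->
    `|g (x + h) - g x - A * h| <= `|h|) -> {for x, continuous g}.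
Proof.
move=> [r r0 hr]; apply/cvgrPdist_le => /= e e0.
have A1 : 0 < `|A| + 1 by rewrite ltr_wpDl.
have rr : 0 < Num.min r (e / (`|A| + 1)) by rewrite lt_min r0 divr_gt0.
exists (Num.min r (e / (`|A| + 1))) => //= t; rewrite /ball/= lt_min => /andP[t1 t2].
have := hr (t - x); rewrite distrC => /(_ (ltW t1)).
rewrite (addrC x) subrK => h.
rewrite distrC.
have -> : g t - g x = (g t - g x - A * (t - x)) + A * (t - x) by ring.
apply: (le_trans (ler_normD _ _)); rewrite normrM.
apply: (@le_trans _ _ ((`|A| + 1) * `|t - x|)).
  by rewrite mulrDl mul1r addrC lerD2l (distrC t).
by rewrite mulrC -ler_pdivlMr// distrC ltW.
Qed.

Lemma closed_form_continuous1 P Q x y :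
  closed_form_at P Q x y -> {for x, continuous (fun t => P t y)}.
Proof.
move=> [A [B [D h]]]; apply: (@continuous_of_affine_bound _ _ A).
have [r r0 hr] := h 1 ltr01; exists r => // k kr.
have [] := hr k 0 kr; first by rewrite normr0 ltW.
by rewrite addr0 mulr0 subr0 normr0 addr0 mul1r.
Qed.

Lemma closed_form_continuous2 P Q x y :
  closed_form_at P Q x y -> {for y, continuous (fun t => Q x t)}.
Proof.
move=> [A [B [D h]]]; apply: (@continuous_of_affine_bound _ _ D).
have [r r0 hr] := h 1 ltr01; exists r => // k kr.
have [|_] := hr 0 k _ kr; first by rewrite normr0 ltW.
by rewrite addr0 mulr0 subr0 normr0 add0r mul1r.
Qed.

(** The common side x = m is traversed once in each direction and cancels. *)
Lemma boundary_integral_splitx P Q a m b c d : a <= m -> m <= b ->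
  cont_seg (fun x => P x c) a b -> cont_seg (fun x => P x d) a b ->
  cont_seg (Q a) c d -> cont_seg (Q m) c d -> cont_seg (Q b) c d ->
  boundary_integral P Q a b c d =
  boundary_integral P Q a m c d + boundary_integral P Q m b c d.
Proof.
move=> am mb c1 c2 c3 c4 c5; rewrite /boundary_integral.
rewrite (@Rintegral_seg_split _ _ a m b)//; last exact: cont_segB.
by rewrite !(Rintegral_segB (a := c))//; ring.
Qed.

Lemma boundary_integral_splity P Q a b c m d : c <= m -> m <= d ->
  cont_seg (fun x => P x c) a b -> cont_seg (fun x => P x m) a b ->
  cont_seg (fun x => P x d) a b ->
  cont_seg (Q a) c d -> cont_seg (Q b) c d ->
  boundary_integral P Q a b c d =
  boundary_integral P Q a b c m + boundary_integral P Q a b m d.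
Proof.
move=> am mb c1 c2 c3 c4 c5; rewrite /boundary_integral.
rewrite (@Rintegral_seg_split _ (fun y => Q b y - Q a y) c m d)//; last exact: cont_segB.
by rewrite !(Rintegral_segB (a := a))//; ring.
Qed.

(* The affine part of the form contributes nothing, since its P_y and Q_x agree. *)
Lemma boundary_integral_small P Q x y a b c d (A B D e : R) :
  a <= x <= b -> c <= y <= d -> 0 <= e ->
  cont_seg (fun x => P x c) a b -> cont_seg (fun x => P x d) a b ->
  cont_seg (Q a) c d -> cont_seg (Q b) c d ->
  (forall s t, a <= s <= b -> c <= t <= d ->
    `|P s t - P x y - A * (s - x) - B * (t - y)| <= e /\
    `|Q s t - Q x y - B * (s - x) - D * (t - y)| <= e) ->
  `|boundary_integral P Q a b c d| <= (e *+ 2) * ((b - a) + (d - c)).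
Proof.
move=> /andP[ax xb] /andP[cy yd] e0 c1 c2 c3 c4 h.
have ab := le_trans ax xb; have cd := le_trans cy yd.
have h1 : `|\int[leb]_(x in `[a, b]) (P x c - P x d) - B * (c - d) * (b - a)| <=
   (e *+ 2) * (b - a).
  apply: Rintegral_seg_bound => //; first exact: cont_segB.
  move=> s sab; have [p1 _] := h s c sab (introT andP (conj (lexx c) cd)).
  have [p2 _] := h s d sab (introT andP (conj cd (lexx d))).
  move: p1 p2; rewrite !ler_norml mulr2n => /andP[p1 p2] /andP[p3 p4].
  by apply/andP; split; lra.
have h2 : `|\int[leb]_(y in `[c, d]) (Q b y - Q a y) - B * (b - a) * (d - c)| <=
   (e *+ 2) * (d - c).
  apply: Rintegral_seg_bound => //; first exact: cont_segB.
  move=> s sab; have [_ p1] := h a s (introT andP (conj (lexx a) ab)) sab.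
  have [_ p2] := h b s (introT andP (conj ab (lexx b))) sab.
  move: p1 p2; rewrite !ler_norml mulr2n => /andP[p1 p2] /andP[p3 p4].
  by apply/andP; split; lra.
rewrite mulrDr; apply: le_trans (lerD h1 h2).
apply: le_trans (ler_normD _ _); rewrite /boundary_integral.
by rewrite le_eqVlt; apply/orP; left; apply/eqP; congr `|_|; ring.
Qed.

(** Goursat's bisection: if the integral were nonzero, rectangles whose integral exceeds a fixed
    multiple of their area would shrink to a point, where differentiability makes the integral
    smaller than that. *)
Lemma goursat P Q a b c d : a < b -> c < d ->
  (forall x y, a <= x <= b -> c <= y <= d -> closed_form_at P Q x y) ->
  boundary_integral P Q a b c d = 0.
Proof.
move=> ab cd cl; apply/eqP; apply: contrapT => /negP J0.
pose area a b c d : R := (b - a) * (d - c).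
have A0 : 0 < area a b c d by rewrite mulr_gt0 ?subr_gt0.
(* Half the actual ratio, so that the initial rectangle is bad with strict inequality. *)
pose eta := `|boundary_integral P Q a b c d| / (2 * area a b c d).
have J1 : 0 < `|boundary_integral P Q a b c d| by rewrite normr_gt0.
have eta0 : 0 < eta by rewrite divr_gt0// mulr_gt0.
pose inside a' b' c' d' := [/\ a <= a', b' <= b, c <= c' & d' <= d].
have cP a' b' c' d' y : inside a' b' c' d' -> c' <= y <= d' ->
    cont_seg (fun x => P x y) a' b'.
  move=> [i1 i2 i3 i4] /andP[y1 y2] x /andP[x1 x2].
  apply: (@closed_form_continuous1 P Q); apply: cl; apply/andP; split; lra.
have cQ a' b' c' d' x : inside a' b' c' d' -> a' <= x <= b' -> cont_seg (Q x) c' d'.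
  move=> [i1 i2 i3 i4] /andP[y1 y2] y /andP[x1 x2].
  apply: (@closed_form_continuous2 P Q); apply: cl; apply/andP; split; lra.
pose bad a' b' c' d' := inside a' b' c' d' /\
  eta * area a' b' c' d' < `|boundary_integral P Q a' b' c' d'|.
have [||x [y xy]] := @rectangle_bisection R bad a b c d (ltW ab) (ltW cd).
- split; first by split.
  have -> : eta * area a b c d = `|boundary_integral P Q a b c d| / 2.
    by rewrite /eta; field; rewrite gt_eqF.
  lra.
- move=> a' b' c' d' ab' cd' [ins bd] m n.
  have ma : a' <= m by rewrite /m; lra.
  have mb : m <= b' by rewrite /m; lra.
  have nc : c' <= n by rewrite /n; lra.
  have nd : n <= d' by rewrite /n; lra.
  have [i1 i2 i3 i4] := ins.
  have insl : inside a' m c' d' by split => //; exact: le_trans mb i2.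
  have insr : inside m b' c' d' by split => //; exact: le_trans i1 ma.
  have insi (i j : bool) : inside (if i then m else a') (if i then b' else m)
                           (if j then n else c') (if j then d' else n).
    by case: i; case: j; split => //;
      [exact: le_trans i1 ma|exact: le_trans i3 nc|exact: le_trans i1 ma|exact: le_trans nd i4
      |exact: le_trans mb i2|exact: le_trans i3 nc|exact: le_trans mb i2|exact: le_trans nd i4].
  (* If all four quarters were good, their bounds would add up to [eta] times the area of the
     parent. *)
  apply: contrapT => nbad.
  have sm (i j : bool) : `|boundary_integral P Q (if i then m else a') (if i then b' else m)
       (if j then n else c') (if j then d' else n)| <= eta * (area a' b' c' d' / 4).
    rewrite leNgt; apply/negP => lt4; apply: nbad; exists i, j; split; first exact: insi.
    suff -> : area (if i then m else a') (if i then b' else m)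
       (if j then n else c') (if j then d' else n) = area a' b' c' d' / 4 by [].
    by rewrite /area /m /n; case: (i); case: (j); field.
  have := sm false false; have := sm false true; have := sm true false; have := sm true true.
  rewrite /= => s1 s2 s3 s4; move: bd; apply/negP; rewrite -leNgt.
  rewrite (@boundary_integral_splitx P Q a' m b' c' d')//; first last.
    - apply: (cQ a' b') => //; rewrite ?lexx ?ab'//.
    - apply: (cQ a' b') => //; rewrite ?lexx ?ma ?mb//.
    - apply: (cQ a' b') => //; rewrite ?lexx ?ab'//.
    - apply: (cP a' b' c' d') => //; rewrite ?lexx ?cd'//.
    - apply: (cP a' b' c' d') => //; rewrite ?lexx ?cd'//.
  rewrite (@boundary_integral_splity P Q a' m c' n d')//; first last.
    - apply: (cQ a' b') => //; rewrite ?lexx ?ma ?mb//.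
    - apply: (cQ a' b') => //; rewrite ?lexx ?ab'//.
    - by apply: (cP a' m c' d'); [by []|rewrite ?lexx ?cd'].
    - by apply: (cP a' m c' d'); [by []|rewrite ?nc ?nd].
    - by apply: (cP a' m c' d'); [by []|rewrite ?lexx ?cd'].
  rewrite (@boundary_integral_splity P Q m b' c' n d')//; first last.
    - apply: (cQ a' b') => //; rewrite ?lexx ?ab'//.
    - apply: (cQ a' b') => //; rewrite ?lexx ?ma ?mb//.
    - by apply: (cP m b' c' d'); [by []|rewrite ?lexx ?cd'].
    - by apply: (cP m b' c' d'); [by []|rewrite ?nc ?nd].
    - by apply: (cP m b' c' d'); [by []|rewrite ?lexx ?cd'].
  apply: (le_trans (ler_normD _ _)).
  apply: (le_trans (lerD (ler_normD _ _) (ler_normD _ _))); lra.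
have [a0 [b0 [c0 [d0 [[[i1 i2 i3 i4] _] /andP[x1 x2] /andP[y1 y2] _ _]]]]] := xy 0%N.
have [A [B [D hd]]] : closed_form_at P Q x y by apply: cl; apply/andP; split; lra.
pose S := (b - a) + (d - c).
have S0 : 0 < S by rewrite addr_gt0 ?subr_gt0.
(* Chosen with 2 e S^2 = [eta] times the initial area: the bound of [boundary_integral_small] at
   step k is then exactly [eta] times the area of the k-th rectangle. *)
pose e := eta * area a b c d / (2 * S * S).
have e0 : 0 < e by rewrite divr_gt0 ?(mulr_gt0 eta0 A0)// !mulr_gt0.
have [r r0 hr] := hd e e0.
have [k kr] : exists k : nat, S / 2 ^+ k <= r.
  have := @cvg_geometric R S (2^-1).
  rewrite ger0_norm// => /(_ _)h.
  have /h : (2^-1 : R) < 1 by lra.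
  move/cvgrPdist_le => /(_ r r0) [N _ hN]; exists N.
  have := hN N (leqnn N); rewrite sub0r normrN /= exprVn ger0_norm//.
  by rewrite divr_ge0// ltW.
have [a1 [b1 [c1 [d1 [[ins bd] /andP[ax bx] /andP[cy dy] w1 w2]]]]] := xy k.
have k0 : 0 < (2 : R) ^+ k by rewrite exprn_gt0.
have wS : (b1 - a1) + (d1 - c1) = S / 2 ^+ k by rewrite w1 w2 -mulrDl.
move: bd; apply/negP; rewrite -leNgt.
have ab1 : a1 <= b1 by lra.
have cd1 : c1 <= d1 by lra.
apply: (le_trans (@boundary_integral_small P Q x y a1 b1 c1 d1 A B D (e * (S / 2 ^+ k)) _ _ _ _ _ _ _ _)).
- by rewrite ax bx.
- by rewrite cy dy.
- by apply: ltW; rewrite mulr_gt0// divr_gt0.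
- by apply: (cP a1 b1 c1 d1) => //; rewrite lexx cd1.
- by apply: (cP a1 b1 c1 d1) => //; rewrite lexx cd1.
- by apply: (cQ a1 b1) => //; rewrite lexx ab1.
- by apply: (cQ a1 b1) => //; rewrite lexx ab1.
- move=> s t /andP[s1 s2] /andP[t1 t2].
  have sw : `|s - x| <= b1 - a1 by rewrite ler_norml; apply/andP; split; lra.
  have tw : `|t - y| <= d1 - c1 by rewrite ler_norml; apply/andP; split; lra.
  have [||h1 h2] := hr (s - x) (t - y); [lra|lra|].
  rewrite ![_ + (_ - _)]addrC !subrK in h1 h2.
  have le2 : e * (`|s - x| + `|t - y|) <= e * (S / 2 ^+ k).
    by rewrite ler_pM2l//; lra.
  by split; [exact: le_trans h1 le2|exact: le_trans h2 le2].
rewrite wS /area w1 w2 /e -/(area a b c d).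
rewrite le_eqVlt; apply/orP; left; apply/eqP; rewrite mulr2n /area; field.
by rewrite ?gt_eqF.
Qed.

End Goursat.

(** * Complex differentiable functions *)

Section ComplexDifferentiability.
Variable R : realType.
Notation C := (R * R)%type.
Implicit Types (z w : C) (f g : C -> C).

(** Carries identities with quotients into a field type, where [field] applies. *)
Definition toC z : complex R := Complex z.1 z.2.

Lemma toC_inj z w : toC z = toC w -> z = w.
Proof. by case: z w => [x y] [x' y'] [-> ->]. Qed.

Lemma toCD z w : toC (cadd z w) = toC z + toC w. Proof. by []. Qed.

Lemma toCB z w : toC (csub z w) = toC z - toC w. Proof. by []. Qed.

Lemma toCM z w : toC (cmul z w) = toC z * toC w. Proof. by []. Qed.

Lemma toC_neq0 z : cabs z != 0 -> toC z != 0.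
Proof.
by rewrite cabs_eq0; apply: contra => /eqP e; apply/eqP/toC_inj; rewrite e.
Qed.

Lemma toCV z : cabs z != 0 -> toC (cinv z) = (toC z)^-1.
Proof.
move=> z0; apply: (mulIf (toC_neq0 z0)); rewrite -toCM cmul_inv// mulVf//.
exact: toC_neq0.
Qed.

Lemma cadd0 z : cadd z (0, 0) = z.
Proof. by case: z => x y; rewrite /cadd/= !addr0. Qed.

Lemma cdifferentiable_lipschitz f z : cdifferentiable_at f z ->
  exists2 K : R, 0 < K & exists2 d : R, 0 < d & forall h, cabs h < d ->
    cabs (csub (f (cadd z h)) (f z)) <= K * cabs h.
Proof.
move=> [c hc]; exists (cabs c + 1); first by rewrite ltr_wpDl ?cabs_ge0.
have [d d0 hd] := hc 1 ltr01; exists d => // h hlt.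
have [/eqP|h0] := eqVneq (cabs h) 0.
  rewrite cabs_eq0 => /eqP ->; rewrite cadd0 cabs0 mulr0.
  by rewrite /csub !subrr cabs0.
have hp : 0 < cabs h by rewrite lt_neqAle eq_sym h0 cabs_ge0.
have := hd h; rewrite hp hlt => /(_ isT); rewrite mul1r => h1.
apply: (le_trans (cabs_le_csub _ (cmul c h))).
by rewrite cabsM mulrDl mul1r lerD2l.
Qed.

Lemma cdifferentiable_cst (a : C) z : cdifferentiable_at (fun=> a) z.
Proof.
exists (0, 0) => e e0; exists 1 => // h _.
have -> : csub (csub a a) (cmul (0, 0) h) = (0, 0).
  by rewrite /csub /cmul/=; congr pair; ring.
by rewrite cabs0 mulr_ge0 ?cabs_ge0// ltW.
Qed.

Lemma cdifferentiableM f g z : cdifferentiable_at f z -> cdifferentiable_at g z ->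
  cdifferentiable_at (fun w => cmul (f w) (g w)) z.
Proof.
move=> df dg; have [K K0 [d0 d00 lip]] := cdifferentiable_lipschitz dg.
case: df => a ha; case: dg => b hb.
exists (cadd (cmul a (g z)) (cmul (f z) b)) => e e0.
pose M := cabs (g z) + K * d0 + cabs (f z) + 1.
have M0 : 0 < M.
  by rewrite ltr_wpDl// !addr_ge0 ?cabs_ge0// mulr_ge0// ltW.
have eM : 0 < e / (2 * M) by rewrite divr_gt0// mulr_gt0.
have [d1 d10 h1] := ha _ eM; have [d2 d20 h2] := hb _ eM.
pose d3 := e / (2 * (cabs a + 1) * K).
have a1 : 0 < cabs a + 1 by rewrite ltr_wpDl ?cabs_ge0.
have d30 : 0 < d3 by rewrite divr_gt0// !mulr_gt0.
exists (Num.min (Num.min d0 d1) (Num.min d2 d3)); first by rewrite !lt_min d00 d10 d20 d30.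
move=> h /andP[hp]; rewrite !lt_min => /andP[/andP[hd0 hd1] /andP[hd2 hd3]].
have {}h1 := h1 h (introT andP (conj hp hd1)).
have {}h2 := h2 h (introT andP (conj hp hd2)).
have l := lip h hd0.
have -> : csub (csub (cmul (f (cadd z h)) (g (cadd z h))) (cmul (f z) (g z)))
    (cmul (cadd (cmul a (g z)) (cmul (f z) b)) h) =
  cadd (cadd (cmul (csub (csub (f (cadd z h)) (f z)) (cmul a h)) (g (cadd z h)))
    (cmul (f z) (csub (csub (g (cadd z h)) (g z)) (cmul b h))))
    (cmul (cmul a h) (csub (g (cadd z h)) (g z))).
  by rewrite /csub /cadd /cmul/=; congr pair; ring.
apply: (le_trans (cabs_triangle _ _)).
apply: (le_trans (lerD (cabs_triangle _ _) (lexx _))); rewrite !cabsM.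
have gb : cabs (g (cadd z h)) <= cabs (g z) + K * d0.
  apply: (le_trans (cabs_le_csub _ (g z))); rewrite lerD2l (le_trans l)//.
  by rewrite ler_pM2l// ltW.
have t12 : cabs (csub (csub (f (cadd z h)) (f z)) (cmul a h)) * cabs (g (cadd z h)) +
    cabs (f z) * cabs (csub (csub (g (cadd z h)) (g z)) (cmul b h)) <= e / 2 * cabs h.
  apply: (@le_trans _ _ (e / (2 * M) * cabs h * (cabs (g z) + K * d0) +
     cabs (f z) * (e / (2 * M) * cabs h))).
    by apply: lerD; [apply: ler_pM; rewrite ?cabs_ge0|rewrite ler_wpM2l ?cabs_ge0].
  have -> : e / (2 * M) * cabs h * (cabs (g z) + K * d0) +
     cabs (f z) * (e / (2 * M) * cabs h) =
     (e / (2 * M) * cabs h) * (cabs (g z) + K * d0 + cabs (f z)) by ring.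
  have -> : e / 2 * cabs h = (e / (2 * M) * cabs h) * M by field; rewrite gt_eqF.
  by apply: ler_wpM2l; [rewrite ltW// mulr_gt0|rewrite /M; lra].
have t3 : cabs a * cabs h * cabs (csub (g (cadd z h)) (g z)) <= e / 2 * cabs h.
  apply: (@le_trans _ _ ((cabs a + 1) * cabs h * (K * d3))).
    apply: ler_pM; rewrite ?mulr_ge0 ?cabs_ge0//.
      by rewrite ler_pM2r// lerDl.
    by rewrite (le_trans l)// ler_pM2l// ltW.
  rewrite le_eqVlt; apply/orP; left; apply/eqP; rewrite /d3; field.
  by rewrite !gt_eqF.
lra.
Qed.

Lemma cdifferentiable_inv_affine (p q : C) z : cabs (cadd p (cmul q z)) != 0 ->
  cdifferentiable_at (fun w => cinv (cadd p (cmul q w))) z.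
Proof.
set G := cadd p (cmul q z) => G0.
have Gp : 0 < cabs G by rewrite lt_neqAle eq_sym G0 cabs_ge0.
exists (csub (0, 0) (cmul q (cmul (cinv G) (cinv G)))) => e e0.
have q1 : 0 < cabs q + 1 by rewrite ltr_wpDl ?cabs_ge0.
(* [d1] keeps the denominator above |G|/2, and [d2] makes the remainder (qh)^2/(G^2 G') at most
   e|h|. The added 1 guards against q = 0. *)
pose d1 := cabs G / (2 * (cabs q + 1)).
pose d2 := e * cabs G ^+ 3 / (2 * (cabs q + 1) ^+ 2).
have d10 : 0 < d1 by rewrite divr_gt0// mulr_gt0.
have d20 : 0 < d2 by rewrite divr_gt0 ?mulr_gt0 ?exprn_gt0.
exists (Num.min d1 d2); first by rewrite lt_min d10.
move=> h /andP[hp]; rewrite lt_min => /andP[hd1 hd2].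
have GE : cadd p (cmul q (cadd z h)) = cadd G (cmul q h).
  by rewrite /G /cadd /cmul/=; congr pair; ring.
rewrite GE; set G' := cadd G (cmul q h).
have qh : cabs q * cabs h <= cabs G / 2.
  apply: (@le_trans _ _ ((cabs q + 1) * d1)).
    by apply: ler_pM; rewrite ?cabs_ge0 ?lerDl// ltW.
  by rewrite le_eqVlt; apply/orP; left; apply/eqP; rewrite /d1; field; rewrite gt_eqF.
have G'p : cabs G / 2 <= cabs G'.
  have := cabs_le_csub G G'.
  have -> : csub G G' = csub (0, 0) (cmul q h).
    by rewrite /G' /csub /cadd/=; congr pair; ring.
  have -> : cabs (csub (0, 0) (cmul q h)) = cabs q * cabs h.
    rewrite csubC -cabsM; congr cabs; rewrite /csub/=; congr pair; ring.
  lra.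
have G'0 : cabs G' != 0 by rewrite gt_eqF//; lra.
have -> : csub (csub (cinv G') (cinv G)) (cmul (csub (0, 0) (cmul q (cmul (cinv G) (cinv G)))) h)
  = cmul (cmul (cmul q h) (cmul q h)) (cmul (cmul (cinv G) (cinv G)) (cinv G')).
  apply: toC_inj; rewrite !(toCB, toCM, toCD, toCV)//.
  have -> : toC (0, 0) = 0 by [].
  have e1 : toC G' = toC G + toC q * toC h by [].
  have := toC_neq0 G'0; rewrite e1 => n1; have n2 := toC_neq0 G0.
  by field; rewrite n1 n2.
rewrite !cabsM !cabs_inv.
have -> : cabs q * cabs h * (cabs q * cabs h) * ((cabs G)^-1 / cabs G / cabs G') =
   (cabs q * (cabs q * cabs h) / (cabs G ^+ 2 * cabs G')) * cabs h.
  by field; rewrite G0 G'0.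
rewrite ler_pM2r// ler_pdivrMr; last by rewrite mulr_gt0 ?exprn_gt0//; lra.
apply: (@le_trans _ _ (e * (cabs G ^+ 2 * (cabs G / 2)))); last first.
  by rewrite ler_pM2l// ler_pM2l// exprn_gt0.
apply: (@le_trans _ _ ((cabs q + 1) * ((cabs q + 1) * d2))).
  apply: ler_pM; rewrite ?mulr_ge0 ?cabs_ge0 ?lerDl//.
  by apply: ler_pM; rewrite ?cabs_ge0 ?lerDl// ltW.
rewrite le_eqVlt; apply/orP; left; apply/eqP; rewrite /d2; field.
by rewrite gt_eqF.
Qed.

Definition cpow z n : C := iter n (cmul z) (cone R).

Lemma cabs_pow z n : cabs (cpow z n) = cabs z ^+ n.
Proof.
elim: n => [|n ih]; first by rewrite expr0 cabs_one.
by rewrite /cpow iterS cabsM -/(cpow z n) ih exprS.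
Qed.

Lemma cdifferentiable_pow f z n : cdifferentiable_at f z ->
  cdifferentiable_at (fun w => cpow (f w) n) z.
Proof.
move=> df; elim: n => [|n ih]; first exact: cdifferentiable_cst.
exact: cdifferentiableM.
Qed.

(** The form is the imaginary part of g dz, and its closedness is one of the Cauchy-Riemann
    equations: for g' = p + iq, both cross derivatives equal p. *)
Lemma cdifferentiable_closed_form g z : cdifferentiable_at g z ->
  closed_form_at (fun x y => (g (x, y)).2) (fun x y => (g (x, y)).1) z.1 z.2.
Proof.
case: z => x y [[p q] hc] /=; exists q, p, (- q) => e e0.
have [d d0 hd] := hc e e0; exists (d / 4); first by rewrite divr_gt0.
move=> h k hr kr.
have [/eqP|hk0] := eqVneq (cabs (h, k)) 0.
  rewrite cabs_eq0 => /eqP [-> ->]; rewrite !addr0 !mulr0 !subr0 !subrr normr0.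
  by rewrite addr0 mulr0.
have hp : 0 < cabs (h, k) by rewrite lt_neqAle eq_sym hk0 cabs_ge0.
have hle := cabs_le_norms (h, k); rewrite /= in hle.
have := hd (h, k); rewrite hp (_ : cabs (h, k) < d) => [/(_ isT) hh|]; last lra.
have eh : e * cabs (h, k) <= e * (`|h| + `|k|) by rewrite ler_pM2l.
split.
- have := le_trans (normr_snd_cabs _) (le_trans hh eh).
  by rewrite /csub /cmul /cadd/=; congr (_ <= _); congr `|_|; ring.
- have := le_trans (normr_fst_cabs _) (le_trans hh eh).
  by rewrite /csub /cmul /cadd/=; congr (_ <= _); congr `|_|; ring.
Qed.

Lemma cdifferentiable_cabs_near f z (e : R) : cdifferentiable_at f z -> 0 < e ->
  exists2 d : R, 0 < d & forall w, `|w.1 - z.1| < d -> `|w.2 - z.2| < d ->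
    `|cabs (f w) - cabs (f z)| <= e /\ cabs (csub (f w) (f z)) <= e.
Proof.
move=> df e0; have [K K0 [d d0 lip]] := cdifferentiable_lipschitz df.
exists (Num.min (d / 2) (e / (2 * K))).
  by rewrite lt_min !divr_gt0// mulr_gt0.
move=> w; rewrite !lt_min => /andP[a1 a2] /andP[b1 b2].
have hn := cabs_le_norms (csub w z); rewrite /= in hn.
have wE : cadd z (csub w z) = w.
  by case: (z) (w) => [? ?] [? ?]; rewrite /cadd /csub/=; congr pair; ring.
have := lip (csub w z); rewrite wE => /(_ _)l.
have {}l : cabs (csub (f w) (f z)) <= K * cabs (csub w z) by apply: l; lra.
have l2 : cabs (csub (f w) (f z)) <= e.
  apply: (le_trans l); rewrite mulrC -ler_pdivlMr//.
  have : e / (2 * K) = e / K / 2 by field; rewrite gt_eqF.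
  lra.
split=> //.
have h1 := cabs_le_csub (f w) (f z); have h2 := cabs_le_csub (f z) (f w).
rewrite csubC in h2; rewrite ler_norml; apply/andP; split; lra.
Qed.

End ComplexDifferentiability.

(** * Measurability of semicontinuous functions of the plane *)

Section PlaneMeasurability.
Variable R : realType.
Notation C := (R * R)%type.

(** Superlevel sets are relatively open in [D], hence traces of countable unions of open boxes with
    rational corners. *)
Lemma measurable_fun_lower_semicontinuous2 (D : set C) (g : C -> R) : measurable D ->
  (forall z, D z -> forall e : R, 0 < e -> exists2 d : R, 0 < d &
    forall w : C, `|w.1 - z.1| < d -> `|w.2 - z.2| < d -> g z - e < g w) ->
  measurable_fun D g.
Proof.
move=> mD lsc; apply: (measurability _ (RGenOInfty.measurableE R)) => //.
move=> /= _ [_ [a ->]] <-.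
pose B (i : (rat * rat) * (rat * rat)) : set C :=
  [set w | [/\ ratr i.1.1 < w.1, w.1 < ratr i.1.2, ratr i.2.1 < w.2 & w.2 < ratr i.2.2]].
pose I i := `[< B i `<=` [set w | a < g w] >].
have mB i : measurable (B i).
  have -> : B i = `]ratr i.1.1, ratr i.1.2[%classic `*` `]ratr i.2.1, ratr i.2.2[%classic.
    apply/seteqP; split => w /=; rewrite !in_itv/=.
      by move=> [-> -> -> ->].
    by move=> [/andP[? ?] /andP[? ?]].
  by apply: measurableX; exact: measurable_itv.
have -> : D `&` g @^-1` `]a, +oo[%classic = D `&` \bigcup_i (if I i then B i else set0).
  apply/seteqP; split => [z|z] /= [Dz].
    rewrite in_itv/= andbT => az; split => //.
    have [d d0 hd] := lsc z Dz (g z - a) ltac:(by rewrite subr_gt0).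
    have [|q1] := @rat_in_itvoo R (z.1 - d) z.1; first lra.
    rewrite in_itv/= => /andP[q11 q12].
    have [|q2] := @rat_in_itvoo R z.1 (z.1 + d); first lra.
    rewrite in_itv/= => /andP[q21 q22].
    have [|q3] := @rat_in_itvoo R (z.2 - d) z.2; first lra.
    rewrite in_itv/= => /andP[q31 q32].
    have [|q4] := @rat_in_itvoo R z.2 (z.2 + d); first lra.
    rewrite in_itv/= => /andP[q41 q42].
    exists ((q1, q2), (q3, q4)) => //.
    have -> : I ((q1, q2), (q3, q4)).
      apply/asboolP => w [/= w1 w2 w3 w4].
      have : g z - (g z - a) < g w.
        by apply: hd; rewrite ltr_norml; apply/andP; split; lra.
      lra.
    by split.
  move=> [i _]; case: ifP => // /asboolP h /h /= az; split => //.
  by rewrite in_itv/= az.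
apply: measurableI => //; apply: countable_bigcupT_measurable; first exact: countableP.
by move=> i; case: ifP.
Qed.

End PlaneMeasurability.

(** * The sub-mean value inequality *)

Section SubMeanValue.
Variable R : realType.
Notation C := (R * R)%type.
Notation leb := (@lebesgue_measure R).
Implicit Types (f : C -> C) (z : C).

(** On a side of the square of half-side r the numerator is at least (3/4 - 1/4) m r and the
    denominator at most 2 r^2. *)
Lemma kernel_lower_bound (m F1 F2 r k : R) : 0 < m -> 0 < r -> `|k| <= r ->
  `|F1 - m| <= m / 4 -> `|F2| <= m / 4 ->
  m / (4 * r) <= (F1 * r + F2 * k) / (r ^+ 2 + k ^+ 2).
Proof.
move=> m0 r0 kr; rewrite !ler_norml => /andP[f1 f2] /andP[g1 g2].
have k2 : k ^+ 2 <= r ^+ 2 by rewrite -real_normK ?num_real// ler_sqr ?nnegrE// ltW.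
have r2 : 0 < r ^+ 2 by rewrite exprn_gt0.
rewrite ler_pdivlMr; last by rewrite ltr_pwDl// sqr_ge0.
apply: (@le_trans _ _ (m / (4 * r) * (2 * r ^+ 2))).
  by rewrite ler_pM2l ?divr_gt0 ?mulr_gt0//; lra.
have -> : m / (4 * r) * (2 * r ^+ 2) = m * r / 2 by field; rewrite gt_eqF.
have : `|F2 * k| <= m / 4 * r.
  by rewrite normrM ler_pM// ler_norml; apply/andP; split.
rewrite ler_norml => /andP[h1 h2].
have : m * (3 / 4) * r <= F1 * r by rewrite ler_pM2r//; lra.
lra.
Qed.

Lemma cauchy_kernelE f (z0 : C) x y :
  let w := csub (x, y) z0 in
  let F := f (x, y) in
  cmul F (cinv w) = ((F.1 * w.1 + F.2 * w.2) / (w.1 ^+ 2 + w.2 ^+ 2),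
                     (F.2 * w.1 - F.1 * w.2) / (w.1 ^+ 2 + w.2 ^+ 2)).
Proof. by move=> w F; rewrite /cmul /cinv/= sqr_cabs; congr pair; ring. Qed.

Definition cauchy_kernel f z0 w : C := cmul (f w) (cinv (csub w z0)).

Lemma cauchy_kernel_closed f z0 x y : cdifferentiable_at f (x, y) ->
  (x != z0.1) || (y != z0.2) ->
  closed_form_at (fun x y => (cauchy_kernel f z0 (x, y)).2)
                 (fun x y => (cauchy_kernel f z0 (x, y)).1) x y.
Proof.
move=> df ne; apply: (@cdifferentiable_closed_form R (cauchy_kernel f z0) (x, y)).
apply: cdifferentiableM => //.
have -> : (fun w => cinv (csub w z0)) =
   (fun w : C => cinv (cadd (- z0.1, - z0.2) (cmul (cone R) w))).
  by apply/funext => w; congr cinv; rewrite /csub /cadd /cmul/=; congr pair; ring.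
apply: cdifferentiable_inv_affine; rewrite cabs_eq0 -pair_eqE/= negb_and.
rewrite /cmul/= !mul1r !mul0r subr0 addr0.
by rewrite ![- _ + _]addrC !subr_eq0.
Qed.

Lemma nested_bounds (x0 s r x1 x2 : R) : 0 < r -> r < x0 - x1 -> r < x2 - x0 ->
  x0 - s <= x1 -> x2 <= x0 + s ->
  [/\ x0 - s <= x1 <= x0 + s, x0 - s <= x0 - r <= x0 + s,
      x0 - s <= x0 + r <= x0 + s & x0 - s <= x2 <= x0 + s] /\
  [/\ x1 != x0, x0 - r != x0, x0 + r != x0 & x2 != x0] /\
  [/\ x1 < x0 - r, x0 - r < x0 + r, x0 + r < x2, x0 - r < x0 & x0 < x0 + r] /\
  [/\ x1 < x2 & x0 - r < x2].
Proof.
move=> h1 h2 h3 h4 h5; split; first by split; apply/andP; split; lra.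
by split; [split; apply/eqP; lra|split; split; lra].
Qed.

Lemma side_bounds (x0 s x1 x2 : R) : 0 < s ->
  x0 - 2 * s <= x1 <= x0 - s -> x0 + s <= x2 <= x0 + 2 * s ->
  [/\ x1 != x0, x2 != x0, x0 - 2 * s <= x1 <= x0 + 2 * s & x0 - 2 * s <= x2 <= x0 + 2 * s] /\
  [/\ s <= `|x1 - x0| <= 2 * s, s <= `|x2 - x0| <= 2 * s, x1 <= x2,
      x0 - 2 * s <= x1 < x0 & x0 < x2 <= x0 + 2 * s].
Proof.
move=> h1 /andP[h2 h3] /andP[h4 h5]; split.
  by split; [apply/eqP; lra|apply/eqP; lra|apply/andP; split; lra|apply/andP; split; lra].
split.
- by rewrite ler0_norm; [apply/andP; split|]; lra.
- by rewrite ger0_norm; [apply/andP; split|]; lra.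
- lra.
- by apply/andP; split; lra.
- by apply/andP; split; lra.
Qed.

(* Half of Cauchy's formula: the boundary integral of Im (f dz / (z - z0)) does not
   depend on the rectangle around z0, and a tiny square around z0 bounds it below. *)
Lemma cauchy_rectangle_lower f z0 (s m x1 x2 y1 y2 : R) : 0 < m -> f z0 = (m, 0) ->
  (forall x y, `|x - z0.1| <= s -> `|y - z0.2| <= s -> cdifferentiable_at f (x, y)) ->
  z0.1 - s <= x1 < z0.1 -> z0.1 < x2 <= z0.1 + s ->
  z0.2 - s <= y1 < z0.2 -> z0.2 < y2 <= z0.2 + s ->
  2 * m <= boundary_integral (fun x y => (cauchy_kernel f z0 (x, y)).2)
                             (fun x y => (cauchy_kernel f z0 (x, y)).1) x1 x2 y1 y2.
Proof.
move=> m0 fz0 df /andP[x11 x12] /andP[x21 x22] /andP[y11 y12] /andP[y21 y22].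
set g := cauchy_kernel f z0.
set V := fun x y => (g (x, y)).2; set U := fun x y => (g (x, y)).1.
set x0 := z0.1; set y0 := z0.2.
have cl x y : `|x - x0| <= s -> `|y - y0| <= s -> (x != x0) || (y != y0) ->
    closed_form_at V U x y.
  by move=> hx hy ne; apply: cauchy_kernel_closed => //; exact: df.
have s0 : 0 < s by lra.
have [d d0 hd] : exists2 d : R, 0 < d & forall w : C, `|w.1 - z0.1| < d ->
    `|w.2 - z0.2| < d -> `|cabs (f w) - cabs (f z0)| <= m / 4 /\
    cabs (csub (f w) (f z0)) <= m / 4.
  apply: cdifferentiable_cabs_near; last by rewrite divr_gt0.
  by rewrite (surjective_pairing z0); apply: df; rewrite subrr normr0 ltW.
(* Halved margins: the square of half-side r lies strictly inside the rectangle and where f differs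
   from m by at most m/4. *)
pose r := Num.min (Num.min (d / 2) (Num.min (x0 - x1) (x2 - x0) / 2))
                 (Num.min (y0 - y1) (y2 - y0) / 2).
have r0 : 0 < r.
  by rewrite /r !lt_min !divr_gt0 ?lt_min ?subr_gt0 ?x12 ?x21 ?y12 ?y21.
have [rd rx1 rx2 ry1 ry2] : [/\ r < d, r < x0 - x1, r < x2 - x0, r < y0 - y1 & r < y2 - y0].
  have h1 : r <= d / 2 by rewrite /r !ge_min lexx.
  have h2 : r <= Num.min (x0 - x1) (x2 - x0) / 2 by rewrite /r !ge_min lexx orbT.
  have h3 : r <= Num.min (y0 - y1) (y2 - y0) / 2 by rewrite /r !ge_min lexx orbT.
  have h4 : Num.min (x0 - x1) (x2 - x0) <= x0 - x1 by rewrite ge_min lexx.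
  have h5 : Num.min (x0 - x1) (x2 - x0) <= x2 - x0 by rewrite ge_min lexx orbT.
  have h6 : Num.min (y0 - y1) (y2 - y0) <= y0 - y1 by rewrite ge_min lexx.
  have h7 : Num.min (y0 - y1) (y2 - y0) <= y2 - y0 by rewrite ge_min lexx orbT.
  by split; lra.
have [[xx1 xx2 xx3 xx4] [[xn1 xn2 xn3 xn4] [[xo1 xo2 xo3 xo4 xo5] [xo6 xo7]]]] :=
  nested_bounds r0 rx1 rx2 x11 x22.
have [[yy1 yy2 yy3 yy4] [[yn1 yn2 yn3 yn4] [[yo1 yo2 yo3 yo4 yo5] [yo6 yo7]]]] :=
  nested_bounds r0 ry1 ry2 y11 y22.
have cV y a b : y != y0 -> y0 - s <= y <= y0 + s -> x0 - s <= a <= x0 + s ->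
    x0 - s <= b <= x0 + s -> cont_seg (fun x => V x y) a b.
  move=> ny /andP[h1 h2] /andP[ha _] /andP[_ hb] x /andP[xa xb].
  apply: (@closed_form_continuous1 _ V U); apply: cl; rewrite ?ny ?orbT//;
    rewrite ler_distl ?h1 ?h2//.
  by rewrite (le_trans ha xa) (le_trans xb hb).
have cU x a b : x != x0 -> x0 - s <= x <= x0 + s -> y0 - s <= a <= y0 + s ->
    y0 - s <= b <= y0 + s -> cont_seg (U x) a b.
  move=> ny /andP[h1 h2] /andP[ha _] /andP[_ hb] y /andP[xa xb].
  apply: (@closed_form_continuous2 _ V U); apply: cl; rewrite ?ny ?orbT//;
    rewrite ler_distl ?h1 ?h2//.
  by rewrite (le_trans ha xa) (le_trans xb hb).
(* A rectangle that misses [z0] has integral zero, by Goursat. *)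
have ze a b c e : x0 - s <= a <= x0 + s -> a < b -> x0 - s <= b <= x0 + s ->
    y0 - s <= c <= y0 + s -> c < e -> y0 - s <= e <= y0 + s ->
    [|| b < x0, x0 < a, e < y0 | y0 < c] -> boundary_integral V U a b c e = 0.
  move=> /andP[h1 _] h2 /andP[_ h3] /andP[h4 _] h5 /andP[_ h6] ne.
  apply: goursat => // x y /andP[xa xb] /andP[ya yb].
  apply: cl; rewrite ?ler_distl.
  - by rewrite (le_trans h1 xa) (le_trans xb h3).
  - by rewrite (le_trans h4 ya) (le_trans yb h6).
  case/or4P: ne => hne; apply/orP; [left|left|right|right].
  - by rewrite lt_eqF// (le_lt_trans xb).
  - by rewrite gt_eqF// (lt_le_trans hne).
  - by rewrite lt_eqF// (le_lt_trans yb).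
  - by rewrite gt_eqF// (lt_le_trans hne).
(* Dissection into five rectangles: strips below and above, and three pieces of the middle band.
   Only the central square survives. *)
rewrite (@boundary_integral_splity _ V U x1 x2 y1 (y0 - r) y2);
  [|exact: ltW|exact: ltW|exact: cV..|exact: cU|exact: cU].
rewrite (@boundary_integral_splity _ V U x1 x2 (y0 - r) (y0 + r) y2);
  [|exact: ltW|exact: ltW|exact: cV..|exact: cU|exact: cU].
rewrite (@boundary_integral_splitx _ V U x1 (x0 - r) x2 (y0 - r) (y0 + r));
  [|exact: ltW|exact: ltW|exact: cV|exact: cV|exact: cU..].
rewrite (@boundary_integral_splitx _ V U (x0 - r) (x0 + r) x2 (y0 - r) (y0 + r));
  [|exact: ltW|exact: ltW|exact: cV|exact: cV|exact: cU..].
rewrite (ze x1 x2 y1 (y0 - r))//; last by rewrite yo4 !orbT.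
rewrite (ze x1 x2 (y0 + r) y2)//; last by rewrite yo5 !orbT.
rewrite (ze x1 (x0 - r) (y0 - r) (y0 + r))//; last by rewrite xo4.
rewrite (ze (x0 + r) x2 (y0 - r) (y0 + r))//; last by rewrite xo5 !orbT.
rewrite !add0r !addr0 /boundary_integral.
have near x y : `|x - x0| <= r -> `|y - y0| <= r ->
    `|(f (x, y)).1 - m| <= m / 4 /\ `|(f (x, y)).2| <= m / 4.
  move=> hx hy; have [||_ h] := hd (x, y); [exact: le_lt_trans rd|exact: le_lt_trans rd|].
  rewrite fz0 in h; have := normr_fst_cabs (csub (f (x, y)) (m, 0)).
  have := normr_snd_cabs (csub (f (x, y)) (m, 0)); rewrite /= subr0 => h1 h2.
  by split; [exact: le_trans h2 h|exact: le_trans h1 h].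
have kl := kernel_lower_bound.
(* Each of the two horizontal sides contributes at least m/(4r) over a length 2r, so the pair gives
   m; the vertical pair in [i2] gives another m. *)
have i1 : m / (2 * r) * ((x0 + r) - (x0 - r)) <=
    \int[leb]_(x in `[x0 - r, x0 + r]) (V x (y0 - r) - V x (y0 + r)).
  rewrite -Rintegral_seg_cst; last exact: ltW.
  apply: Rintegral_seg_le; first exact: cont_seg_cst.
    by apply: cont_segB; exact: cV.
  move=> x xr; rewrite -ler_distl in xr.
  have [||n1 n2] := near x (y0 - r); [by []|by rewrite addrAC subrr add0r normrN gtr0_norm|].
  have [||n3 n4] := near x (y0 + r); [by []|by rewrite addrAC subrr add0r gtr0_norm|].
  rewrite /V /g /cauchy_kernel !cauchy_kernelE /csub/= -/x0 -/y0.
  have k1 := kl m _ _ r (x - x0) m0 r0 xr n1 n2.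
  have k2 := kl m _ _ r (- (x - x0)) m0 r0 (etrans (congr1 (fun t => t <= r) (normrN _)) xr) n3 n4.
  rewrite sqrrN in k2.
  have -> : y0 - r - y0 = - r by ring.
  have -> : y0 + r - y0 = r by ring.
  rewrite sqrrN [(x - x0) ^+ 2 + _]addrC.
  have -> : m / (2 * r) = m / (4 * r) + m / (4 * r) by field; rewrite gt_eqF.
  rewrite -[X in _ <= _ - X]opprK -[X in _ - - X]mulNr.
  have e1 : (f (x, y0 - r)).2 * (x - x0) - (f (x, y0 - r)).1 * - r =
     (f (x, y0 - r)).1 * r + (f (x, y0 - r)).2 * (x - x0) by ring.
  have e2 : - ((f (x, y0 + r)).2 * (x - x0) - (f (x, y0 + r)).1 * r) =
     (f (x, y0 + r)).1 * r + (f (x, y0 + r)).2 * - (x - x0) by ring.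
  by rewrite e1 e2 opprK lerD.
have i2 : m / (2 * r) * ((y0 + r) - (y0 - r)) <=
    \int[leb]_(y in `[y0 - r, y0 + r]) (U (x0 + r) y - U (x0 - r) y).
  rewrite -Rintegral_seg_cst; last exact: ltW.
  apply: Rintegral_seg_le; first exact: cont_seg_cst.
    by apply: cont_segB; exact: cU.
  move=> y yr; rewrite -ler_distl in yr.
  have [||n1 n2] := near (x0 + r) y; [by rewrite addrAC subrr add0r gtr0_norm|by []|].
  have [||n3 n4] := near (x0 - r) y; [by rewrite addrAC subrr add0r normrN gtr0_norm|by []|].
  rewrite /U /g /cauchy_kernel !cauchy_kernelE /csub/= -/x0 -/y0.
  have k1 := kl m _ _ r (y - y0) m0 r0 yr n1 n2.
  have k2 := kl m _ _ r (- (y - y0)) m0 r0 (etrans (congr1 (fun t => t <= r) (normrN _)) yr) n3 n4.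
  rewrite sqrrN in k2.
  have -> : x0 - r - x0 = - r by ring.
  have -> : x0 + r - x0 = r by ring.
  rewrite sqrrN.
  have -> : m / (2 * r) = m / (4 * r) + m / (4 * r) by field; rewrite gt_eqF.
  rewrite -[X in _ <= _ - X]opprK -[X in _ - - X]mulNr.
  have e2 : - ((f (x0 - r, y)).1 * - r + (f (x0 - r, y)).2 * (y - y0)) =
     (f (x0 - r, y)).1 * r + (f (x0 - r, y)).2 * - (y - y0) by ring.
  by rewrite e2 opprK lerD.
have e1 (a : R) : m / (2 * r) * (a + r - (a - r)) = m by field; rewrite gt_eqF.
by move: i1 i2; rewrite !e1; lra.
Qed.

Lemma Rintegral_seg_sub (g : R -> R) a a' b' b : a <= a' -> a' <= b' -> b' <= b ->
  cont_seg g a b -> (forall x, 0 <= g x) ->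
  \int[leb]_(x in `[a', b']) g x <= \int[leb]_(x in `[a, b]) g x.
Proof.
move=> aa ab bb cg g0.
rewrite (@Rintegral_seg_split _ g a a' b)//; last exact: le_trans bb.
rewrite (@Rintegral_seg_split _ g a' b' b)//; last exact: cont_segS cg.
have := @Rintegral_ge0 _ _ _ leb `[a, a']%classic g (fun x _ => g0 x).
have := @Rintegral_ge0 _ _ _ leb `[b', b]%classic g (fun x _ => g0 x).
lra.
Qed.

Definition square z (s : R) : set C :=
  `[z.1 - s, z.1 + s]%classic `*` `[z.2 - s, z.2 + s]%classic.

Section Squares.
Variables (f : C -> C) (z0 : C) (s : R).
Hypothesis df : forall x y, `|x - z0.1| <= s -> `|y - z0.2| <= s ->
  cdifferentiable_at f (x, y).

Lemma cont_vertical x a b : `|x - z0.1| <= s -> z0.2 - s <= a -> b <= z0.2 + s ->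
  cont_seg (fun y => cabs (f (x, y))) a b.
Proof.
move=> hx ha hb y /andP[ya yb]; apply/cvgrPdist_le => /= e e0.
have [|d d0 hd] := @cdifferentiable_cabs_near R f (x, y) e _ e0.
  by apply: df => //; rewrite ler_norml; apply/andP; split; lra.
exists d => //= t; rewrite /ball/= => ht; rewrite distrC.
by apply: (hd (x, t) _ _).1 => /=; rewrite ?subrr ?normr0// distrC.
Qed.

Lemma cont_horizontal y a b : `|y - z0.2| <= s -> z0.1 - s <= a -> b <= z0.1 + s ->
  cont_seg (fun x => cabs (f (x, y))) a b.
Proof.
move=> hx ha hb x /andP[ya yb]; apply/cvgrPdist_le => /= e e0.
have [|d d0 hd] := @cdifferentiable_cabs_near R f (x, y) e _ e0.
  by apply: df => //; rewrite ler_norml; apply/andP; split; lra.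
exists d => //= t; rewrite /ball/= => ht; rewrite distrC.
by apply: (hd (t, y) _ _).1 => /=; rewrite ?subrr ?normr0// distrC.
Qed.

Lemma measurable_square : measurable (square z0 s).
Proof. by apply: measurableX; exact: measurable_itv. Qed.

Lemma measurable_cabs_square : measurable_fun (square z0 s) (fun z => cabs (f z)).
Proof.
apply: measurable_fun_lower_semicontinuous2; first exact: measurable_square.
move=> z [/=]; rewrite !in_itv/= => /andP[a1 a2] /andP[b1 b2] e e0.
have [|d d0 hd] := @cdifferentiable_cabs_near R f z (e / 2) _ ltac:(by rewrite divr_gt0).
  by rewrite (surjective_pairing z); apply: df; rewrite ler_norml; apply/andP; split; lra.
exists d => // w w1 w2; have [+ _] := hd w w1 w2.
rewrite ler_norml => /andP[]; lra.
Qed.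

End Squares.

Definition col_integral f z0 (s x : R) : R :=
  \int[leb]_(y in `[z0.2 - s, z0.2 + s]) cabs (f (x, y)).

Definition row_integral f z0 (s y : R) : R :=
  \int[leb]_(x in `[z0.1 - s, z0.1 + s]) cabs (f (x, y)).

(** The lower bound 2|f(z0)| meets the upper bound |f|/s for the kernel, valid since every side is
    at distance at least s from [z0]. The line integrals are extended to the whole big square, so
    that the bound for one side does not depend on the position of the others. *)
Lemma cauchy_rectangle_bound f z0 (s x1 x2 y1 y2 : R) : 0 < s ->
  (forall x y, `|x - z0.1| <= 2 * s -> `|y - z0.2| <= 2 * s -> cdifferentiable_at f (x, y)) ->
  z0.1 - 2 * s <= x1 <= z0.1 - s -> z0.1 + s <= x2 <= z0.1 + 2 * s ->
  z0.2 - 2 * s <= y1 <= z0.2 - s -> z0.2 + s <= y2 <= z0.2 + 2 * s ->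
  2 * s * cabs (f z0) <= col_integral f z0 (2 * s) x1 + col_integral f z0 (2 * s) x2 +
    row_integral f z0 (2 * s) y1 + row_integral f z0 (2 * s) y2.
Proof.
move=> s0 df X1 X2 Y1 Y2.
set col := col_integral f z0 (2 * s); set row := row_integral f z0 (2 * s).
have rpos (y : R) : 0 <= row y by apply: Rintegral_ge0 => x _; exact: cabs_ge0.
have cpos (x : R) : 0 <= col x by apply: Rintegral_ge0 => y _; exact: cabs_ge0.
have [fz0|fz0] := eqVneq (cabs (f z0)) 0.
  by rewrite fz0 mulr0 !addr_ge0.
set m := cabs (f z0).
have m0 : 0 < m by rewrite lt_neqAle eq_sym fz0 cabs_ge0.
(* rotate f so that f z0 becomes a positive real *)
pose om : C := ((f z0).1 / m, - (f z0).2 / m).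
have om1 : cabs om = 1.
  rewrite /cabs/= !expr_div_n sqrrN -mulrDl -sqr_cabs -/m divff ?sqrtr1//.
  by rewrite expf_neq0.
pose F w := cmul om (f w).
have aF w : cabs (F w) = cabs (f w) by rewrite cabsM om1 mul1r.
have F0 : F z0 = (m, 0).
  have := sqr_cabs (f z0); rewrite -/m => e.
  rewrite /F /om /cmul/=; congr pair; last by field.
  have -> : (f z0).1 / m * (f z0).1 - - (f z0).2 / m * (f z0).2 =
     ((f z0).1 ^+ 2 + (f z0).2 ^+ 2) / m by field.
  by rewrite -e expr2 mulfK.
have dF x y : `|x - z0.1| <= 2 * s -> `|y - z0.2| <= 2 * s -> cdifferentiable_at F (x, y).
  by move=> hx hy; apply: cdifferentiableM; [exact: cdifferentiable_cst|exact: df].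
have [[xn1 xn2 xx1 xx2] [xs1 xs2 x12 xl xr]] := side_bounds s0 X1 X2.
have [[yn1 yn2 yy1 yy2] [ys1 ys2 y12 yl yr]] := side_bounds s0 Y1 Y2.
have low := @cauchy_rectangle_lower F z0 (2 * s) m x1 x2 y1 y2 m0 F0 dF xl xr yl yr.
set g := cauchy_kernel F z0 in low.
have gb w : s <= `|w.1 - z0.1| \/ s <= `|w.2 - z0.2| -> cabs (g w) <= cabs (f w) / s.
  move=> hw; rewrite /g /cauchy_kernel cabsM cabs_inv aF ler_wpM2l ?cabs_ge0//.
  have ws : s <= cabs (csub w z0).
    by case: hw => h; [apply: (le_trans h (normr_fst_cabs (csub w z0)))|
                       apply: (le_trans h (normr_snd_cabs (csub w z0)))].
  by rewrite lef_pV2 ?posrE//; exact: lt_le_trans ws.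
have cl x y : `|x - z0.1| <= 2 * s -> `|y - z0.2| <= 2 * s ->
    (x != z0.1) || (y != z0.2) ->
    closed_form_at (fun x y => (g (x, y)).2) (fun x y => (g (x, y)).1) x y.
  by move=> hx hy ne; apply: cauchy_kernel_closed => //; exact: dF.
have cV y a b : y != z0.2 -> z0.2 - 2 * s <= y <= z0.2 + 2 * s -> z0.1 - 2 * s <= a ->
    b <= z0.1 + 2 * s -> cont_seg (fun x => (g (x, y)).2) a b.
  move=> ny /andP[h1 h2] ha hb x /andP[xa xb].
  apply: (@closed_form_continuous1 _ (fun x y => (g (x, y)).2) (fun x y => (g (x, y)).1)).
  apply: cl; rewrite ?ny ?orbT// ler_distl ?h1 ?h2//.
  by rewrite (le_trans ha xa) (le_trans xb hb).
have cU x a b : x != z0.1 -> z0.1 - 2 * s <= x <= z0.1 + 2 * s -> z0.2 - 2 * s <= a ->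
    b <= z0.2 + 2 * s -> cont_seg (fun y => (g (x, y)).1) a b.
  move=> ny /andP[h1 h2] ha hb y /andP[xa xb].
  apply: (@closed_form_continuous2 _ (fun x y => (g (x, y)).2) (fun x y => (g (x, y)).1)).
  apply: cl; rewrite ?ny ?orbT// ler_distl ?h1 ?h2//.
  by rewrite (le_trans ha xa) (le_trans xb hb).
rewrite /boundary_integral in low.
have cstM (h : R -> R) (a b : R) : cont_seg h a b -> cont_seg (fun x => h x / s) a b.
  by move=> ch x xab; apply: continuousM; [exact: ch|exact: cst_continuous].
have nV y a b : y != z0.2 -> z0.2 - 2 * s <= y <= z0.2 + 2 * s ->
    s <= `|y - z0.2| <= 2 * s -> z0.1 - 2 * s <= a -> a <= b -> b <= z0.1 + 2 * s ->
    `|\int[leb]_(x in `[a, b]) (g (x, y)).2| <= row y / s.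
  move=> yne ybd /andP[hy2 hy1] ha ab hb.
  have ch : cont_seg (fun x => cabs (f (x, y))) (z0.1 - 2 * s) (z0.1 + 2 * s).
    by apply: (cont_horizontal df) => //; rewrite lexx.
  have cg : cont_seg (fun x => (g (x, y)).2) a b by exact: cV.
  have cab : cont_seg (fun x => cabs (f (x, y))) a b by exact: cont_segS ch.
  apply: (@le_trans _ _ (\int[leb]_(x in `[a, b]) (cabs (f (x, y)) / s))).
    have le1 x : a <= x <= b -> `|(g (x, y)).2| <= cabs (f (x, y)) / s.
      by move=> _; apply: (le_trans (normr_snd_cabs _)); apply: gb; right.
    rewrite ler_norml; apply/andP; split; last first.
      apply: Rintegral_seg_le => //; first exact: cstM.
      by move=> x /le1; rewrite ler_norml => /andP[].
    rewrite -mulN1r -RintegralZl//; last exact: cont_seg_integrable (cstM _ _ _ cab).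
    apply: Rintegral_seg_le => //.
      move=> x xab; apply: continuousM; [exact: cst_continuous|exact: (cstM _ _ _ cab _ xab)].
    by move=> x /le1; rewrite ler_norml mulN1r => /andP[].
  rewrite RintegralZr//; last exact: cont_seg_integrable cab.
  rewrite ler_pM2r ?invr_gt0//; apply: Rintegral_seg_sub => //.
  by move=> x; exact: cabs_ge0.
have nU x a b : x != z0.1 -> z0.1 - 2 * s <= x <= z0.1 + 2 * s ->
    s <= `|x - z0.1| <= 2 * s -> z0.2 - 2 * s <= a -> a <= b -> b <= z0.2 + 2 * s ->
    `|\int[leb]_(y in `[a, b]) (g (x, y)).1| <= col x / s.
  move=> yne ybd /andP[hy2 hy1] ha ab hb.
  have ch : cont_seg (fun y => cabs (f (x, y))) (z0.2 - 2 * s) (z0.2 + 2 * s).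
    by apply: (cont_vertical df) => //; rewrite lexx.
  have cg : cont_seg (fun y => (g (x, y)).1) a b by exact: cU.
  have cab : cont_seg (fun y => cabs (f (x, y))) a b by exact: cont_segS ch.
  apply: (@le_trans _ _ (\int[leb]_(y in `[a, b]) (cabs (f (x, y)) / s))).
    have le1 y : a <= y <= b -> `|(g (x, y)).1| <= cabs (f (x, y)) / s.
      by move=> _; apply: (le_trans (normr_fst_cabs _)); apply: gb; left.
    rewrite ler_norml; apply/andP; split; last first.
      apply: Rintegral_seg_le => //; first exact: cstM.
      by move=> y /le1; rewrite ler_norml => /andP[].
    rewrite -mulN1r -RintegralZl//; last exact: cont_seg_integrable (cstM _ _ _ cab).
    apply: Rintegral_seg_le => //.
      move=> y xab; apply: continuousM; [exact: cst_continuous|exact: (cstM _ _ _ cab _ xab)].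
    by move=> y /le1; rewrite ler_norml mulN1r => /andP[].
  rewrite RintegralZr//; last exact: cont_seg_integrable cab.
  rewrite ler_pM2r ?invr_gt0//; apply: Rintegral_seg_sub => //.
  by move=> y; exact: cabs_ge0.
case/andP: (xx1) => xa1 _; case/andP: (xx2) => _ xb2.
case/andP: (yy1) => ya1 _; case/andP: (yy2) => _ yb2.
have e1 := Rintegral_segB (cV y1 x1 x2 yn1 yy1 xa1 xb2) (cV y2 x1 x2 yn2 yy2 xa1 xb2).
have e2 := Rintegral_segB (cU x2 y1 y2 xn2 xx2 ya1 yb2) (cU x1 y1 y2 xn1 xx1 ya1 yb2).
rewrite e1 e2 in low.
have b1 := nV y1 x1 x2 yn1 yy1 ys1 xa1 x12 xb2.
have b2 := nV y2 x1 x2 yn2 yy2 ys2 xa1 x12 xb2.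
have b3 := nU x1 y1 y2 xn1 xx1 xs1 ya1 y12 yb2.
have b4 := nU x2 y1 y2 xn2 xx2 xs2 ya1 y12 yb2.
have : 2 * m <= (col x1 + col x2 + row y1 + row y2) / s.
  rewrite !mulrDl; move: b1 b2 b3 b4; rewrite !ler_norml; clear -low.
  by move=> /andP[? ?] /andP[? ?] /andP[? ?] /andP[? ?]; lra.
rewrite ler_pdivlMr// => h.
by rewrite -mulrA [s * m]mulrC mulrA.
Qed.

End SubMeanValue.

(** * Planar Lebesgue measure as a product measure *)

Section AreaMeasure.
Variable R : realType.
Notation C := (R * R)%type.
Notation leb := (@lebesgue_measure R).

Lemma lebesgue_measure_segment (u v : R) : u <= v -> leb `[u, v]%classic = (v - u)%:E.
Proof.
move=> uv; rewrite lebesgue_measure_itv/= lte_fin; case: ltP => //= vu.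
by congr EFin; apply/esym/eqP; rewrite subr_eq0 eq_le vu uv.
Qed.

(** A named copy of the product measure, convertible with the one in [area_cone_integral], to which
    the measure and sigma-finiteness instances are attached. *)
Definition area : set (measurableTypeR R * measurableTypeR R)%type -> \bar R :=
  (leb \x leb)%E.

HB.instance Definition _ := Measure.on area.

Lemma area_sigma_finite : sigma_finite setT area.
Proof.
have mI (n : nat) : measurable (`[- n%:R, n%:R]%classic : set (measurableTypeR R)).
  exact: measurable_itv.
exists (fun n => (`[- n%:R, n%:R]%classic : set (measurableTypeR R)) `*`
                 (`[- n%:R, n%:R]%classic : set (measurableTypeR R))).
  apply/seteqP; split => // -[x y] _.
  pose n := maxn (Num.truncn `|x|).+1 (Num.truncn `|y|).+1.
  have le (t : R) (m : nat) : ((Num.truncn `|t|).+1 <= m)%N -> `|t| <= m%:R.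
    move=> tm; apply: (le_trans (ltW (truncnS_gt `|t|))).
    by rewrite ler_nat.
  exists n => //; split => /=; rewrite in_itv/= -ler_norml; apply: le.
    exact: leq_maxl.
  exact: leq_maxr.
move=> n; split; first exact: measurableX.
have -> : area (`[- n%:R, n%:R]%classic `*` `[- n%:R, n%:R]%classic) =
    (leb `[(- n%:R)%R, n%:R%R]%classic * leb `[(- n%:R)%R, n%:R%R]%classic)%E.
  exact: product_measure1E.
rewrite lebesgue_measure_segment -?EFinM ?ltry//.
by rewrite (le_trans _ (ler0n _ n))// oppr_le0.
Qed.

HB.instance Definition _ := Measure_isSigmaFinite.Build _ _ _ area area_sigma_finite.

Lemma area_rectangle (a b c d : R) : a <= b -> c <= d ->
  area (`[a, b]%classic `*` `[c, d]%classic) = ((b - a) * (d - c))%:E.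
Proof.
move=> ab cd; have mI (u v : R) : measurable (`[u, v]%classic : set (measurableTypeR R)).
  exact: measurable_itv.
have -> : area (`[a, b]%classic `*` `[c, d]%classic) =
    (leb `[a, b]%classic * leb `[c, d]%classic)%E by exact: product_measure1E.
by rewrite !lebesgue_measure_segment.
Qed.

End AreaMeasure.

Section SubMeanArea.
Variable R : realType.
Notation C := (R * R)%type.
Notation leb := (@lebesgue_measure R).
Variables (f : C -> C) (z0 : C) (s : R).
Hypothesis df : forall x y, `|x - z0.1| <= s -> `|y - z0.2| <= s ->
  cdifferentiable_at f (x, y).

Let G := (fun z => (cabs (f z))%:E) \_ (square z0 s).

Lemma measurable_square_patch :
  measurable_fun [set: (measurableTypeR R * measurableTypeR R)%type] G.
Proof.
apply/(measurable_restrictT _ _).1; first exact: measurable_square.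
apply/measurable_EFinP; exact: measurable_cabs_square.
Qed.

Lemma square_patch_ge0 z : (0 <= G z)%E.
Proof. by rewrite /G patchE; case: ifPn => // _; rewrite lee_fin cabs_ge0. Qed.

(** Tonelli, keeping only the columns with abscissa in [u, v]. *)
Lemma integral_square_ge_col (u v K : R) : 0 <= K -> z0.1 - s <= u -> u <= v -> v <= z0.1 + s ->
  (forall x, u <= x <= v -> K <= col_integral f z0 s x) ->
  ((K * (v - u))%:E <= \int[@area R]_(z in square z0 s) (cabs (f z))%:E)%E.
Proof.
move=> K0 hu uv hv hK.
rewrite integral_mkcond -/G.
have -> : (\int[@area R]_z G z = \int[leb]_x fubini_F leb G x)%E.
  exact: (@fubini_tonelli1 _ _ _ _ R leb leb G measurable_square_patch square_patch_ge0).
have mF : measurable_fun setT (fubini_F leb G).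
  exact: measurable_fun_fubini_tonelli_F measurable_square_patch square_patch_ge0.
have F0 x : (0 <= fubini_F leb G x)%E by apply: integral_ge0 => y _; exact: square_patch_ge0.
apply: (@le_trans _ _ (\int[leb]_(x in `[u, v]) (fubini_F leb G x))%E); last first.
  by apply: ge0_subset_integral => //; exact: measurable_itv.
have -> : (K * (v - u))%:E = (\int[leb]_(x in `[u, v]) K%:E)%E.
  rewrite integral_cst//= lebesgue_measure_itv/= lte_fin; case: ltP => //= vu.
  have -> : u = v by apply/eqP; rewrite eq_le uv vu.
  by rewrite subrr mulr0 mule0.
apply: ge0_le_integral => //; first exact: measurable_funTS mF.
move=> x /=; rewrite in_itv/= => /andP[xu xv].
have xs : z0.1 - s <= x <= z0.1 + s by rewrite (le_trans hu xu) (le_trans xv hv).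
have -> : fubini_F leb G x = (col_integral f z0 s x)%:E; last first.
  by rewrite lee_fin hK// xu xv.
rewrite /col_integral /Rintegral fineK; last first.
  apply: integrable_fin_num => //; apply: cont_seg_integrable.
  by apply: (cont_vertical df) => //; rewrite ler_distl.
rewrite [RHS]integral_mkcond /fubini_F; apply: eq_integral => y _.
rewrite /G !patchE /square; congr (if _ then _ else _).
apply/idP/idP => /set_mem h; apply/mem_set; first exact: h.2.
by split => //; rewrite /= in_itv.
Qed.

Lemma integral_square_ge_row (u v K : R) : 0 <= K -> z0.2 - s <= u -> u <= v -> v <= z0.2 + s ->
  (forall y, u <= y <= v -> K <= row_integral f z0 s y) ->
  ((K * (v - u))%:E <= \int[@area R]_(z in square z0 s) (cabs (f z))%:E)%E.
Proof.
move=> K0 hu uv hv hK.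
rewrite integral_mkcond -/G.
have -> : (\int[@area R]_z G z = \int[leb]_x fubini_G leb G x)%E.
  exact: (@fubini_tonelli2 _ _ _ _ R leb leb G measurable_square_patch square_patch_ge0).
have mF : measurable_fun setT (fubini_G leb G).
  exact: measurable_fun_fubini_tonelli_G measurable_square_patch square_patch_ge0.
have F0 x : (0 <= fubini_G leb G x)%E by apply: integral_ge0 => y _; exact: square_patch_ge0.
apply: (@le_trans _ _ (\int[leb]_(x in `[u, v]) (fubini_G leb G x))%E); last first.
  by apply: ge0_subset_integral => //; exact: measurable_itv.
have -> : (K * (v - u))%:E = (\int[leb]_(x in `[u, v]) K%:E)%E.
  rewrite integral_cst//= lebesgue_measure_itv/= lte_fin; case: ltP => //= vu.
  have -> : u = v by apply/eqP; rewrite eq_le uv vu.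
  by rewrite subrr mulr0 mule0.
apply: ge0_le_integral => //; first exact: measurable_funTS mF.
move=> y /=; rewrite in_itv/= => /andP[yu yv].
have ys : z0.2 - s <= y <= z0.2 + s by rewrite (le_trans hu yu) (le_trans yv hv).
have -> : fubini_G leb G y = (row_integral f z0 s y)%:E; last first.
  by rewrite lee_fin hK// yu yv.
rewrite /row_integral /Rintegral fineK; last first.
  apply: integrable_fin_num => //; apply: cont_seg_integrable.
  by apply: (cont_horizontal df) => //; rewrite ler_distl.
rewrite [RHS]integral_mkcond /fubini_G; apply: eq_integral => x _.
rewrite /G !patchE /square; congr (if _ then _ else _).
apply/idP/idP => /set_mem h; apply/mem_set; first exact: h.1.
by split => //; rewrite /= in_itv.
Qed.

End SubMeanArea.

Section SubMean.
Variable R : realType.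
Notation C := (R * R)%type.

(* If every side family had a member with integral below s |f z0| / 2, these four
   members would contradict cauchy_rectangle_bound. *)
Lemma sub_mean_value (f : C -> C) z0 (s : R) : 0 < s ->
  (forall x y, `|x - z0.1| <= 2 * s -> `|y - z0.2| <= 2 * s -> cdifferentiable_at f (x, y)) ->
  ((s ^+ 2 / 2 * cabs (f z0))%:E <=
    \int[@area R]_(z in square z0 (2 * s)) (cabs (f z))%:E)%E.
Proof.
move=> s0 df; pose K := s * cabs (f z0) / 2.
have K0 : 0 <= K by rewrite divr_ge0// mulr_ge0 ?cabs_ge0// ltW.
have eK (u : R) : s ^+ 2 / 2 * cabs (f z0) = K * ((u + s) - u) by rewrite /K; ring.
have [h1|/existsNP[x1 /not_implyP[X1 /negP]]] :=
  pselect (forall x, z0.1 - 2 * s <= x <= z0.1 - s -> K <= col_integral f z0 (2 * s) x).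
  rewrite (eK (z0.1 - 2 * s)); apply: (integral_square_ge_col df) => //; [lra|lra|].
  by move=> x /andP[xa xb]; apply: h1; apply/andP; split; lra.
rewrite -ltNge => c1.
have [h1|/existsNP[x2 /not_implyP[X2 /negP]]] :=
  pselect (forall x, z0.1 + s <= x <= z0.1 + 2 * s -> K <= col_integral f z0 (2 * s) x).
  rewrite (eK (z0.1 + s)); apply: (integral_square_ge_col df) => //; [lra|lra|lra|].
  by move=> x /andP[xa xb]; apply: h1; apply/andP; split; lra.
rewrite -ltNge => c2.
have [h1|/existsNP[y1 /not_implyP[Y1 /negP]]] :=
  pselect (forall y, z0.2 - 2 * s <= y <= z0.2 - s -> K <= row_integral f z0 (2 * s) y).
  rewrite (eK (z0.2 - 2 * s)); apply: (integral_square_ge_row df) => //; [lra|lra|].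
  by move=> x /andP[xa xb]; apply: h1; apply/andP; split; lra.
rewrite -ltNge => c3.
have [h1|/existsNP[y2 /not_implyP[Y2 /negP]]] :=
  pselect (forall y, z0.2 + s <= y <= z0.2 + 2 * s -> K <= row_integral f z0 (2 * s) y).
  rewrite (eK (z0.2 + s)); apply: (integral_square_ge_row df) => //; [lra|lra|lra|].
  by move=> x /andP[xa xb]; apply: h1; apply/andP; split; lra.
rewrite -ltNge => c4.
exfalso; have := cauchy_rectangle_bound s0 df X1 X2 Y1 Y2.
by rewrite /K in c1 c2 c3 c4; lra.
Qed.

End SubMean.

(** * Bergman disks, cones and boxes *)

Section BergmanDisks.
Variable R : realType.
Notation C := (R * R)%type.
Implicit Types (a w z : C) (t : R).

(** The identity 1 - |phi_a(w)|^2 = (1-|a|^2)(1-|w|^2)/|1 - conj(a) w|^2 with denominators cleared;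
    it shows |phi_a(w)| < 1. *)
Lemma mobius_identity a w :
  cabs (csub (cone R) (cmul (cconj a) w)) ^+ 2 - cabs (csub a w) ^+ 2 =
  (1 - cabs a ^+ 2) * (1 - cabs w ^+ 2).
Proof. by rewrite !sqr_cabs /csub /cmul /cconj /cone/=; ring. Qed.

(** This is tanh t, the pseudohyperbolic radius of the Bergman disk. *)
Definition bergman_radius t : R := (expR (2 * t) - 1) / (expR (2 * t) + 1).

Lemma bergman_radius_bound t : 0 < t -> 0 < bergman_radius t < 1.
Proof.
move=> t0; have e1 : 1 < expR (2 * t) by rewrite expR_gt1 mulr_gt0.
rewrite /bergman_radius; apply/andP; split; first by rewrite divr_gt0; lra.
by rewrite ltr_pdivrMr; lra.
Qed.

(** The distance is the inverse hyperbolic tangent of |phi_a(w)|, which is increasing. Inverting it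
    and clearing denominators leaves a comparison of moduli without logarithms. *)
Lemma bergman_dist_lt a w t : 0 < t -> disk a -> disk w ->
  (bergman_dist w a < t) =
  (cabs (csub a w) < bergman_radius t * cabs (csub (cone R) (cmul (cconj a) w))).
Proof.
rewrite /disk/= => t0 a1 w1.
have a0 := cabs_ge0 a; have w0 := cabs_ge0 w.
set B := cabs (csub (cone R) (cmul (cconj a) w)); set A := cabs (csub a w).
have B0 : 0 < B by have := csub_conj_le (ltW a1) (ltW w1); rewrite -/B; lra.
have A0 : 0 <= A by exact: cabs_ge0.
have AB : A < B.
  have := mobius_identity a w; rewrite -/A -/B.
  have : 0 < (1 - cabs a ^+ 2) * (1 - cabs w ^+ 2) by apply: mulr_gt0; nra.
  by move=> h1 h2; rewrite ltNge; apply/negP => BA; nra.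
have xE : cabs (mobius a w) = A / B by rewrite /mobius /cdiv cabsM cabs_inv.
have x1 : A / B < 1 by rewrite ltr_pdivrMr ?mul1r.
have x0 : 0 <= A / B by rewrite divr_ge0// ltW.
have y0 : 0 < (1 + A / B) / (1 - A / B) by rewrite divr_gt0; lra.
have E0 := expR_gt0 (2 * t).
rewrite /bergman_dist xE.
have -> : (2^-1 * ln ((1 + A / B) / (1 - A / B)) < t) =
    (ln ((1 + A / B) / (1 - A / B)) < 2 * t).
  by apply/idP/idP; lra.
rewrite -[2 * t]expRK ltr_ln ?posrE// ltr_pdivrMr; last lra.
rewrite /bergman_radius mulrAC ltr_pdivlMr; last lra.
have -> : (1 + A / B < expR (2 * t) * (1 - A / B)) =
   ((1 + A / B) * B < expR (2 * t) * (1 - A / B) * B) by rewrite ltr_pM2r.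
have -> : (1 + A / B) * B = B + A by field; rewrite gt_eqF.
have -> : expR (2 * t) * (1 - A / B) * B = expR (2 * t) * (B - A) by field; rewrite gt_eqF.
by apply/idP/idP; nra.
Qed.

(** Since |1 - conj(a) w| >= 1-|a|, half of tanh t works; the half provides the strict
    inequality. *)
Lemma bergman_disk_contains_ball t : 0 < t -> exists2 e : R, 0 < e < 1 &
  forall a w, disk a -> cabs (csub w a) <= e * (1 - cabs a) -> bergman_disk a t w.
Proof.
move=> t0; have /andP[r0 r1] := bergman_radius_bound t0.
exists (bergman_radius t / 2); first by apply/andP; split; lra.
rewrite /disk/= => a w a1 wa.
have w1 : disk w.
  rewrite /disk/=; have := cabs_le_csub w a.
  have : bergman_radius t / 2 * (1 - cabs a) <= 1 / 2 * (1 - cabs a).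
    by rewrite ler_pM2r//; lra.
  lra.
split => //; rewrite bergman_dist_lt// csubC.
have := csub_conj_le (ltW a1) (ltW w1).
set B := cabs (csub (cone R) _) => hB; apply: (le_lt_trans wa).
apply: (@le_lt_trans _ _ (bergman_radius t / 2 * B)).
  by rewrite ler_pM2l//; lra.
by rewrite ltr_pM2r; lra.
Qed.

(** In |w-a| < r |1 - conj(a) w| <= r (2u + |w-a|) with r < 1 the last term is absorbed. The height
    u may be that of [a] or, by symmetry, that of [w]; the second choice makes the heights
    comparable. *)
Lemma bergman_disk_bounded t : 0 < t -> exists2 K : R, 0 < K &
  forall a w, disk a -> bergman_disk a t w ->
    cabs (csub w a) <= K * (1 - cabs a) /\ 1 - cabs a <= (1 + K) * (1 - cabs w).
Proof.
move=> t0; have /andP[r0 r1] := bergman_radius_bound t0.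
set r := bergman_radius t in r0 r1 *.
exists (2 * r / (1 - r)); first by rewrite divr_gt0; lra.
move=> a w a1 [w1]; rewrite bergman_dist_lt// csubC -/r => h.
rewrite /disk/= in a1 w1.
have h1 := csub_conj_upper w (ltW a1).
have h2 := csub_conj_upper a (ltW w1).
rewrite -csub_conj_sym (csubC a w) in h2.
have h3 := cabs_le_csub w a.
have key (u : R) : cabs (csub (cone R) (cmul (cconj a) w)) <= 2 * u + cabs (csub w a) ->
    cabs (csub w a) <= 2 * r / (1 - r) * u.
  move=> hu; rewrite mulrAC ler_pdivlMr; last lra.
  have : r * cabs (csub (cone R) (cmul (cconj a) w)) <= r * (2 * u + cabs (csub w a)).
    by rewrite ler_pM2l.
  lra.
split; first exact: key.
have := key _ h2; lra.
Qed.

End BergmanDisks.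

(** * Measurability of Bergman disks, cones and Carleson boxes *)

Section ConeMeasurability.
Variable R : realType.
Notation C := (R * R)%type.

Lemma measurable_cabs : measurable_fun [set: C] (@cabs R).
Proof.
apply: measurable_fun_lower_semicontinuous2 => // z _ e e0.
exists (e / 2); first by rewrite divr_gt0.
move=> w w1 w2; have := cabs_le_csub z w; rewrite csubC.
have := cabs_le_norms (csub w z); rewrite /=; lra.
Qed.

Section Composition.
Context d (T : measurableType d).
Implicit Types (f g : T -> R).

Lemma measurable_cabs_pair f g : measurable_fun setT f -> measurable_fun setT g ->
  measurable_fun setT (fun t => cabs (f t, g t)).
Proof.
move=> mf mg; apply: (measurableT_comp measurable_cabs).
exact: measurable_fun_pair.
Qed.

Lemma measurable_set_lt f g : measurable_fun setT f -> measurable_fun setT g ->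
  measurable [set t | f t < g t].
Proof.
move=> mf mg; have := measurable_fun_ltr mf mg measurableT (Y := [set true]) I.
by rewrite setTI; congr (measurable _); apply/seteqP; split.
Qed.

Lemma measurable_set_le f g : measurable_fun setT f -> measurable_fun setT g ->
  measurable [set t | f t <= g t].
Proof.
move=> mf mg; have := measurable_fun_ler mf mg measurableT (Y := [set true]) I.
by rewrite setTI; congr (measurable _); apply/seteqP; split.
Qed.

End Composition.

Lemma measurable_plane_fst : measurable_fun [set: C] (fun z : C => z.1).
Proof. exact: measurable_fst. Qed.

Lemma measurable_plane_snd : measurable_fun [set: C] (fun z : C => z.2).
Proof. exact: measurable_snd. Qed.

Lemma measurable_disk : measurable (@disk R).
Proof. by apply: measurable_set_lt => //; exact: measurable_cabs. Qed.

Lemma measurable_cos_fun : measurable_fun [set: R] (@cos R).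
Proof. exact: continuous_measurable_fun (@continuous_cos R). Qed.

Lemma measurable_sin_fun : measurable_fun [set: R] (@sin R).
Proof. exact: continuous_measurable_fun (@continuous_sin R). Qed.

Lemma measurable_cdist (a : C) : measurable_fun [set: C] (fun w => cabs (csub w a)).
Proof.
by apply: measurable_cabs_pair; apply: measurable_funB.
Qed.

Lemma measurable_csub_conj (a : C) :
  measurable_fun [set: C] (fun w => cabs (csub (cone R) (cmul (cconj a) w))).
Proof.
have m1 := measurable_plane_fst; have m2 := measurable_plane_snd.
apply: measurable_cabs_pair; rewrite /=; apply: measurable_funB => //.
  by apply: measurable_funB; apply: measurable_funM.
by apply: measurable_funD; apply: measurable_funM.
Qed.

Definition cball (a : C) (r : R) : set C := [set w | cabs (csub w a) <= r].

Lemma measurable_cball (a : C) (r : R) : measurable (cball a r).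
Proof. by apply: measurable_set_le => //; exact: measurable_cdist. Qed.

Lemma measurable_lusin_cone (s : R) (xi : C) : measurable (lusin_cone s xi).
Proof.
apply: measurableI; first exact: measurable_disk.
apply: measurable_set_lt; first exact: measurable_csub_conj.
by apply: measurable_funM => //; apply: measurable_funB => //; exact: measurable_cabs.
Qed.

Lemma measurable_bergman_disk (a : C) (t : R) : 0 < t -> disk a ->
  measurable (bergman_disk a t).
Proof.
move=> t0 a1.
have -> : bergman_disk a t = @disk R `&` [set w | cabs (csub w a) <
    bergman_radius t * cabs (csub (cone R) (cmul (cconj a) w))].
  by apply/seteqP; split => w [w1 h]; split => //; move: h; rewrite bergman_dist_lt// csubC.
apply: measurableI; first exact: measurable_disk.
apply: measurable_set_lt; first exact: measurable_cdist.
by apply: measurable_funM => //; exact: measurable_csub_conj.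
Qed.

(* Rotating the arc to be centred at 0 turns the angle condition into a lower bound
   on the cosine; the origin belongs to the box exactly when l > 1. *)
Lemma carleson_boxE (a l : R) : 0 < l -> l <= 2 * pi ->
  carleson_box a l =
  [set z | cabs z < 1] `&` [set z | 1 - l < cabs z] `&`
  [set z | cabs z * cos (l / 2) < z.1 * cos (a + l / 2) + z.2 * sin (a + l / 2)] `|`
  (if 1 < l then [set (0, 0)] else set0).
Proof.
move=> l0 l2; have pi0 := pi_gt0 R; apply/seteqP; split => [z|z].
- move=> [r [phi [r0 rl r1 /andP[p1 p2] ->]]].
  have [r00|r00] := eqVneq r 0.
    right; rewrite r00 !mul0r; move: rl; rewrite r00 ltrBlDr add0r => ->.
    by [].
  left; rewrite /= cabs_polar//; split => //.
  have rp : 0 < r by rewrite lt_neqAle eq_sym r00.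
  have -> : r * cos phi * cos (a + l / 2) + r * sin phi * sin (a + l / 2) =
     r * cos (phi - (a + l / 2)) by rewrite cosB; ring.
  rewrite ltr_pM2l// -[X in _ < X]cos_norm ltr_cos ?in_itv/=.
  - by rewrite ltr_norml; apply/andP; split; lra.
  - by rewrite normr_ge0/= ler_norml; apply/andP; split; lra.
  - by apply/andP; split; lra.
- case => [[[/= z1 zl] h]|]; last first.
    case: ifPn => // l1 ->; exists 0, (a + l / 2); rewrite !mul0r; split => //; lra.
  have [phi /andP[p0 p1] zE] := polar_decomposition z.
  have zp : 0 < cabs z.
    rewrite lt_neqAle cabs_ge0 andbT eq_sym; apply/eqP => z0.
    move/eqP: z0; rewrite cabs_eq0 => /eqP ze.
    by move: h; rewrite ze cabs0/= !mul0r addr0 ltxx.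
  have hc : cos (l / 2) < cos (phi - (a + l / 2)).
    move: h; rewrite {2 3}zE /= => h; rewrite -(ltr_pM2l zp) cosB.
    by apply: (lt_le_trans h); rewrite le_eqVlt; apply/orP; left; apply/eqP; ring.
  have c1 : -1 <= cos (phi - (a + l / 2)) <= 1 by rewrite cos_geN1 cos_le1.
  pose psi := acos (cos (phi - (a + l / 2))).
  have ps0 : 0 <= psi by exact: acos_ge0.
  have pspi : psi <= pi by exact: acos_lepi.
  have cpsi : cos psi = cos (phi - (a + l / 2)) by rewrite acosK// in_itv.
  have psl : psi < l / 2.
    by rewrite -ltr_cos ?cpsi// in_itv/=; apply/andP; split; lra.
  have spsi : sin psi = `|sin (phi - (a + l / 2))|.
    rewrite /psi sin_acos// -sqrtr_sqr; congr Num.sqrt.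
    by rewrite sin2cos2.
  (* The cosine fixes the angle up to sign and the sine decides the sign: [sg] represents
     [phi - (a + l / 2)] in [-pi, pi]. *)
  pose sg : R := if 0 <= sin (phi - (a + l / 2)) then psi else - psi.
  have [e1 e2] : cos sg = cos (phi - (a + l / 2)) /\ sin sg = sin (phi - (a + l / 2)).
    rewrite /sg; case: ifPn => [s0|]; first by rewrite cpsi spsi ger0_norm.
    by rewrite -ltNge => s0; rewrite cosN sinN cpsi spsi ltr0_norm// opprK.
  have sgl : `|sg| < l / 2 by rewrite /sg; case: ifPn => _; rewrite ?normrN ger0_norm.
  exists (cabs z), (a + l / 2 + sg); split => //.
  + exact: ltW.
  + by move: sgl; rewrite ltr_norml => /andP[s1 s2]; apply/andP; split; lra.
  rewrite {1}zE.
  have -> : cos phi = cos ((a + l / 2) + (phi - (a + l / 2))) by congr cos; ring.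
  have -> : sin phi = sin ((a + l / 2) + (phi - (a + l / 2))) by congr sin; ring.
  by rewrite !(cosD (a + l / 2)) !(sinD (a + l / 2)) e1 e2.
Qed.

Lemma measurable_carleson_box (a l : R) : 0 < l -> l <= 2 * pi ->
  measurable (carleson_box a l).
Proof.
move=> l0 l2; rewrite carleson_boxE//; apply: measurableU; last first.
  case: ifPn => _ //.
  have -> : [set ((0 : R), (0 : R))] = [set 0] `*` [set 0].
    by apply/seteqP; split => [_ ->//|[x y] [/= -> ->]].
  by apply: measurableX; exact: measurable_set1.
have m1 := measurable_plane_fst; have m2 := measurable_plane_snd.
have mc := measurable_cabs.
apply: measurableI; first apply: measurableI.
- exact: measurable_set_lt.
- exact: measurable_set_lt.
apply: measurable_set_lt; first exact: measurable_funM.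
by apply: measurable_funD; exact: measurable_funM.
Qed.

End ConeMeasurability.

(** * Balls and Carleson boxes *)

Section Series.
Variable R : realType.

Lemma geometric_sum_le (c x : R) n : 0 <= c -> 0 <= x < 1 ->
  \sum_(0 <= k < n) c * x ^+ k <= c / (1 - x).
Proof.
move=> c0 /andP[x0 x1]; rewrite ler_pdivlMr ?subr_gt0//.
suff -> : (\sum_(0 <= k < n) c * x ^+ k) * (1 - x) = c * (1 - x ^+ n).
  by rewrite ler_piMr// lerBlDr lerDl exprn_ge0.
elim: n => [|n ih]; first by rewrite big_geq// expr0 subrr mul0r mulr0.
by rewrite big_nat_recr//= mulrDl ih exprS; ring.
Qed.

Lemma nneseries_geometric_le (c x : R) : 0 <= c -> 0 <= x < 1 ->
  (\sum_(0 <= k <oo) (c * x ^+ k)%:E <= (c / (1 - x))%:E)%E.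
Proof.
move=> c0 x01; apply: lime_le.
  apply: is_cvg_nneseries => k _ _; rewrite lee_fin mulr_ge0// exprn_ge0//.
  by case/andP: x01.
by apply: nearW => n; rewrite sumEFin lee_fin geometric_sum_le.
Qed.

Lemma powR_exprn (x b : R) k : 0 <= x -> (x ^+ k) `^ b = (x `^ b) ^+ k.
Proof.
move=> x0; elim: k => [|k ih]; first by rewrite !expr0 powR1.
by rewrite !exprS powRM ?exprn_ge0// ih.
Qed.

Lemma powR_lt1 (x b : R) : 0 < x < 1 -> 0 < b -> x `^ b < 1.
Proof.
move=> /andP[x0 x1] b0; rewrite -[X in _ < X](_ : 1 `^ b = 1); last by rewrite powR1.
by apply: gt0_ltr_powR => //; rewrite nnegrE ltW.
Qed.

Lemma powR_le_mono (x y b : R) : 0 <= b -> 0 <= x -> x <= y -> x `^ b <= y `^ b.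
Proof.
by move=> b0 x0 xy; apply: ge0_ler_powR => //; rewrite nnegrE// (le_trans x0 xy).
Qed.

Lemma geometric_small (rho l h : R) : 0 < rho < 1 -> 0 < l -> 0 < h ->
  exists k : nat, rho ^+ k * l < h.
Proof.
move=> /andP[r0 r1] l0 h0; have := @cvg_geometric R l rho.
rewrite ger0_norm ?ltW// => /(_ r1) /cvgrPdist_lt /(_ h h0) [N _ hN]; exists N.
have := hN N (leqnn N); rewrite sub0r normrN /= ger0_norm 1?mulrC//.
by rewrite mulr_ge0 ?exprn_ge0 ?ltW.
Qed.

(** The least power that brings l below h has a positive exponent; take its predecessor. *)
Lemma geometric_layer (rho l h : R) : 0 < rho < 1 -> 0 < h <= l ->
  exists k : nat, rho ^+ k.+1 * l < h <= rho ^+ k * l.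
Proof.
move=> r01 /andP[h0 hl]; have l0 := lt_le_trans h0 hl.
have ex := geometric_small r01 l0 h0; case: (ex_minnP ex) => -[|k] hk kmin.
  by move: hk; rewrite expr0 mul1r ltNge hl.
exists k; rewrite hk leNgt; apply/negP => hk'.
by have := kmin _ hk'; rewrite ltnn.
Qed.

End Series.

Section CarlesonBoxes.
Variable R : realType.
Notation C := (R * R)%type.
Implicit Types (a w z : C).

Lemma polar_dist (r r' p p' : R) : 0 <= r <= 1 ->
  cabs (csub (r * cos p, r * sin p) (r' * cos p', r' * sin p')) <= `|r - r'| + `|p - p'|.
Proof.
move=> /andP[r0 r1].
apply: (le_trans (csub_triangle _ (r * cos p', r * sin p') _)); rewrite addrC; apply: lerD.
  have -> : csub (r * cos p', r * sin p') (r' * cos p', r' * sin p') =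
      cmul (r - r', 0) (cexpi p').
    by rewrite /csub /cmul /cexpi/=; congr pair; ring.
  rewrite cabsM cabs_expi mulr1 /cabs/= expr0n addr0 sqrtr_sqr//.
have -> : csub (r * cos p, r * sin p) (r * cos p', r * sin p') =
    cmul (r, 0) (csub (cexpi p) (cexpi p')).
  by rewrite /csub /cmul /cexpi/=; congr pair; ring.
rewrite cabsM [X in X * _]/cabs/= expr0n addr0 sqrtr_sqr ger0_norm//.
apply: (le_trans _ (cdist_expi_le p p')).
by rewrite ler_piMl// cabs_ge0.
Qed.

(* Cut the box into the layers rho^(k+1) l < 1 - |z| <= rho^k l and each layer into
   angular pieces of length eta rho^k l; a piece lies in the ball around any of its points. *)
Lemma carleson_of_balls (mu : {measure set C -> \bar R}) (e K b : R) :
  0 < e < 1 -> 0 < K -> 1 < b ->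
  (forall a, disk a ->
    (mu (cball a (e * (1 - cabs a))) <= (K * (1 - cabs a) `^ b)%:E)%E) ->
  exists2 K' : R, 0 < K' & forall a l : R, 0 < l -> l <= 2 * pi ->
    (mu (carleson_box a l) <= (K' * l `^ b)%:E)%E.
Proof.
move=> /andP[e0 e1] K0 b1 hmu.
(* With this ratio, 1 - [rho] = [eta] = [rho] e/2. The radial and angular widths of a piece then add
   up to e [rho]^(k+1) l, which is below e(1-|z|) for each of its points z. *)
pose rho : R := (1 + e / 2)^-1.
have r0 : 0 < rho by rewrite invr_gt0; lra.
have rE : rho * (1 + e / 2) = 1 by rewrite mulVf// gt_eqF//; lra.
have rE1 : 1 - rho = rho * e / 2 by lra.
have r1 : rho < 1 by rewrite -subr_gt0 rE1 divr_gt0// mulr_gt0.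
have r01 : 0 < rho < 1 by rewrite r0 r1.
pose eta := rho * e / 2.
have eta0 : 0 < eta by rewrite divr_gt0// mulr_gt0.
have eta1 : eta < 1 by rewrite /eta -rE1; lra.
(* Layer k has about [rho]^(-k) pieces, each of measure at most a multiple of [rho]^(kb); hence the
   ratio [rho]^(b-1), below 1 because b > 1. *)
pose x := rho `^ (b - 1).
have x0 : 0 <= x by exact: powR_ge0.
have x1 : x < 1 by apply: powR_lt1; rewrite ?r0//; lra.
have rb : rho `^ b = rho * x by rewrite /x mulr_powRB1// ?ltW//; lra.
pose K' := 2 * K / eta / (1 - x).
have K'0 : 0 < K' by rewrite !divr_gt0 ?mulr_gt0// subr_gt0.
exists K' => // a l l0 l2.
pose wd k := eta * (rho ^+ k * l).
have rk0 k : 0 < rho ^+ k by rewrite exprn_gt0.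
have wd0 k : 0 < wd k by rewrite !mulr_gt0.
pose pt (p : nat * nat) z := exists r phi : R, [/\ 0 <= r, rho ^+ p.1.+1 * l < 1 - r,
   1 - r <= rho ^+ p.1 * l,
   a + p.2%:R * wd p.1 <= phi <= a + p.2.+1%:R * wd p.1 &
   z = (r * cos phi, r * sin phi)].
pose cov (p : nat * nat) (F : set C) := [/\ measurable F,
    (mu F <= (K * (rho ^+ p.1 * l) `^ b)%:E)%E & forall z, pt p z -> F z].
(* The centre of the covering ball is an arbitrary point of the piece; an empty piece is covered by
   the empty set. *)
have [F hF] : {F : nat * nat -> set C & forall p, cov p (F p)}.
  apply: choice => -[k j].
  have [[z' [r' [phi' [r'0 r'1 r'2 /andP[p'1 p'2] z'E]]]]|ne] := pselect (exists z, pt (k, j) z); last first.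
    exists set0; split => //.
      by rewrite measure0 lee_fin mulr_ge0 ?powR_ge0 ?ltW.
    by move=> z zp; apply: ne; exists z.
  rewrite /= in r'1 r'2 p'1 p'2.
  have h'0 : 0 < 1 - r' by apply: lt_trans r'1; rewrite mulr_gt0.
  have cz' : cabs z' = r' by rewrite z'E cabs_polar.
  exists (cball z' (e * (1 - cabs z'))); split.
  - exact: measurable_cball.
  - apply: (le_trans (hmu z' _)); first by rewrite /disk/= cz'; lra.
    rewrite lee_fin ler_pM2l// cz'; apply: powR_le_mono => //; lra.
  - move=> z [r [phi [r0' r1' r2' /andP[p1 p2] ->]]]; rewrite /= in r1' r2' p1 p2.
    rewrite /cball/= cz' z'E; apply: (le_trans (polar_dist _ _ _ _)).
      by rewrite r0'/= -subr_ge0; apply: ltW; apply: lt_trans r1'; rewrite mulr_gt0.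
    have dr : `|r - r'| <= (1 - rho) * (rho ^+ k * l).
      rewrite exprS in r'1 r1'; rewrite ler_norml mulrBl mul1r mulrA.
      by apply/andP; split; lra.
    have dp : `|phi - phi'| <= wd k.
      rewrite -natr1 mulrDl mul1r in p'2 p2.
      by rewrite ler_norml; apply/andP; split; lra.
    apply: (@le_trans _ _ (e * (rho ^+ k.+1 * l))); last by rewrite ler_pM2l// ltW.
    apply: (le_trans (lerD dr dp)).
    rewrite /wd /eta exprS le_eqVlt; apply/orP; left; apply/eqP.
    by rewrite rE1; field.
pose N k := (Num.truncn (eta * rho ^+ k)^-1).+1.
pose G k := \big[setU/set0]_(j < N k) F (k, nat_of_ord j).
have mG k : measurable (G k).
  by apply: bigsetU_measurable => j _; have [] := hF (k, nat_of_ord j).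
have cover : carleson_box a l `<=` \bigcup_k G k.
  move=> z [r [phi [r0' r1' r2' /andP[p1 p2] zE]]].
  have [|k /andP[k1 k2]] := @geometric_layer R rho l (1 - r) r01.
    by apply/andP; split; lra.
  exists k => //; pose j := Num.truncn ((phi - a) / wd k).
  have q0 : 0 <= (phi - a) / wd k by rewrite divr_ge0// ?ltW//; lra.
  have jN : (j < N k)%N.
    rewrite ltnS truncn_le_nat; apply: le_lt_trans (truncnS_gt _).
    rewrite ler_pdivrMr// /wd.
    have -> : (eta * rho ^+ k)^-1 * (eta * (rho ^+ k * l)) = l.
      by field; rewrite !gt_eqF.
    lra.
  rewrite /G (bigD1 (Ordinal jN))//=; left.
  have [_ _ h] := hF (k, j); apply: h; exists r, phi; split => //=.
  have /andP[t1 t2] := truncn_itv q0; rewrite -/j in t1 t2.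
  rewrite ler_pdivlMr// in t1; rewrite ltr_pdivrMr// in t2.
  by apply/andP; split; lra.
apply: (le_trans (measure_sigma_subadditive mu mG (measurable_carleson_box a l0 l2) cover)).
apply: (@le_trans _ _ (\sum_(0 <= k <oo) (2 * K / eta * l `^ b * x ^+ k)%:E)%E); last first.
  apply: (le_trans (nneseries_geometric_le _ _)).
  - by rewrite mulr_ge0 ?powR_ge0// ltW// divr_gt0// mulr_gt0.
  - by rewrite x0 x1.
  - by rewrite lee_fin /K' le_eqVlt; apply/orP; left; apply/eqP; ring.
apply: lee_nneseries => // k _.
have mF j : measurable (F (k, j)) by have [] := hF (k, j).
apply: (le_trans (@Boole_inequality _ _ _ mu (fun j => F (k, j)) (N k) (fun j _ => mF j))).
apply: (@le_trans _ _ (\sum_(j < N k) (K * (rho ^+ k * l) `^ b)%:E)%E).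
  by apply: lee_sum => j _; have [_ + _] := hF (k, nat_of_ord j).
rewrite sumEFin lee_fin sumr_const card_ord -[X in X <= _]mulr_natr.
have y1 : 1 <= (eta * rho ^+ k)^-1.
  rewrite invf_ge1 ?mulr_gt0//.
  by apply: mulr_ile1; try exact: ltW; apply: exprn_ile1; exact: ltW.
have Nle : (N k)%:R <= 2 * (eta * rho ^+ k)^-1.
  have : (Num.truncn (eta * rho ^+ k)^-1)%:R <= (eta * rho ^+ k)^-1.
    by rewrite truncn_le; lra.
  by rewrite /N -natr1; lra.
apply: (@le_trans _ _ (K * (rho ^+ k * l) `^ b * (2 * (eta * rho ^+ k)^-1))).
  by rewrite ler_wpM2l// mulr_ge0 ?powR_ge0 ?ltW.
have -> : (rho ^+ k * l) `^ b = rho ^+ k * x ^+ k * l `^ b.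
  by rewrite powRM ?powR_exprn ?rb ?exprMn// ltW.
rewrite le_eqVlt; apply/orP; left; apply/eqP.
by field; rewrite !gt_eqF.
Qed.

(** Arcs are open, so a full-length box misses one radius, which the second box recovers. As 2 pi >
    1, the radial condition is void. *)
Lemma disk_in_two_boxes z : disk z -> carleson_box 0 (2 * pi) z \/ carleson_box pi (2 * pi) z.
Proof.
rewrite /disk/= => z1; have pi2 := pi_ge2 R; have z0 := cabs_ge0 z.
have [phi /andP[p0 p1] zE] := polar_decomposition z.
have [p00|p00] := eqVneq phi 0.
  right; exists (cabs z), (2 * pi); split => //; [lra|apply/andP; split; lra|].
  rewrite {1}zE p00; have -> : 2 * pi = 0 + pi *+ 2 :> R by rewrite mulr2n; ring.
  by rewrite cosD2pi sinD2pi.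
left; exists (cabs z), phi; split => //; first lra.
by rewrite add0r p1 andbT lt_neqAle eq_sym p00.
Qed.

(** Smallness forces |w| >= 1/4, and |w| times the chord between the directions is at most 2|w-a|.
    The chord is thus at most 8Kh and the arc at most 32Kh, h being the height of [a]; the spare h
    on either side makes the arc condition strict. *)
Lemma ball_in_carleson_box (K : R) a w th : 0 < K -> (64 * K + 2) * (1 - cabs a) <= 1 ->
  disk a -> disk w -> cabs (csub w a) <= K * (1 - cabs a) ->
  0 <= th < 2 * pi -> a = (cabs a * cos th, cabs a * sin th) ->
  carleson_box (th - (32 * K + 1) * (1 - cabs a)) ((64 * K + 2) * (1 - cabs a)) w.
Proof.
rewrite /disk/= => K0 hs a1 w1 wa th02 aE; have pi2 := pi_ge2 R.
have [phi p02 wE] := polar_decomposition w.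
set h := 1 - cabs a in hs wa *.
have h0 : 0 < h by rewrite /h; lra.
have hE : cabs a = 1 - h by rewrite /h; ring.
have Kh : 0 < K * h by rewrite mulr_gt0.
have wh : cabs (csub w a) <= 1 / 32 by lra.
have h2 : h <= 1 / 2 by lra.
have wge : 1 / 4 <= cabs w.
  have := cabs_le_csub a w; rewrite csubC hE; lra.
have w0 := cabs_ge0 w.
have ch : cabs (csub (cexpi phi) (cexpi th)) <= 8 * cabs (csub w a).
  have e1 : cabs w * cabs (csub (cexpi phi) (cexpi th)) =
      cabs (csub w (cabs w * cos th, cabs w * sin th)).
    have -> : cabs w * cabs (csub (cexpi phi) (cexpi th)) =
      cabs (cmul (cabs w, 0) (csub (cexpi phi) (cexpi th))).
      by rewrite cabsM [X in _ = X * _]/cabs/= expr0n addr0 sqrtr_sqr ger0_norm.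
    have -> : csub w (cabs w * cos th, cabs w * sin th) =
      csub (cabs w * cos phi, cabs w * sin phi) (cabs w * cos th, cabs w * sin th).
      by rewrite -wE.
    by congr cabs; rewrite /cmul /csub/=; congr pair; ring.
  have e2 : cabs (csub a (cabs w * cos th, cabs w * sin th)) <= cabs (csub w a).
    rewrite {1}aE; apply: (le_trans (polar_dist _ _ _ _)).
      by rewrite cabs_ge0 ltW.
    rewrite subrr normr0 addr0 ler_norml.
    have := cabs_le_csub a w; have := cabs_le_csub w a; rewrite (csubC a w) => u1 u2.
    by apply/andP; split; lra.
  have := csub_triangle w a (cabs w * cos th, cabs w * sin th); rewrite -e1 => tr.
  have : 1 / 4 * cabs (csub (cexpi phi) (cexpi th)) <=
      cabs w * cabs (csub (cexpi phi) (cexpi th)) by rewrite ler_wpM2r// cabs_ge0.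
  lra.
have inb p : `|p - th| <= 32 * (K * h) -> w = (cabs w * cos p, cabs w * sin p) ->
    carleson_box (th - (32 * K + 1) * h) ((64 * K + 2) * h) w.
  rewrite ler_norml => /andP[pl pr] wp; exists (cabs w), p; split => //.
    by have := cabs_le_csub a w; rewrite csubC hE; lra.
  by apply/andP; split; lra.
have per (y : R) : cos (y + 2 * pi) = cos y /\ sin (y + 2 * pi) = sin y.
  by rewrite (_ : 2 * pi = pi *+ 2) ?cosD2pi ?sinD2pi// mulr2n; ring.
have [u|u|u] := @arc_le_chord R phi th (8 * (K * h)) p02 th02
  ltac:(by apply: (le_trans ch); rewrite ler_pM2l).
- by apply: (inb phi) => //; lra.
- apply: (inb (phi - 2 * pi)).
    by rewrite (_ : phi - 2 * pi - th = phi - th - 2 * pi); [lra|ring].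
  by have [<- <-] := per (phi - 2 * pi); rewrite subrK.
- apply: (inb (phi + 2 * pi)).
    by rewrite (_ : phi + 2 * pi - th = phi - th + 2 * pi); [lra|ring].
  by have [-> ->] := per phi.
Qed.

Lemma bergman_of_carleson (mu : {measure set C -> \bar R}) (t K b : R) :
  0 < t -> 0 < K -> 0 < b ->
  (forall a l : R, 0 < l -> l <= 2 * pi -> (mu (carleson_box a l) <= (K * l `^ b)%:E)%E) ->
  exists2 K' : R, 0 < K' & forall z, disk z ->
    (mu (bergman_disk z t) <= (K' * (1 - cabs z) `^ b)%:E)%E.
Proof.
move=> t0 K0 b0 hmu; have pi2 := pi_ge2 R.
have [M M0 hM] := bergman_disk_bounded t0.
pose L := 64 * M + 2.
have L0 : 0 < L by rewrite /L; lra.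
pose K1 := K * L `^ b; pose K2 := 2 * K * (2 * pi) `^ b * L `^ b.
have Lb : 0 < L `^ b by rewrite powR_gt0.
have K10 : 0 < K1 by rewrite mulr_gt0.
have K20 : 0 < K2 by rewrite !mulr_gt0// powR_gt0// mulr_gt0// pi_gt0.
exists (K1 + K2); first by rewrite addr_gt0.
move=> z zd; have := zd; rewrite /disk/= => z1.
have hz : 0 < 1 - cabs z by lra.
have mB := measurable_bergman_disk t0 zd.
(* At small height one box of comparable size suffices. Otherwise the height is bounded below and
   two full boxes cover everything; the factor L^b in [K2] pays for the missing power. *)
have [sm|bg] := leP (L * (1 - cabs z)) 1.
  have [th th02 zE] := polar_decomposition z.
  apply: (@le_trans _ _ (mu (carleson_box (th - (32 * M + 1) * (1 - cabs z)) (L * (1 - cabs z))))).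
    apply: le_measure; rewrite ?inE//.
      by apply: measurable_carleson_box; [rewrite mulr_gt0|lra].
    move=> w wd; have [h1 h2] := hM z w zd wd.
    by apply: ball_in_carleson_box => //; exact: wd.1.
  apply: (le_trans (hmu _ _ _ _)); [by rewrite mulr_gt0|lra|].
  rewrite lee_fin powRM; [|exact: ltW|exact: ltW].
  by rewrite mulrA ler_wpM2r ?powR_ge0// lerDl ltW.
have p20 : 0 < 2 * pi :> R by rewrite mulr_gt0// pi_gt0.
have m1 := @measurable_carleson_box R 0 (2 * pi) p20 (lexx _).
have m2 := @measurable_carleson_box R pi (2 * pi) p20 (lexx _).
apply: (@le_trans _ _ (mu (carleson_box 0 (2 * pi) `|` carleson_box pi (2 * pi)))).
  apply: le_measure; rewrite ?inE//; first exact: measurableU.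
  by move=> w [wd _]; exact: disk_in_two_boxes.
apply: (le_trans (measureU2 _ m1 m2)).
apply: (le_trans (leeD (hmu 0 (2 * pi) p20 (lexx _)) (hmu pi (2 * pi) p20 (lexx _)))).
rewrite -EFinD lee_fin.
have e1 : 1 <= L `^ b * (1 - cabs z) `^ b.
  rewrite -powRM; [|exact: ltW|exact: ltW].
  rewrite -[X in X <= _](_ : 1 `^ b = 1); last by rewrite powR1.
  apply: powR_le_mono; lra.
have e2 : 2 * K * (2 * pi) `^ b <= K2 * (1 - cabs z) `^ b.
  have -> : K2 * (1 - cabs z) `^ b = 2 * K * (2 * pi) `^ b * (L `^ b * (1 - cabs z) `^ b).
    by rewrite /K2; ring.
  by rewrite ler_peMr// !mulr_ge0 ?powR_ge0// ltW.
have e3 : 0 <= K1 * (1 - cabs z) `^ b by rewrite mulr_ge0 ?powR_ge0// ltW.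
have -> : K * (2 * pi) `^ b + K * (2 * pi) `^ b = 2 * K * (2 * pi) `^ b by ring.
by apply: (le_trans e2); rewrite mulrDl lerDr.
Qed.

End CarlesonBoxes.

(** * Test functions: from the weak type inequality to Bergman disks *)

Section PowerComparison.
Variable R : realType.

(** Logarithms treat both signs of [c] at once, whence the exponent |c| of the constant. *)
Lemma powR_comparable (x y k c : R) : 0 < x -> 0 < y -> 1 <= k -> x <= k * y -> y <= k * x ->
  x `^ c <= k `^ `|c| * y `^ c.
Proof.
move=> x0 y0 k1 xy yx; have k0 : 0 < k by lra.
have lk : 0 <= ln k by rewrite ln_ge0.
have lx : `|ln x - ln y| <= ln k.
  have e1 : ln x <= ln k + ln y by rewrite -lnM ?posrE// ler_ln ?posrE ?mulr_gt0.
  have e2 : ln y <= ln k + ln x by rewrite -lnM ?posrE// ler_ln ?posrE ?mulr_gt0.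
  by rewrite ler_norml; apply/andP; split; lra.
rewrite /powR !gt_eqF// -expRD ler_expR.
have : c * (ln x - ln y) <= `|c| * ln k.
  by apply: (le_trans (ler_norm _)); rewrite normrM ler_wpM2l.
lra.
Qed.

Lemma powR_anti (x y c : R) : c <= 0 -> 0 < x -> x <= y -> y `^ c <= x `^ c.
Proof.
move=> c0 x0 xy; have y0 := lt_le_trans x0 xy.
by rewrite /powR !gt_eqF// ler_expR ler_wnM2l// ler_ln.
Qed.

End PowerComparison.

Section IntegralCover.
Context d (T : measurableType d) (R : realType).
Variable mu : {measure set T -> \bar R}.

(** On [D] the function is dominated by the sum of the g_k times the indicators of the B_k, which
    may overlap. All layer-by-layer estimates of integrals below go through this. *)
Lemma integral_le_cover (D : set T) (G : T -> \bar R) (B : nat -> set T) (g : nat -> R) :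
  measurable D -> measurable_fun D G -> (forall x, D x -> 0 <= G x)%E ->
  (forall k, measurable (B k)) -> (forall k, 0 <= g k) -> D `<=` \bigcup_k B k ->
  (forall k x, D x -> B k x -> (G x <= (g k)%:E)%E) ->
  (\int[mu]_(x in D) G x <= \sum_(0 <= k <oo) ((g k)%:E * mu (B k)))%E.
Proof.
move=> mD mG G0 mB g0 cov hG.
pose h k x := ((g k)%:E * (\1_(B k) x)%:E)%E.
have h0 k x : (0 <= h k x)%E by rewrite /h -EFinM lee_fin mulr_ge0.
have mh k : measurable_fun D (h k).
  apply: measurable_funTS; apply: emeasurable_funM => //.
  by apply/measurable_EFinP; exact: measurable_indic.
apply: (@le_trans _ _ (\int[mu]_(x in D) \sum_(0 <= k <oo) h k x)%E).
  apply: ge0_le_integral => //.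
    exact: ge0_emeasurable_sum.
  move=> x Dx; have [k _ Bx] := cov x Dx.
  apply: (@le_trans _ _ (h k x)).
    by rewrite /h indicE mem_set// mule1; exact: hG.
  apply: le_trans (nneseries_lim_ge k.+1 _); last by move=> *; exact: h0.
  rewrite big_nat_recr//= leeDr//.
  by apply: sume_ge0 => *; exact: h0.
rewrite integral_nneseries//.
apply: lee_nneseries => [k _ _|k _].
  by apply: integral_ge0 => *; exact: h0.
rewrite /h ge0_integralZl_EFin//; last first.
  by apply: measurable_funTS; apply/measurable_EFinP; exact: measurable_indic.
apply: lee_pmul => //.
- by rewrite lee_fin.
- by apply: integral_ge0 => x _; rewrite lee_fin.
rewrite integral_indic//; apply: le_measure; rewrite ?inE//; exact: measurableI.
Qed.

End IntegralCover.

(** * Arcs of the circle and the weak quasinorm *)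

Section CircleMeasure.
Variable R : realType.
Notation C := (R * R)%type.
Notation leb := (@lebesgue_measure R).

(* Lebesgue measure is by construction an outer measure: no measurability is needed. *)
Lemma lebesgue_measure_mono (A B : set R) : A `<=` B -> (leb A <= leb B)%E.
Proof.
move=> AB; rewrite /lebesgue_measure /lebesgue_stieltjes_measure /measure_extension.
by apply: le_outer_measure.
Qed.

Lemma circle_measure_ge0 (E : set C) : (0 <= circle_measure E)%E.
Proof.
by rewrite -[leLHS](measure0 leb); exact: lebesgue_measure_mono.
Qed.

(** Any two points of the set are at chord distance at most 2r, hence at angular distance at most 8r
    modulo a full turn: three intervals of length 16r. *)
Lemma circle_measure_arc (w : C) (r : R) : 0 <= r ->
  (circle_measure (cball w r) <= (48 * r)%:E)%E.
Proof.
move=> r0; rewrite /circle_measure.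
set A := (X in leb X).
have [[b [b02 bw]]|ne] := pselect (exists b, A b); last first.
  have -> : A = set0 by apply/seteqP; split => // th Ath; apply: ne; exists th.
  by rewrite measure0 lee_fin mulr_ge0.
pose I c : set R := `[(c - 8 * r)%R, (c + 8 * r)%R]%classic.
have mI c : measurable (I c) by exact: measurable_itv.
have sub : A `<=` I b `|` I (b + 2 * pi) `|` I (b - 2 * pi).
  move=> th [th02 thw]; rewrite /cball/= in bw thw.
  have dd : cabs (csub (cexpi th) (cexpi b)) <= 2 * r.
    have := csub_triangle (cexpi th) w (cexpi b); rewrite (csubC w); lra.
  have mkI c u : `|th - b - u| <= 4 * (2 * r) -> c = b + u -> I c th.
    rewrite ler_norml => /andP[u1 u2] ->; rewrite /I/= in_itv/=.
    by apply/andP; split; lra.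
  have [u|u|u] := arc_le_chord th02 b02 dd.
  - by left; left; apply: (mkI b 0); rewrite ?subr0 ?addr0.
  - by left; right; apply: (mkI _ (2 * pi)).
  - by right; apply: (mkI _ (- (2 * pi))) => //; rewrite opprK.
apply: (le_trans (lebesgue_measure_mono sub)).
have lI c : leb (I c) = (16 * r)%:E.
  by rewrite /I lebesgue_measure_segment; [congr EFin; ring|lra].
have m2 := measurableU _ _ (mI b) (mI (b + 2 * pi)).
apply: (le_trans (measureU2 leb m2 (mI (b - 2 * pi)))).
apply: (le_trans (leeD (measureU2 leb (mI b) (mI (b + 2 * pi))) (lexx _))).
by rewrite [X in (X + _ + _)%E]lI [X in (_ + X + _)%E]lI [X in (_ + _ + X)%E]lI -!EFinD lee_fin; lra.
Qed.

(** The interval extends away from the nearer end of the period: to the right of [b] if b <= pi,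
    otherwise to the left. *)
Lemma arc_in_period (b s : R) : 0 <= b < 2 * pi -> 0 < s <= 1 ->
  exists c : R, `[c, c + s]%classic `<=` [set th | 0 <= th < 2 * pi /\ `|th - b| <= s].
Proof.
move=> /andP[b0 b2] /andP[s0 s1]; have pi2 := pi_ge2 R.
have [bp|bp] := leP b pi.
  exists b => th /=; rewrite in_itv/= => /andP[h1 h2]; split.
    by apply/andP; split; lra.
  by rewrite ger0_norm; lra.
exists (b - s) => th /=; rewrite in_itv/= => /andP[h1 h2]; split.
  by apply/andP; split; lra.
by rewrite ler0_norm; lra.
Qed.

(** A function at least v on an arc of length s has weak norm at least v s^(1/q). A real level
    strictly below v is used because v may be infinite and the level sets are strict. *)
Lemma weakLq_lower (q N s c : R) (g : C -> \bar R) (v : \bar R) : 1 < q -> 0 <= N -> 0 < s ->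
  (weakLq_norm q g <= N%:E)%E ->
  (forall th, c <= th <= c + s -> 0 <= th < 2 * pi /\ (v <= g (cexpi th))%E) ->
  (v <= (N / s `^ q^-1)%:E)%E.
Proof.
move=> q1 N0 s0 hN hv; rewrite leNgt; apply/negP => vlt.
have sq : 0 < s `^ q^-1 by rewrite powR_gt0.
have [lam lam1 lam2] : exists2 lam : R, N / s `^ q^-1 < lam & (lam%:E < v)%E.
  case: v vlt hv => [v|_ _|//].
    rewrite lte_fin => vlt _; exists ((N / s `^ q^-1 + v) / 2); rewrite ?lte_fin; lra.
  by exists (N / s `^ q^-1 + 1); rewrite ?ltry//; lra.
have lam0 : 0 < lam by apply: le_lt_trans lam1; rewrite divr_ge0// ltW.
have : ((lam * s `^ q^-1)%:E <= N%:E)%E.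
  apply: le_trans hN; apply: le_ereal_sup_tmp.
  exists (lam%:E * (circle_measure [set xi | (lam%:E < `|g xi|)%E]) `^ q^-1)%E.
    by exists lam.
  rewrite EFinM lee_pmul2l ?lte_fin// -poweR_EFin.
  apply: gt0_ler_poweR; rewrite ?in_itv/= ?leey ?andbT.
  - by rewrite invr_ge0; lra.
  - by rewrite lee_fin ltW.
  - exact: circle_measure_ge0.
  have -> : s%:E = leb `[c, c + s]%classic.
    by rewrite lebesgue_measure_segment; [congr EFin; ring|lra].
  apply: lebesgue_measure_mono => th /=; rewrite in_itv/= => /hv[h1 h2]; split => //.
  by apply: (lt_le_trans (lt_le_trans lam2 h2)); exact: lee_abs.
rewrite lee_fin leNgt => /negP; apply.
by rewrite -ltr_pdivrMr.
Qed.

End CircleMeasure.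

Section TestFunctions.
Variable R : realType.
Notation C := (R * R)%type.
Implicit Types (a w z xi : C).

Lemma measurable_analytic (f : C -> C) : analytic_on_disk f ->
  measurable_fun (@disk R) (fun z => cabs (f z)).
Proof.
move=> af; apply: measurable_fun_lower_semicontinuous2; first exact: measurable_disk.
move=> z zd e e0.
have [|d d0 hd] := @cdifferentiable_cabs_near R f z (e / 2) (af z zd); first by rewrite divr_gt0.
exists d => // w w1 w2; have [+ _] := hd w w1 w2.
rewrite ler_norml => /andP[]; lra.
Qed.

Lemma measurable_height_powR (c : R) : measurable_fun [set: C] (fun z : C => (1 - cabs z) `^ c).
Proof.
have m : measurable_fun [set: C] (fun z : C => 1 - cabs z).
  by apply: measurable_funB => //; exact: measurable_cabs.
exact: (measurableT_comp (measurable_powR c) m).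
Qed.

Lemma measurable_area_integrand (f : C -> C) (c : R) : analytic_on_disk f ->
  measurable_fun (@disk R) (fun z => (cabs (f z) * (1 - cabs z) `^ c)%:E).
Proof.
move=> af; apply/measurable_EFinP; apply: measurable_funM; first exact: measurable_analytic.
by apply: measurable_funTS; exact: measurable_height_powR.
Qed.

Lemma measurable_mu_integrand (f : C -> C) : analytic_on_disk f ->
  measurable_fun (@disk R) (fun z => (cabs (f z) / (1 - cabs z))%:E).
Proof.
move=> af; apply: (eq_measurable_fun (fun z => (cabs (f z) * (1 - cabs z) `^ (-1))%:E)).
  by move=> z /set_mem zd; rewrite powR_inv1// subr_ge0 ltW.
exact: measurable_area_integrand.
Qed.

Definition test_function a n : C -> C :=
  fun w => cpow (cinv (csub (cone R) (cmul (cconj a) w))) n.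

Lemma analytic_test_function a n : disk a -> analytic_on_disk (test_function a n).
Proof.
rewrite /disk/= => a1 z; rewrite /disk/= => z1; apply: cdifferentiable_pow.
have E w : csub (cone R) (cmul (cconj a) w) = cadd (cone R) (cmul (- a.1, a.2) w).
  by rewrite /csub /cadd /cmul /cconj/=; congr pair; ring.
have -> : (fun w => cinv (csub (cone R) (cmul (cconj a) w))) =
    (fun w => cinv (cadd (cone R) (cmul (- a.1, a.2) w))).
  by apply/funext => w; rewrite E.
apply: cdifferentiable_inv_affine; rewrite -E gt_eqF//.
have := csub_conj_le (ltW a1) (ltW z1); lra.
Qed.

Lemma cabs_test_function a n w :
  cabs (test_function a n w) = (cabs (csub (cone R) (cmul (cconj a) w)))^-1 ^+ n.
Proof. by rewrite /test_function cabs_pow cabs_inv. Qed.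

(** With D = |1 - conj(a) z|, moving from z to [xi] changes the kernel by at most |z-xi| < s(1-|z|)
    <= sD, and at [xi] its modulus is |xi-a|. *)
Lemma kernel_dist_lower (s : R) a xi z : 1 < s -> disk a -> cabs xi = 1 -> lusin_cone s xi z ->
  1 - cabs z <= cabs (csub (cone R) (cmul (cconj a) z)) /\
  cabs (csub xi a) <= (1 + s) * cabs (csub (cone R) (cmul (cconj a) z)).
Proof.
rewrite /disk/= => s1 a1 x1 [+ hz]; rewrite /disk/= => z1.
set D := cabs (csub (cone R) (cmul (cconj a) z)).
have hD : 1 - cabs z <= D by rewrite /D csub_conj_sym; apply: csub_conj_le; exact: ltW.
split => //; rewrite cdist_unit// in hz.
rewrite -cdist_unit// -csub_conj_sym.
have := cabs_le_csub (csub (cone R) (cmul (cconj a) xi)) (csub (cone R) (cmul (cconj a) z)).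
rewrite -/D.
have -> : csub (csub (cone R) (cmul (cconj a) xi)) (csub (cone R) (cmul (cconj a) z)) =
   cmul (cconj a) (csub z xi).
  by rewrite /csub /cmul/=; congr pair; ring.
rewrite cabsM cabs_conj csubC (csubC z).
have : cabs a * cabs (csub xi z) <= cabs (csub xi z) by rewrite ler_piMl ?cabs_ge0// ltW.
have : s * (1 - cabs z) <= s * D by rewrite ler_pM2l//; lra.
rewrite mulrDl mul1r; lra.
Qed.

(** Such points lie within sy of [xi], hence in a square of side 2sy. *)
Lemma area_cone_slice (s y : R) xi : 1 < s -> 0 < y -> cabs xi = 1 ->
  (area (lusin_cone s xi `&` [set z : C | (1 - cabs z <= y)%R]) <= (4 * s ^+ 2 * y ^+ 2)%:E)%E.
Proof.
move=> s1 y0 x1; have sy : 0 < s * y by rewrite mulr_gt0//; lra.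
apply: (@le_trans _ _ (area (square xi (s * y)))).
  apply: le_measure; rewrite ?inE.
  - apply: measurableI; first exact: measurable_lusin_cone.
    by apply: measurable_set_le => //; apply: measurable_funB => //; exact: measurable_cabs.
  - exact: measurable_square.
  move=> z [[zd]]; rewrite cdist_unit// csubC /= => h hy.
  have hs : cabs (csub z xi) <= s * y.
    by apply: (le_trans (ltW h)); rewrite ler_pM2l//; lra.
  have := le_trans (normr_fst_cabs _) hs; have := le_trans (normr_snd_cabs _) hs.
  by rewrite /square/= !in_itv/= !ler_distl => -> ->.
by rewrite /square area_rectangle; [rewrite lee_fin le_eqVlt; apply/orP; left; apply/eqP; ring|lra|lra].
Qed.

End TestFunctions.

(** * The area integral of a test function over a cone *)

Section TestFunctionIntegral.
Variable R : realType.
Notation C := (R * R)%type.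
Variables (s alpha : R) (n : nat).
Hypotheses (s1 : 1 < s) (alpha1 : -1 < alpha) (n_large : alpha + 2 <= n%:R).

Let nu : R := n%:R.
Let G a (z : C) : \bar R :=
  (cabs (test_function a n z) * (1 - cabs z) `^ (alpha - 1))%:E.

Let G0 a z : (0 <= G a z)%E.
Proof. by rewrite lee_fin mulr_ge0 ?cabs_ge0 ?powR_ge0. Qed.

Let D a (z : C) := cabs (csub (cone R) (cmul (cconj a) z)).

Let GE a z : 0 < D a z -> cabs (test_function a n z) = D a z `^ (- nu).
Proof.
move=> D0; rewrite cabs_test_function -/(D a z) powRN /nu powR_mulrn ?ltW//.
by rewrite exprVn.
Qed.

Let nu0 : 0 <= nu. Proof. exact: ler0n. Qed.

(* Below height dl the kernel is at most dl ^ (- n), above it at most the height to the power - n. *)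
Lemma test_integral_low : exists2 K : R, 0 < K & forall (a xi : C) (dl : R), disk a ->
  cabs xi = 1 -> 0 < dl -> cabs (csub xi a) = (1 + s) * dl ->
  (\int[@area R]_(z in lusin_cone s xi `&` [set z | (1 - cabs z <= dl)%R]) G a z <=
    (K * dl `^ (alpha + 1 - nu))%:E)%E.
Proof.
have ss1 := s1; have al1 := alpha1; have nl := n_large.
pose M := 2 `^ `|alpha - 1| * (4 * s ^+ 2).
(* A layer of height y has area of order y^2 and weight y^(alpha-1), so halving y multiplies its
   share by 2^(-alpha-1), below 1 because alpha > -1. *)
pose x : R := 2^-1 `^ (alpha + 1).
have x0 : 0 <= x by exact: powR_ge0.
have x1 : x < 1 by apply: powR_lt1; [apply/andP; split; lra|lra].
have M0 : 0 < M by rewrite /M mulr_gt0 ?powR_gt0// mulr_gt0// exprn_gt0//; lra.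
exists (M / (1 - x)); first by rewrite divr_gt0// subr_gt0.
move=> a xi dl ad xi1 dl0 hdl.
pose y k := 2^-1 ^+ k * dl.
have y0 k : 0 < y k by rewrite mulr_gt0// exprn_gt0.
pose B k := lusin_cone s xi `&` [set z | 1 - cabs z <= y k].
have mle (t : R) : measurable [set z : C | 1 - cabs z <= t].
  by apply: measurable_set_le => //; apply: measurable_funB => //; exact: measurable_cabs.
have mge (t : R) : measurable [set z : C | t < 1 - cabs z].
  by apply: measurable_set_lt => //; apply: measurable_funB => //; exact: measurable_cabs.
have mcone := measurable_lusin_cone s xi.
pose B' k := B k `&` [set z | y k / 2 < 1 - cabs z].
pose g k := dl `^ (- nu) * (2 `^ `|alpha - 1| * y k `^ (alpha - 1)).
have g0 k : 0 <= g k by rewrite !mulr_ge0 ?powR_ge0.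
apply: (le_trans (@integral_le_cover _ _ _ (@area R) _ (G a) B' g _ _ _ _ _ _ _)) => //.
- exact: (measurableI _ _ mcone (mle dl)).
- apply: measurable_funS (measurable_area_integrand (alpha - 1) (analytic_test_function n ad)) => //.
    exact: measurable_disk.
  by move=> z [[]].
- by move=> k; exact: (measurableI _ _ (measurableI _ _ mcone (mle (y k))) (mge (y k / 2))).
- move=> z [zc /= hz]; have [zd _] := zc; rewrite /disk/= in zd.
  have [||k /andP[k1 k2]] := @geometric_layer R 2^-1 dl (1 - cabs z).
  + by apply/andP; split; lra.
  + by rewrite hz andbT subr_gt0.
  exists k => //; split; first by split.
  by move: k1; rewrite exprS -mulrA /= /y mulrC.
- move=> k z [zc hz] [[_ /= h1] /= h2]; rewrite /G /g lee_fin.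
  have [zd _] := zc; rewrite /disk/= in zd.
  have [d1 d2] := kernel_dist_lower s1 ad xi1 zc; rewrite -/(D a z) in d1 d2.
  have Ddl : dl <= D a z by rewrite -(@ler_pM2l _ (1 + s)) -?hdl//; lra.
  rewrite GE; last exact: lt_le_trans Ddl.
  apply: ler_pM; rewrite ?powR_ge0//.
    by apply: powR_anti => //; rewrite oppr_le0.
  by apply: powR_comparable => //; have := y0 k; lra.
apply: (@le_trans _ _ (\sum_(0 <= k <oo) (M * dl `^ (alpha + 1 - nu) * x ^+ k)%:E)%E); last first.
  apply: (le_trans (nneseries_geometric_le _ _)).
  - by rewrite mulr_ge0 ?powR_ge0// ltW.
  - by rewrite x0 x1.
  - by rewrite lee_fin le_eqVlt; apply/orP; left; apply/eqP; ring.
apply: lee_nneseries => [k _ _|k _]; first by rewrite mule_ge0// lee_fin.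
apply: (@le_trans _ _ ((g k)%:E * (4 * s ^+ 2 * y k ^+ 2)%:E)%E).
  apply: lee_pmul => //; first by rewrite lee_fin.
  apply: le_trans (area_cone_slice s1 (y0 k) xi1).
  by apply: le_measure; rewrite ?inE; [|exact: (measurableI _ _ mcone (mle (y k)))|by move=> z []];
    exact: (measurableI _ _ (measurableI _ _ mcone (mle (y k))) (mge (y k / 2))).
rewrite -EFinM lee_fin le_eqVlt; apply/orP; left; apply/eqP.
have e1 : y k `^ (alpha - 1) * y k ^+ 2 = dl `^ (alpha + 1) * x ^+ k.
  rewrite -(powR_mulrn 2 (ltW (y0 k))) -powRD; last by rewrite (gt_eqF (y0 k)) implybT.
  have -> : alpha - 1 + 2%:R = alpha + 1 by ring.
  by rewrite /y powRM ?exprn_ge0 ?ltW// powR_exprn// mulrC.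
have e2 : dl `^ (alpha + 1 - nu) = dl `^ (alpha + 1) * dl `^ (- nu).
  by rewrite powRD// (gt_eqF dl0) implybT.
rewrite e2 /g /M.
transitivity (2 `^ `|alpha - 1| * (4 * s ^+ 2) * dl `^ (- nu) * (y k `^ (alpha - 1) * y k ^+ 2)).
  by ring.
by rewrite e1; ring.
Qed.

(** Layers now double upwards from [dl]; the one of height y contributes y^(alpha-1-n+2), and the
    exponent is at most -1 by the choice of n. *)
Lemma test_integral_high : exists2 K : R, 0 < K & forall (a xi : C) (dl : R), disk a ->
  cabs xi = 1 -> 0 < dl -> cabs (csub xi a) = (1 + s) * dl ->
  (\int[@area R]_(z in lusin_cone s xi `&` [set z | (dl < 1 - cabs z)%R]) G a z <=
    (K * dl `^ (alpha + 1 - nu))%:E)%E.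
Proof.
have ss1 := s1; have al1 := alpha1; have nl := n_large.
pose c := alpha - 1 - nu.
pose M := 2 `^ `|c| * (16 * s ^+ 2).
pose x : R := 2 `^ (alpha + 1 - nu).
have x0 : 0 <= x by exact: powR_ge0.
have x1 : x < 1.
  have -> : x = 2^-1 `^ (nu - alpha - 1).
    rewrite /x -powR_inv1// -powRrM mulN1r; congr (_ `^ _); ring.
  by apply: powR_lt1; [apply/andP; split; lra|rewrite /nu; lra].
have M0 : 0 < M by rewrite /M mulr_gt0 ?powR_gt0// mulr_gt0// exprn_gt0//; lra.
exists (M / (1 - x)); first by rewrite divr_gt0// subr_gt0.
move=> a xi dl ad xi1 dl0 hdl.
pose y k := 2 ^+ k * dl.
have y0 k : 0 < y k by rewrite mulr_gt0// exprn_gt0.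
have mle (t : R) : measurable [set z : C | 1 - cabs z <= t].
  by apply: measurable_set_le => //; apply: measurable_funB => //; exact: measurable_cabs.
have mge (t : R) : measurable [set z : C | t <= 1 - cabs z].
  by apply: measurable_set_le => //; apply: measurable_funB => //; exact: measurable_cabs.
have mgt (t : R) : measurable [set z : C | t < 1 - cabs z].
  by apply: measurable_set_lt => //; apply: measurable_funB => //; exact: measurable_cabs.
have mcone := measurable_lusin_cone s xi.
pose B k := lusin_cone s xi `&` [set z | 1 - cabs z <= 2 * y k].
pose B' k := B k `&` [set z | y k <= 1 - cabs z].
pose g k := 2 `^ `|c| * y k `^ c.
have g0 k : 0 <= g k by rewrite !mulr_ge0 ?powR_ge0.
apply: (le_trans (@integral_le_cover _ _ _ (@area R) _ (G a) B' g _ _ _ _ _ _ _)) => //.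
- exact: (measurableI _ _ mcone (mgt dl)).
- apply: measurable_funS (measurable_area_integrand (alpha - 1) (analytic_test_function n ad)) => //.
    exact: measurable_disk.
  by move=> z [[]].
- by move=> k; exact: (measurableI _ _ (measurableI _ _ mcone (mle (2 * y k))) (mge (y k))).
- move=> z [zc /= hz]; have [zd _] := zc; rewrite /disk/= in zd.
  have [||k /andP[k1 k2]] := @geometric_layer R 2^-1 (1 - cabs z) dl.
  + by apply/andP; split; lra.
  + by rewrite dl0 ltW.
  have k0 : 0 < (2 : R) ^+ k by rewrite exprn_gt0.
  rewrite exprVn in k2; rewrite exprS exprVn in k1.
  exists k => //; split; first split => //=.
    rewrite -(@ltr_pM2l _ (2 * 2 ^+ k)) ?mulr_gt0// in k1; rewrite /y mulrA.
    have : 2 * 2 ^+ k * (2^-1 / 2 ^+ k * (1 - cabs z)) = 1 - cabs z.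
      by field; rewrite gt_eqF.
    by move=> e; rewrite e in k1; exact: ltW.
  by move: k2; rewrite /y/= mulrC ler_pdivlMr// mulrC.
- move=> k z [zc hz] [[_ /= h1] /= h2]; rewrite /G /g lee_fin.
  have [zd _] := zc; rewrite /disk/= in zd.
  have [d1 d2] := kernel_dist_lower s1 ad xi1 zc; rewrite -/(D a z) in d1 d2.
  have h0 : 0 < 1 - cabs z by lra.
  rewrite GE; last exact: lt_le_trans d1.
  apply: (@le_trans _ _ ((1 - cabs z) `^ c)).
    have -> : (1 - cabs z) `^ c = (1 - cabs z) `^ (- nu) * (1 - cabs z) `^ (alpha - 1).
      by rewrite -powRD ?(gt_eqF h0) ?implybT//; congr (_ `^ _); rewrite /c; ring.
    by rewrite ler_wpM2r ?powR_ge0//; apply: powR_anti => //; rewrite oppr_le0.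
  by apply: powR_comparable => //; have := y0 k; lra.
apply: (@le_trans _ _ (\sum_(0 <= k <oo) (M * dl `^ (alpha + 1 - nu) * x ^+ k)%:E)%E); last first.
  apply: (le_trans (nneseries_geometric_le _ _)).
  - by rewrite mulr_ge0 ?powR_ge0// ltW.
  - by rewrite x0 x1.
  - by rewrite lee_fin le_eqVlt; apply/orP; left; apply/eqP; ring.
apply: lee_nneseries => [k _ _|k _]; first by rewrite mule_ge0// lee_fin.
apply: (@le_trans _ _ ((g k)%:E * (4 * s ^+ 2 * (2 * y k) ^+ 2)%:E)%E).
  apply: lee_pmul => //; first by rewrite lee_fin.
  apply: le_trans (area_cone_slice s1 (_ : 0 < 2 * y k) xi1); last by rewrite mulr_gt0.
  by apply: le_measure; rewrite ?inE; [|exact: (measurableI _ _ mcone (mle (2 * y k)))|by move=> z []];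
    exact: (measurableI _ _ (measurableI _ _ mcone (mle (2 * y k))) (mge (y k))).
rewrite -EFinM lee_fin le_eqVlt; apply/orP; left; apply/eqP.
have e1 : y k `^ c * y k ^+ 2 = dl `^ (alpha + 1 - nu) * x ^+ k.
  rewrite -(powR_mulrn 2 (ltW (y0 k))) -powRD; last by rewrite (gt_eqF (y0 k)) implybT.
  have -> : c + 2%:R = alpha + 1 - nu by rewrite /c; ring.
  by rewrite /y powRM ?exprn_ge0 ?ltW// powR_exprn// mulrC.
rewrite /g /M.
transitivity (2 `^ `|c| * (16 * s ^+ 2) * (y k `^ c * y k ^+ 2)).
  by ring.
by rewrite e1; ring.
Qed.

(** The cone is cut at height |xi-a|/(1+s), where the two lower bounds of [kernel_dist_lower]
    balance. *)
Lemma test_integral_bound : exists2 K : R, 0 < K & forall a xi : C, disk a -> cabs xi = 1 ->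
  (area_cone_integral s alpha (test_function a n) xi <=
    (K * cabs (csub xi a) `^ (alpha + 1 - nu))%:E)%E.
Proof.
have ss1 := s1; have al1 := alpha1; have nl := n_large.
have [K1 K10 h1] := test_integral_low; have [K2 K20 h2] := test_integral_high.
have pi0 := pi_gt0 R.
pose L := (1 + s)^-1 `^ (alpha + 1 - nu).
have s0 : 0 < (1 + s)^-1 by rewrite invr_gt0; lra.
have L0 : 0 < L by rewrite powR_gt0.
exists ((K1 + K2) * L); first by rewrite mulr_gt0// addr_gt0.
move=> a xi ad xi1; have := ad; rewrite /disk/= => a1.
pose dl := cabs (csub xi a) / (1 + s).
have hdl : cabs (csub xi a) = (1 + s) * dl by rewrite /dl; field; rewrite gt_eqF//; lra.
have x0 : 0 < cabs (csub xi a) by have := cabs_le_csub xi a; rewrite xi1; lra.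
have dl0 : 0 < dl by rewrite divr_gt0//; lra.
have mcone := measurable_lusin_cone s xi.
have mGd := measurable_area_integrand (alpha - 1) (analytic_test_function n ad).
have mG : measurable_fun (lusin_cone s xi) (G a).
  by apply: measurable_funS mGd; [exact: measurable_disk|move=> z []].
have mle : measurable [set z : C | 1 - cabs z <= dl].
  by apply: measurable_set_le => //; apply: measurable_funB => //; exact: measurable_cabs.
have mgt : measurable [set z : C | dl < 1 - cabs z].
  by apply: measurable_set_lt => //; apply: measurable_funB => //; exact: measurable_cabs.
have -> : area_cone_integral s alpha (test_function a n) xi =
   (pi^-1%:E * \int[@area R]_(z in lusin_cone s xi) G a z)%E.
  rewrite -ge0_integralZl_EFin//; last by rewrite invr_ge0 ltW.
  by apply: eq_integral => z _; rewrite /G -EFinM mulrC.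
have cE : lusin_cone s xi = (lusin_cone s xi `&` [set z | 1 - cabs z <= dl]) `|`
    (lusin_cone s xi `&` [set z | dl < 1 - cabs z]).
  rewrite -setIUr; apply/esym/setIidPl => z _ /=.
  by have [|] := leP (1 - cabs z) dl; [left|right].
apply: (@le_trans _ _ (\int[@area R]_(z in lusin_cone s xi) G a z)%E).
  rewrite gee_pMl ?integral_ge0//.
  by rewrite lee_fin invf_le1//; have := pi_ge2 R; lra.
rewrite cE ge0_integral_setU//.
- apply: (le_trans (leeD (h1 a xi dl ad xi1 dl0 hdl) (h2 a xi dl ad xi1 dl0 hdl))).
  have dlE : dl `^ (alpha + 1 - nu) = L * cabs (csub xi a) `^ (alpha + 1 - nu).
    by rewrite /L -powRM; [rewrite /dl mulrC|exact: ltW|exact: ltW].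
  by rewrite -EFinD -mulrDl lee_fin -mulrA dlE.
- exact: measurableI.
- exact: measurableI.
- by rewrite -cE.
- apply/disj_setPS => z [[_ /= u1] [_ /= u2]].
  by move: u2; rewrite ltNge u1.
Qed.

End TestFunctionIntegral.

(** * Weak norm of the test functions; necessity of the Bergman condition *)

Section NecessityOfBergman.
Variable R : realType.
Notation C := (R * R)%type.
Implicit Types (a w z xi : C).

Lemma area_cone_integral_ge0 (s alpha : R) (f : C -> C) xi :
  (0 <= area_cone_integral s alpha f xi)%E.
Proof.
apply: integral_ge0 => z _; rewrite lee_fin divr_ge0 ?pi_ge0//.
by rewrite mulr_ge0 ?cabs_ge0 ?powR_ge0.
Qed.

Lemma weak_norm_test_function (q s alpha : R) n : 1 < q -> 1 < s -> -1 < alpha ->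
  alpha + 2 <= n%:R ->
  exists2 K : R, 0 < K & forall a, disk a ->
    (weakLq_norm q (area_cone_integral s alpha (test_function a n)) <=
      (K * (1 - cabs a) `^ (q^-1 - (n%:R - alpha - 1)))%:E)%E.
Proof.
move=> q1 s1 al1 nl; have [K1 K10 hK1] := test_integral_bound s1 al1 nl.
set b := n%:R - alpha - 1; have b1 : 1 <= b by rewrite /b; lra.
have q0 : 0 < q^-1 by rewrite invr_gt0; lra.
have qle : q^-1 < 1 by rewrite invf_lt1; lra.
have p48 : 0 < 48 `^ q^-1 :> R by rewrite powR_gt0.
exists (K1 * 48 `^ q^-1); first by rewrite mulr_gt0.
move=> a ad; have := ad; rewrite /disk/= => a1.
apply: ge_ereal_sup => _ [lam /= lam0 <-].
(* The distance from [a] at which the pointwise bound equals [lam]: the level set lies within [rho]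
   of [a]. *)
pose rho := (K1 / lam) `^ b^-1.
have Kl : 0 < K1 / lam by rewrite divr_gt0.
have rho0 : 0 < rho by rewrite powR_gt0.
have rhoE : rho `^ (- b) = lam / K1.
  rewrite /rho -powRrM mulrN mulVf ?gt_eqF//; last lra.
  by rewrite powR_inv1 ?ltW// invf_div.
have sub : [set th : R | 0 <= th < 2 * pi /\
     (lam%:E < `|area_cone_integral s alpha (test_function a n) (cexpi th)|)%E] `<=`
     [set th | 0 <= th < 2 * pi /\ cball a rho (cexpi th)].
  move=> th [th02 hl]; split => //; rewrite /cball/= leNgt; apply/negP => hr.
  move: hl; rewrite gee0_abs ?area_cone_integral_ge0//; apply/negP; rewrite -leNgt.
  apply: (le_trans (hK1 a (cexpi th) ad (cabs_expi th))).
  have -> : alpha + 1 - n%:R = - b by rewrite /b; ring.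
  rewrite lee_fin; apply: (@le_trans _ _ (K1 * rho `^ (- b))).
    by rewrite ler_pM2l//; apply: powR_anti => //; [lra|exact: ltW].
  by rewrite rhoE mulrC divfK ?gt_eqF.
have m48 : (circle_measure [set xi | (lam%:E <
    `|area_cone_integral s alpha (test_function a n) xi|)%E] <= (48 * rho)%:E)%E.
  apply: le_trans (circle_measure_arc a (ltW rho0)).
  exact: lebesgue_measure_mono sub.
(* No boundary point is closer to [a] than 1-|a|, so smaller [rho] gives an empty level set.
   Otherwise lam rho^(1/q) is a multiple of rho^(1/q-b), a negative power and thus largest at rho =
   1-|a|. *)
have [hr|hr] := leP (1 - cabs a) rho; last first.
  have -> : circle_measure [set xi | (lam%:E <
      `|area_cone_integral s alpha (test_function a n) xi|)%E] = 0%E.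
    apply/eqP; rewrite eq_le circle_measure_ge0 andbT.
    rewrite -(measure0 (@lebesgue_measure R)); apply: lebesgue_measure_mono.
    move=> th /sub[_]; rewrite /cball/= => hc.
    have := cabs_le_csub (cexpi th) a; rewrite cabs_expi; lra.
  rewrite poweR0r ?gt_eqF// mule0 lee_fin mulr_ge0 ?powR_ge0//.
  by rewrite ltW// mulr_gt0.
apply: (@le_trans _ _ (lam%:E * ((48 * rho) `^ q^-1)%:E)%E).
  rewrite lee_pmul2l ?lte_fin// -poweR_EFin.
  apply: gt0_ler_poweR; rewrite ?in_itv/= ?leey ?andbT//.
  - exact: ltW.
  - by rewrite lee_fin mulr_ge0// ltW.
rewrite -EFinM lee_fin.
have -> : lam * (48 * rho) `^ q^-1 = K1 * 48 `^ q^-1 * rho `^ (q^-1 - b).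
  have -> : lam = K1 * rho `^ (- b) by rewrite rhoE mulrC divfK ?gt_eqF.
  rewrite powRM ?ltW// powRD; last by rewrite (gt_eqF rho0) implybT.
  by ring.
rewrite ler_pM2l ?mulr_gt0//; apply: powR_anti => //; lra.
Qed.

Lemma mu_cone_ge (mu : {measure set C -> \bar R}) (s c : R) (f : C -> C) xi (S : set C) :
  analytic_on_disk f -> 0 <= c -> measurable S -> S `<=` lusin_cone s xi ->
  (forall w, S w -> c <= cabs (f w) / (1 - cabs w)) ->
  (c%:E * mu S <= mu_cone_integral mu s f xi)%E.
Proof.
move=> af c0 mS Sc hc; have mf := measurable_mu_integrand af.
have g0 z : disk z -> (0 <= (cabs (f z) / (1 - cabs z))%:E)%E.
  by rewrite /disk/= => zd; rewrite lee_fin divr_ge0 ?cabs_ge0// subr_ge0 ltW.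
have mc := measurable_lusin_cone s xi.
have mfc : measurable_fun (lusin_cone s xi) (fun z => (cabs (f z) / (1 - cabs z))%:E).
  by apply: measurable_funS mf; [exact: measurable_disk|move=> z []].
apply: (@le_trans _ _ (\int[mu]_(z in S) (cabs (f z) / (1 - cabs z))%:E)%E); last first.
  by apply: ge0_subset_integral => // z [zd _]; exact: g0.
rewrite -integral_cst//; apply: ge0_le_integral => //.
- exact: measurable_funS mfc.
Qed.

(** The path from [cexpi th] over [cexpi th0] and [z0] to [w] costs eh, 1-|z0| and 2eh, and 1-|z0|
    exceeds 1-|w| by at most 2eh. The total excess 5eh must stay below (s-1)(1-|w|). *)
Lemma cone_stable (s e K : R) (z0 w : C) (th th0 : R) : 0 < e -> 0 < K -> 5 * e * (1 + K) < s - 1 ->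
  disk w -> z0 = (cabs z0 * cos th0, cabs z0 * sin th0) -> disk z0 ->
  forall h : R, 0 < h -> h <= (1 + K) * (1 - cabs w) ->
  cabs (csub w z0) <= 2 * (e * h) -> `|th - th0| <= e * h ->
  lusin_cone s (cexpi th) w.
Proof.
rewrite /disk/= => e0 K0 eK w1 z0E z01 h h0 hw wz thh; split => //.
rewrite cdist_unit ?cabs_expi//.
have t1 := csub_triangle (cexpi th) (cexpi th0) w.
have t2 := csub_triangle (cexpi th0) z0 w.
have t3 := cdist_expi_le th th0.
have t4 : cabs (csub (cexpi th0) z0) = 1 - cabs z0.
  have -> : csub (cexpi th0) z0 = cmul (1 - cabs z0, 0) (cexpi th0).
    by rewrite {1}z0E /csub /cmul /cexpi/=; congr pair; ring.
  rewrite cabsM cabs_expi mulr1 {1}/cabs/= expr0n addr0 sqrtr_sqr ger0_norm//; lra.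
have t5 := cabs_le_csub w z0; rewrite csubC in wz.
have eh : 5 * (e * h) < (s - 1) * (1 - cabs w).
  apply: (@le_lt_trans _ _ (5 * e * (1 + K) * (1 - cabs w))).
    have -> : 5 * (e * h) = 5 * e * h by ring.
    by rewrite -[leRHS]mulrA ler_pM2l// mulr_gt0.
  by rewrite ltr_pM2r// subr_gt0.
rewrite (csubC w) in t5; lra.
Qed.

Lemma bergman_of_cone (mu : {measure set C -> \bar R}) (q alpha s t : R) :
  1 < q -> -1 < alpha -> 1 < s -> 0 < t ->
  (exists2 K : R, 0 < K & forall f : C -> C, analytic_on_disk f ->
    (weakLq_norm q (mu_cone_integral mu s f) <=
      K%:E * weakLq_norm q (area_cone_integral s alpha f))%E) ->
  exists2 K : R, 0 < K & forall z, disk z ->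
    (mu (bergman_disk z t) <= (K * (1 - cabs z) `^ (alpha + 2))%:E)%E.
Proof.
move=> q1 al1 s1 t0 [Ka Ka0 hKa].
pose n := (Num.truncn (alpha + 2)).+1.
have nl : alpha + 2 <= n%:R by apply: ltW; exact: truncnS_gt.
have [Kw Kw0 hKw] := weak_norm_test_function q1 s1 al1 nl.
have [K K0 hK] := bergman_disk_bounded t0.
(* Twice the 5 of [cone_stable], for strictness; the bound 1 lets an arc of length eh fit into the
   period. *)
pose e := Num.min 1 ((s - 1) / (10 * (1 + K))).
have K1 : 0 < 1 + K by lra.
have e0 : 0 < e by rewrite lt_min ltr01 divr_gt0 ?mulr_gt0//; lra.
have e1 : e <= 1 by rewrite ge_min lexx.
have eK : 5 * e * (1 + K) < s - 1.
  have : e <= (s - 1) / (10 * (1 + K)) by rewrite ge_min lexx orbT.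
  rewrite ler_pdivlMr ?mulr_gt0//; lra.
(* The disk lies in a square of side 2Kh, cut into cells of side eh; the number per direction does
   not depend on [a]. *)
pose N := (Num.truncn (2 * K / e)).+1.
pose K3 := Ka * Kw * ((2 + K) ^+ n * (1 + K)) / e `^ q^-1.
have eq0 : 0 < e `^ q^-1 by rewrite powR_gt0.
have K2n : 0 < (2 + K) ^+ n by rewrite exprn_gt0//; lra.
have K30 : 0 < K3 by rewrite /K3 divr_gt0// !mulr_gt0.
exists ((N * N)%:R * K3); first by rewrite mulr_gt0// ltr0n muln_gt0.
move=> a ad; have := ad; rewrite /disk/= => a1.
set h := 1 - cabs a; have h0 : 0 < h by rewrite /h; lra.
have h1 : h <= 1 by rewrite /h; have := cabs_ge0 a; lra.
pose eta := e * h.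
have eta0 : 0 < eta by rewrite mulr_gt0.
have eta1 : 0 < eta <= 1 by rewrite eta0/=; apply: mulr_ile1 => //; exact: ltW.
have mD := measurable_bergman_disk t0 ad.
pose lo (u : R) (i : nat) := u - K * h + i%:R * eta.
(* The index encodes column and row as quotient and remainder of [m] by [N]. *)
pose cell (m : nat) := bergman_disk a t `&`
  ((`[lo a.1 (m %/ N)%N, lo a.1 (m %/ N)%N.+1]%classic : set R) `*`
   (`[lo a.2 (m %% N)%N, lo a.2 (m %% N)%N.+1]%classic : set R)).
have mcell m : measurable (cell m).
  by apply: measurableI => //; apply: measurableX; exact: measurable_itv.
have index (u v : R) : `|v - u| <= K * h ->
    exists2 i : nat, (i < N)%N & lo u i <= v <= lo u i.+1.
  rewrite ler_norml => /andP[v1 v2].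
  pose x := (v - (u - K * h)) / eta.
  have x0 : 0 <= x by apply: divr_ge0; [lra|exact: ltW].
  exists (Num.truncn x).
    rewrite /N ltnS truncn_le_nat; apply: le_lt_trans (truncnS_gt _).
    rewrite /x /eta ler_pdivrMr ?mulr_gt0//.
    have -> : 2 * K / e * (e * h) = 2 * (K * h) by field; rewrite gt_eqF.
    lra.
  have /andP[t1 t2] := truncn_itv x0.
  rewrite /x ler_pdivlMr// in t1; rewrite /x ltr_pdivrMr// in t2.
  by rewrite /lo; apply/andP; split; lra.
have cover : bergman_disk a t `<=` \big[setU/set0]_(m < N * N) cell m.
  move=> w wD; have [wa _] := hK a w ad wD; rewrite -/h in wa.
  have [i iN hi] := index a.1 w.1 (le_trans (normr_fst_cabs (csub w a)) wa).
  have [j jN hj] := index a.2 w.2 (le_trans (normr_snd_cabs (csub w a)) wa).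
  have mN : (i * N + j < N * N)%N.
    apply: (@leq_trans (i * N + N)%N); first by rewrite ltn_add2l.
    by rewrite -mulSnr leq_mul2r iN orbT.
  rewrite (bigD1 (Ordinal mN))//=; left; split => //; split => /=.
    by rewrite in_itv/= divnMDl// (divn_small jN) addn0.
  by rewrite in_itv/= modnMDl modn_small.
have bcell m : (mu (cell m) <= (K3 * h `^ (alpha + 2))%:E)%E.
  have [[z0 [z0D [/=]]]|ne] := pselect (exists z0, cell m z0); last first.
    have -> : cell m = set0 by apply/seteqP; split => // z zc; apply: ne; exists z.
    by rewrite measure0 lee_fin mulr_ge0 ?powR_ge0// ltW.
  rewrite !in_itv/= => /andP[u1 u2] /andP[u3 u4].
  have [z0d _] := z0D.
  have [th0 th002 z0E] := polar_decomposition z0.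
  have [c hc] := arc_in_period th002 eta1.
  pose f := test_function a n.
  have af : analytic_on_disk f by exact: analytic_test_function.
  (* A lower bound for |f(w)|/(1-|w|) on the whole Bergman disk, where the kernel is at most (2+K)h
     and the height at most (1+K)h. *)
  pose c1 := ((2 + K) * h)^-1 ^+ n / ((1 + K) * h).
  have c10 : 0 < c1 by rewrite /c1 divr_gt0 ?mulr_gt0// exprn_gt0// invr_gt0 mulr_gt0//; lra.
  have dist w : cell m w -> cabs (csub w z0) <= 2 * eta.
    move=> [_ [/=]]; rewrite !in_itv/= => /andP[v1 v2] /andP[v3 v4].
    apply: (le_trans (cabs_le_norms _)); rewrite /csub/=.
    have step (u : R) i : lo u i.+1 = lo u i + eta by rewrite /lo -natr1; ring.
    rewrite !step in u2 u4 v2 v4.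
    have n1 : `|w.1 - z0.1| <= eta by rewrite ler_norml; apply/andP; split; lra.
    have n2 : `|w.2 - z0.2| <= eta by rewrite ler_norml; apply/andP; split; lra.
    lra.
  have fl w : cell m w -> c1 <= cabs (f w) / (1 - cabs w).
    move=> [wD _]; have [wd _] := wD; have [wa hw] := hK a w ad wD; rewrite -/h in wa hw.
    have := wd; rewrite /disk/= => w1.
    have D0 := csub_conj_le (ltW a1) (ltW w1).
    have D1 := csub_conj_upper w (ltW a1); rewrite -/h in D0 D1.
    set D := cabs (csub (cone R) _) in D0 D1.
    have D2 : D <= (2 + K) * h by lra.
    have hw2 : 1 - cabs w <= (1 + K) * h.
      by have := cabs_le_csub a w; rewrite csubC /h; rewrite /h in wa; lra.
    have hw0 : 0 < 1 - cabs w by lra.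
    have Dp : 0 < D by lra.
    rewrite /f cabs_test_function /c1 -/D; apply: ler_pM.
    - by rewrite exprn_ge0// invr_ge0 mulr_ge0//; lra.
    - by rewrite invr_ge0 mulr_ge0//; lra.
    - by rewrite lerXn2r ?nnegrE ?invr_ge0 ?mulr_ge0//; try lra; rewrite lef_pV2 ?posrE ?mulr_gt0//; lra.
    - by rewrite lef_pV2 ?posrE ?mulr_gt0.
  pose Nw := Ka * (Kw * h `^ (q^-1 - (n%:R - alpha - 1))).
  have Nw0 : 0 <= Nw by rewrite !mulr_ge0 ?powR_ge0// ltW.
  have hN : (weakLq_norm q (mu_cone_integral mu s f) <= Nw%:E)%E.
    apply: (le_trans (hKa f af)); rewrite /Nw EFinM.
    by rewrite lee_pmul2l ?lte_fin//; exact: hKw.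
  have := @weakLq_lower R q Nw eta c _ (c1%:E * mu (cell m))%E q1 Nw0 eta0 hN.
  move=> /(_ _)low.
  have {}low : (c1%:E * mu (cell m) <= (Nw / eta `^ q^-1)%:E)%E.
    apply: low => th thc; have [] := hc th; first by rewrite /= in_itv.
    move=> th02 thd; split => //; apply: mu_cone_ge => //; first exact: ltW.
    move=> w wc; have [wD _] := wc; have [wd _] := wD; have [wa hw] := hK a w ad wD.
    by apply: (cone_stable e0 K0 eK wd z0E z0d h0 hw (dist w wc) thd).
  rewrite -(@lee_pmul2l _ c1%:E)//.
  apply: (le_trans low); rewrite -EFinM lee_fin le_eqVlt; apply/orP; left; apply/eqP.
  (* The three factors come from the weak norm of the test function, the length of the arc, and
     1/[c1]. *)
  have e3 : h `^ (alpha + 2) = h `^ (q^-1 - (n%:R - alpha - 1)) * (h `^ q^-1)^-1 * (h ^+ n * h).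
    rewrite -(powR_mulrn n (ltW h0)) -{5}(powRr1 (ltW h0)) -powRN.
    rewrite -!powRD ?(gt_eqF h0) ?implybT//; congr (_ `^ _); ring.
  have eE : eta `^ q^-1 = e `^ q^-1 * h `^ q^-1 by rewrite /eta powRM// ltW.
  rewrite e3 eE /Nw /K3 /c1 exprVn exprMn.
  have hq : 0 < h `^ q^-1 by rewrite powR_gt0.
  have hn : 0 < h ^+ n by rewrite exprn_gt0.
  by field; rewrite ?gt_eqF.
have mU : measurable (\big[setU/set0]_(m < N * N) cell m) by apply: bigsetU_measurable.
apply: (@le_trans _ _ (mu (\big[setU/set0]_(m < N * N) cell m))).
  by apply: le_measure; rewrite ?inE.
apply: (le_trans (@Boole_inequality _ _ _ mu cell (N * N) (fun i _ => mcell i))).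
apply: (@le_trans _ _ (\sum_(m < N * N) (K3 * h `^ (alpha + 2))%:E)%E).
  by apply: lee_sum => i _; exact: bcell.
rewrite sumEFin lee_fin sumr_const card_ord -[X in X <= _]mulr_natr.
by rewrite le_eqVlt; apply/orP; left; apply/eqP; ring.
Qed.

End NecessityOfBergman.

(** * Change of aperture in weak Lebesgue spaces *)

Section WeakTypeIntegral.
Context d (T : measurableType d) (R : realType).
Variable mu : {measure set T -> \bar R}.

(* Kolmogorov's inequality: on a set of measure V, the part of A above the level N V^(-1/q)
   is split dyadically. *)
Lemma weak_integral_le (q : R) : 1 < q -> exists2 K : R, 0 < K &
  forall (F : set T) (A : T -> \bar R) (N V : R), measurable F -> measurable_fun F A ->
    (forall x, F x -> (0 <= A x)%E) -> 0 < N -> 0 < V -> (mu F <= V%:E)%E ->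
    (forall lam : R, 0 < lam -> (mu (F `&` [set x | (lam%:E < A x)%E]) <= ((N / lam) `^ q)%:E)%E) ->
    (\int[mu]_(x in F) A x <= (K * (N * V `^ (- q^-1) * V))%:E)%E.
Proof.
move=> q1; have q0 : 0 < q by lra.
(* Doubling the level doubles the value and divides the bound for the measure by 2^q; the ratio
   2^(1-q) is below 1 exactly because q > 1. *)
pose x : R := 2 * 2^-1 `^ q.
have x0 : 0 < x by rewrite mulr_gt0 ?powR_gt0// invr_gt0.
have x1 : x < 1.
  have -> : x = 2^-1 `^ (q - 1).
    have qE : q = q - 1 + 1 by ring.
    have h0 : (0 : R) < 2^-1 by rewrite invr_gt0.
    rewrite /x {1}qE powRD; last by rewrite (gt_eqF h0) implybT.
    by rewrite powRr1 ?ltW//; field.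
  by apply: powR_lt1; [apply/andP; split; lra|lra].
exists (2 / x / (1 - x)); first by rewrite !divr_gt0// subr_gt0.
move=> F A N V mF mA A0 N0 V0 FV hA.
(* The level at which the weak bound (N/tau)^q equals V. *)
pose tau := N * V `^ (- q^-1).
have tau0 : 0 < tau by rewrite mulr_gt0 ?powR_gt0.
have NtauE : (N / tau) `^ q = V.
  have -> : N / tau = V `^ q^-1.
    by rewrite /tau powRN; field; rewrite !gt_eqF ?powR_gt0.
  by rewrite -powRrM mulVf ?gt_eqF// powRr1// ltW.
have mlt (lam : R) : measurable (F `&` [set y | (lam%:E < A y)%E]).
  exact: emeasurable_fun_o_infty.
(* No dyadic layer contains these points; the weak bound at arbitrarily high levels makes them
   negligible. *)
pose Z := F `&` [set y | A y = +oo%E].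
have mZ : measurable Z.
  have -> : Z = F `&` A @^-1` [set +oo%E] by [].
  by apply: mA => //; exact: emeasurable_set1.
have Z0 : mu Z = 0%E.
  apply/eqP; rewrite eq_le measure_ge0 andbT; apply/lee_addgt0Pr => e e0; rewrite add0e.
  pose lam := N / e `^ q^-1.
  have eq0 : 0 < e `^ q^-1 by rewrite powR_gt0.
  have lam0 : 0 < lam by rewrite divr_gt0.
  apply: (@le_trans _ _ (mu (F `&` [set y | (lam%:E < A y)%E]))).
    by apply: le_measure; rewrite ?inE// => y [Fy /= ->]; split => //=; rewrite ltry.
  apply: (le_trans (hA lam lam0)); rewrite lee_fin le_eqVlt; apply/orP; left; apply/eqP.
  have -> : N / lam = e `^ q^-1 by rewrite /lam; field; rewrite !gt_eqF.
  by rewrite -powRrM mulVf ?gt_eqF// powRr1// ltW.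
rewrite (ge0_negligible_integral mZ mF mA A0 Z0).
(* Layer 0 is everything up to [tau]; layer k+1 is where A lies in ]2^k tau, 2^(k+1) tau]. *)
pose B k := if k is k'.+1 then F `&` [set y | ((2 ^+ k' * tau)%:E < A y)%E] `&`
   (F `&` A @^-1` `]-oo, (2 ^+ k'.+1 * tau)%:E]) else F `&` A @^-1` `]-oo, tau%:E].
have mle (lam : R) : measurable (F `&` A @^-1` `]-oo, lam%:E]).
  by apply: mA => //; exact: emeasurable_itv.
pose g k := 2 ^+ k * tau.
have g0 k : 0 <= g k by rewrite mulr_ge0 ?exprn_ge0// ltW.
have mFZ : measurable (F `\` Z) by exact: measurableD.
apply: (le_trans (@integral_le_cover _ _ _ mu _ A B g _ _ _ _ _ _ _)) => //.
- by apply: measurable_funS mA => //; exact: subDsetl.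
- by move=> y [/A0].
- by case=> [|k]; rewrite /B; [exact: mle|apply: measurableI].
- move=> y [Fy nZ].
  have Af : A y != +oo%E by apply/eqP => AE; apply: nZ; split.
  have := A0 y Fy; case E : (A y) Af => [a| |]// _ a0; rewrite lee_fin in a0.
  have [at_|ta] := leP a tau.
    by exists 0%N => //; split => //=; rewrite in_itv/= E lee_fin.
  have [||k /andP[k1 k2]] := @geometric_layer R 2^-1 a tau.
  + by apply/andP; split; lra.
  + by rewrite tau0/= ltW.
  have k0 : 0 < (2 : R) ^+ k by rewrite exprn_gt0.
  rewrite exprVn in k2; rewrite exprS exprVn in k1.
  have k1' : a < 2 * 2 ^+ k * tau.
    rewrite -(@ltr_pM2l _ (2 * 2 ^+ k)) ?mulr_gt0// in k1.
    by have -> : a = 2 * 2 ^+ k * (2^-1 / 2 ^+ k * a) by field; rewrite gt_eqF.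
  have k2' : 2 ^+ k * tau <= a by move: k2; rewrite mulrC ler_pdivlMr// mulrC.
  (* [geometric_layer] includes the lower end, while the layers [B] exclude it: a value equal to 2^k
     tau belongs one layer lower. *)
  move: k2'; rewrite le_eqVlt => /orP[/eqP k2'|k2']; last first.
    exists k.+1 => //; split; split => //=; first by rewrite E lte_fin.
    by rewrite in_itv/= E lee_fin exprS ltW.
  case: k k0 k1 k2 k1' k2' => [|k] k0 k1 k2 k1' k2'.
    by exists 0%N => //; split => //=; rewrite in_itv/= E lee_fin -k2' expr0 mul1r.
  exists k.+1 => //; split; split => //=; last by rewrite in_itv/= E lee_fin k2'.
  have p0 : 0 < 2 ^+ k * tau by rewrite mulr_gt0// exprn_gt0.
  by rewrite E lte_fin -k2' exprS -mulrA; lra.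
- by case=> [|k] y _; rewrite /B /g; [case|case => _ []] => _; rewrite /= in_itv/= ?expr0 ?mul1r.
have W0 : 0 < tau * V by rewrite mulr_gt0.
apply: (@le_trans _ _ (\sum_(0 <= k <oo) (2 / x * (tau * V) * x ^+ k)%:E)%E); last first.
  apply: (le_trans (nneseries_geometric_le _ _)).
  - by rewrite mulr_ge0 ?divr_ge0// ltW.
  - by rewrite ltW.
  - by rewrite lee_fin le_eqVlt; apply/orP; left; apply/eqP; rewrite -/tau; ring.
apply: lee_nneseries => [k _ _|k _]; first by rewrite mule_ge0// lee_fin.
case: k => [|k].
  apply: (@le_trans _ _ (tau%:E * V%:E)%E).
    rewrite /g expr0 mul1r lee_pmul2l ?lte_fin//.
    by apply: le_trans FV; apply: le_measure; rewrite ?inE//; [exact: mle|move=> y []].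
  rewrite -EFinM lee_fin expr0 mulr1 ler_pMl// ler_pdivlMr// mul1r; lra.
apply: (@le_trans _ _ ((g k.+1)%:E * (V * (2^-1 `^ q) ^+ k)%:E)%E).
  have gk : 0 < g k.+1 by apply: mulr_gt0 => //; exact: exprn_gt0.
  rewrite lee_pmul2l ?lte_fin//.
  have l0 : 0 < 2 ^+ k * tau by rewrite mulr_gt0 ?exprn_gt0.
  apply: (@le_trans _ _ ((N / (2 ^+ k * tau)) `^ q)%:E).
    apply: le_trans (hA _ l0).
    by apply: le_measure; rewrite ?inE//; [apply: measurableI|move=> y []].
  rewrite lee_fin le_eqVlt; apply/orP; left; apply/eqP.
  have -> : N / (2 ^+ k * tau) = N / tau * 2^-1 ^+ k.
    by rewrite exprVn; field; rewrite !gt_eqF ?exprn_gt0.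
  have e0 : 0 <= N / tau by rewrite divr_ge0// ltW.
  by rewrite powRM ?exprn_ge0// NtauE powR_exprn.
rewrite -EFinM lee_fin le_eqVlt; apply/orP; left; apply/eqP.
rewrite /g (exprS x) (exprS 2) {3}/x exprMn.
by field; rewrite gt_eqF.
Qed.

End WeakTypeIntegral.

(** * The Hardy-Littlewood maximal function of an indicator *)

Section MaximalFunction.
Variable R : realType.
Notation leb := (@lebesgue_measure R).

(** The pushforward by a translation agrees with Lebesgue measure on half-open intervals, so
    uniqueness applies. *)
Lemma lebesgue_measure_translation (c : R) (A : set R) : measurable A ->
  leb [set x | A (x + c)] = leb A.
Proof.
move=> mA.
have mf : measurable_fun [set: measurableTypeR R] (fun x : measurableTypeR R => x + c : measurableTypeR R).
  by apply: measurable_funD.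
pose nu := pushforward leb (fun x : measurableTypeR R => x + c : measurableTypeR R).
suff: leb A = nu A by [].
pose nu' : {measure set (measurableTypeR R) -> \bar R} :=
  measure_function_pushforward__canonical__measure_function_Measure leb mf.
apply: (@lebesgue_measure_unique _ nu') => // X [[a b] /= _ <-].
have -> : nu' `]a, b]%classic = leb `](a - c), (b - c)]%classic.
  congr (leb _); apply/seteqP; split => x /=; rewrite !in_itv/= => /andP[h1 h2]; apply/andP; split; lra.
rewrite !lebesgue_measure_itv/= !lte_fin ltrD2r.
by case: ifP => // _; rewrite -!EFinB; congr EFin; ring.
Qed.

Lemma integral_norm_indic (D E : set R) : measurable D -> measurable E ->
  (\int[leb]_(y in D) `|(\1_E y)%:E| = leb (E `&` D))%E.
Proof.
move=> mD mE; rewrite -integral_indic//.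
by apply: eq_integral => y _; rewrite gee0_abs.
Qed.

Lemma locally_integrable_indic (E : set R) : measurable E -> (leb E < +oo)%E ->
  locally_integrable setT (\1_E : R -> R).
Proof.
move=> mE Efin; split; [exact: measurable_indic|exact: openT|move=> K _ cK].
have mK : measurable K by exact: compact_measurable.
have -> : (\int[leb]_(x in K) `|\1_E x|%:E = leb (E `&` K))%E by exact: integral_norm_indic.
apply: le_lt_trans Efin; exact: lebesgue_measure_mono.
Qed.

Lemma maximal_indic_ge (E : set R) (x r t : R) : measurable E -> 0 < r ->
  ((t * (r *+ 2))%:E < leb (E `&` ball x r))%E -> (t%:E < HL_maximal (\1_E) x)%E.
Proof.
move=> mE r0 ht.
apply: (@lt_le_trans _ _ (iavg (\1_E) (ball x r))); last first.
  by apply: ereal_sup_ubound; exists r => //=; rewrite in_itv/= r0.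
rewrite /iavg lebesgue_measure_ball ?ltW// inver gt_eqF ?mulrn_wgt0//.
rewrite integral_norm_indic//; last exact: measurable_ball.
have rr : 0 < r *+ 2 by rewrite mulrn_wgt0.
have -> : t%:E = (((r *+ 2)^-1)%:E * (t * (r *+ 2))%:E)%E.
  by rewrite -EFinM; congr EFin; field; rewrite gt_eqF.
by rewrite lte_pmul2l// lte_fin invr_gt0.
Qed.

Lemma maximal_indic_le (E : set R) (t : R) : measurable E -> (leb E < +oo)%E -> 0 < t ->
  (leb [set x | (t%:E < HL_maximal (\1_E) x)%E] <= (3 / t)%:E * leb E)%E.
Proof.
move=> mE Efin t0; apply: (le_trans (maximal_inequality (locally_integrable_indic mE Efin) t0)).
by rewrite integral_norm_indic// setIT.
Qed.

Lemma measurable_maximal_indic (E : set R) (t : R) : measurable E -> (leb E < +oo)%E ->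
  measurable [set x | (t%:E < HL_maximal (\1_E) x)%E].
Proof.
move=> mE Efin; rewrite -[X in measurable X]setTI.
apply: emeasurable_fun_o_infty => //; exact: measurable_HL_maximal (locally_integrable_indic mE Efin).
Qed.

End MaximalFunction.

(** * Cone integrals, viewing arcs and Tonelli's theorem *)

Section ConeAverages.
Variable R : realType.
Notation C := (R * R)%type.
Notation leb := (@lebesgue_measure R).
Notation RT := (measurableTypeR R).
Implicit Types (z w xi : C) (s : R) (E : set R).

Definition period : set R := [set th | 0 <= th < 2 * pi].

Lemma measurable_period : measurable period.
Proof.
have -> : period = `[0, 2 * pi[%classic by apply/seteqP; split => th /=; rewrite in_itv.
exact: measurable_itv.
Qed.

Lemma lebesgue_measure_period_le E : E `<=` period -> (leb E <= (2 * pi)%:E)%E.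
Proof.
move=> EP; have pi0 := pi_gt0 R.
apply: (@le_trans _ _ (leb `[0, 2 * pi]%classic)).
  apply: lebesgue_measure_mono => th /EP/andP[h1 h2] /=.
  by rewrite in_itv/= h1/= ltW.
by rewrite lebesgue_measure_segment ?subr0// mulr_ge0// ltW.
Qed.

(** Its sections at fixed angle are cones and at fixed point viewing arcs, so its measurability
    gives both, jointly, for Tonelli. *)
Definition cone_graph s E : set (RT * (RT * RT)) :=
  [set p | E p.1 /\ lusin_cone s (cexpi p.1) p.2].

Lemma measurable_cone_graph s E : measurable E -> measurable (cone_graph s E).
Proof.
move=> mE.
have m1 : measurable_fun [set: RT * (RT * RT)] (fun p => p.1 : R) by exact: measurable_fst.
have m2 : measurable_fun [set: RT * (RT * RT)] (fun p => p.2 : C) by exact: measurable_snd.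
have m21 : measurable_fun [set: RT * (RT * RT)] (fun p => p.2.1 : R).
  exact: (measurableT_comp (@measurable_plane_fst R) m2).
have m22 : measurable_fun [set: RT * (RT * RT)] (fun p => p.2.2 : R).
  exact: (measurableT_comp (@measurable_plane_snd R) m2).
have mc : measurable_fun [set: RT * (RT * RT)] (fun p => cos (p.1 : R) : R).
  exact: (measurableT_comp (@measurable_cos_fun R) m1).
have ms : measurable_fun [set: RT * (RT * RT)] (fun p => sin (p.1 : R) : R).
  exact: (measurableT_comp (@measurable_sin_fun R) m1).
have ma : measurable_fun [set: RT * (RT * RT)] (fun p => cabs (p.2 : C)).
  exact: (measurableT_comp (@measurable_cabs R) m2).
have -> : cone_graph s E = (E `*` setT) `&` ([set p | cabs (p.2 : C) < 1] `&`
   [set p | cabs (csub (cone R) (cmul (cconj (cexpi (p.1 : R))) (p.2 : C))) < s * (1 - cabs (p.2 : C))]).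
  by apply/seteqP; split => [p [h1 [h2 h3]]|p [[h1 _] [h2 h3]]].
apply: measurableI; first exact: measurableX.
apply: measurableI; first exact: measurable_set_lt.
apply: measurable_set_lt; last by apply: measurable_funM => //; apply: measurable_funB.
apply: measurable_cabs_pair; rewrite /=; apply: measurable_funB => //.
  by apply: measurable_funB; apply: measurable_funM => //; exact: measurableT_comp.
by apply: measurable_funD; apply: measurable_funM => //; exact: measurableT_comp.
Qed.

Definition viewing_arc s z : set R := [set th | period th /\ lusin_cone s (cexpi th) z].

Lemma ysection_cone_graph s E z : E `<=` period ->
  ysection (cone_graph s E) z = E `&` viewing_arc s z.
Proof.
move=> EP; apply/seteqP; split => th; rewrite /ysection/= inE.
  by move=> [/= Eth zc]; split => //; split => //; exact: EP.
by move=> [Eth [_ zc]].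
Qed.

Lemma measurable_arc_measure s E : measurable E -> E `<=` period ->
  measurable_fun [set: RT * RT] (fun z => leb (E `&` viewing_arc s z)).
Proof.
move=> mE EP; have := measurable_fun_ysection leb (measurable_cone_graph s mE).
by congr measurable_fun; apply/funext => z /=; rewrite ysection_cone_graph.
Qed.

Variable F : C -> R.
Hypotheses (F0 : forall z, disk z -> 0 <= F z) (mF : measurable_fun (@disk R) (fun z => (F z)%:E)).

Definition cone_average s (th : R) : \bar R :=
  (\int[@area R]_(z in lusin_cone s (cexpi th)) (F z)%:E)%E.

Let FD := (fun z => (F z)%:E) \_ (@disk R).

Let FD0 z : (0 <= FD z)%E.
Proof. by rewrite /FD patchE; case: ifPn => // /set_mem zd; rewrite lee_fin F0. Qed.

Let mFD : measurable_fun [set: RT * RT] FD.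
Proof. by apply/(measurable_restrictT _ (@measurable_disk R)). Qed.

Let H s E (p : RT * (RT * RT)) : \bar R := ((\1_(cone_graph s E) p)%:E * FD p.2)%E.

Let H0 s E p : (0 <= H s E p)%E.
Proof. by rewrite /H mule_ge0// lee_fin. Qed.

Let mH s E : measurable E -> measurable_fun [set: RT * (RT * RT)] (H s E).
Proof.
move=> mE; apply: emeasurable_funM.
  by apply/measurable_EFinP; apply: measurable_indic; exact: measurable_cone_graph.
exact: (measurableT_comp mFD (@measurable_snd _ _ _ _)).
Qed.

Let H_slice s E th : (\int[@area R]_z H s E (th, z) = (cone_average s \_ E) th)%E.
Proof.
rewrite patchE; case: ifPn => [/set_mem Eth|/negP nE]; last first.
  rewrite integral0_eq// => z _; rewrite /H indicE.
  rewrite memNset ?mul0e// => -[/= Eth]; exfalso; apply: nE; exact/mem_set.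
rewrite /cone_average [RHS]integral_mkcond; apply: eq_integral => z _.
rewrite /H indicE /FD !patchE.
have [zc|zc] := pselect (lusin_cone s (cexpi th) z).
  have [zd _] := zc; have zd' : disk z by [].
  by rewrite (mem_set zc) (mem_set zd') mem_set ?mul1e.
by rewrite (memNset zc) memNset ?mul0e// => -[].
Qed.

Lemma measurable_cone_average s : measurable_fun period (cone_average s).
Proof.
apply/(measurable_restrictT _ measurable_period).
have := @measurable_fun_fubini_tonelli_F _ _ RT (RT * RT)%type R (@area R) (H s period)
  (mH s measurable_period) (H0 s period).
congr measurable_fun; apply/funext => th; exact: H_slice.
Qed.

Lemma cone_average_ge0 s th : (0 <= cone_average s th)%E.
Proof. by apply: integral_ge0 => z [zd _]; rewrite lee_fin F0. Qed.

(** Tonelli on [cone_graph]: the aperture then appears only in the length of an arc, so that two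
    apertures can be compared point by point in z. *)
Lemma integral_cone_average s E : measurable E -> E `<=` period ->
  (\int[leb]_(th in E) cone_average s th =
   \int[@area R]_(z in @disk R) ((F z)%:E * leb (E `&` viewing_arc s z)))%E.
Proof.
move=> mE EP; rewrite integral_mkcond.
transitivity (\int[leb]_th \int[@area R]_z H s E (th, z))%E.
  by apply: eq_integral => th _; rewrite H_slice.
rewrite (@fubini_tonelli _ _ RT (RT * RT)%type R leb (@area R) _ (mH s mE) (H0 s E)).
rewrite [RHS]integral_mkcond; apply: eq_integral => z _; rewrite patchE.
case: ifPn => [/set_mem zd|/negP nd]; last first.
  rewrite integral0_eq// => th _; rewrite /H /FD patchE memNset ?mule0// => zd.
  by apply: nd; exact/mem_set.
rewrite (eq_integral (fun th => (F z)%:E * (\1_(ysection (cone_graph s E) z) th)%:E)%E); last first.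
  move=> th _; rewrite /H /FD patchE mem_set// muleC; congr (_ * _%:E)%E.
  by rewrite !indicE mem_ysection.
have mY : measurable (ysection (cone_graph s E) z).
  by apply: measurable_ysection; exact: measurable_cone_graph.
rewrite ge0_integralZl_EFin//; last 2 first.
- by apply/measurable_EFinP; exact: measurable_indic.
- exact: F0.
by rewrite integral_indic// setIT ysection_cone_graph.
Qed.

End ConeAverages.

Section Aperture.
Variable R : realType.
Notation C := (R * R)%type.
Notation leb := (@lebesgue_measure R).
Notation RT := (measurableTypeR R).
Implicit Types (z w xi : C) (s : R) (E : set R).

Lemma viewing_arc_le s z : disk z -> 0 < s ->
  (leb (viewing_arc s z) <= (48 * (s * (1 - cabs z)))%:E)%E.
Proof.
rewrite /disk/= => zd s0.
have h0 : 0 <= s * (1 - cabs z) by rewrite mulr_ge0 ?ltW// subr_gt0.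
apply: le_trans (circle_measure_arc z h0); apply: lebesgue_measure_mono.
move=> th [thP [_ hz]]; split => //; rewrite /cball/=.
by move: hz; rewrite cdist_unit ?cabs_expi// => /ltW.
Qed.

(** With h = 1-|z|, boundary points at angle at most ch from that of z are within (1+c)h < sh of z.
    The minimum with 1 keeps the interval short enough for [arc_in_period]. *)
Lemma viewing_arc_ge s z : disk z -> 1 < s ->
  ((Num.min 1 ((s - 1) / 2) * (1 - cabs z))%:E <= leb (viewing_arc s z))%E.
Proof.
move=> zd s1; have := zd; rewrite /disk/= => z1; have z0 := cabs_ge0 z.
set c := Num.min _ _; have c0 : 0 < c by rewrite lt_min ltr01 divr_gt0//; lra.
have c1 : c <= 1 by rewrite ge_min lexx.
have cs : c <= (s - 1) / 2 by rewrite ge_min lexx orbT.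
have h0 : 0 < 1 - cabs z by lra.
have ch0 : 0 < c * (1 - cabs z) by rewrite mulr_gt0.
have ch1 : 0 < c * (1 - cabs z) <= 1.
  by rewrite ch0/=; apply: mulr_ile1 => //; [exact: ltW|exact: ltW|lra].
have [phi p02 zE] := polar_decomposition z.
have [b hb] := arc_in_period p02 ch1.
apply: (@le_trans _ _ (leb `[b, b + c * (1 - cabs z)]%classic)).
  by rewrite lebesgue_measure_segment; [rewrite lee_fin; lra|lra].
apply: lebesgue_measure_mono => th /hb[thP thd]; split => //; split => //.
rewrite cdist_unit ?cabs_expi//.
have t1 := csub_triangle (cexpi th) (cexpi phi) z.
have t2 := cdist_expi_le th phi.
have t4 : cabs (csub (cexpi phi) z) = 1 - cabs z.
  have -> : csub (cexpi phi) z = cmul (1 - cabs z, 0) (cexpi phi).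
    by rewrite {1}zE /csub /cmul /cexpi/=; congr pair; ring.
  rewrite cabsM cabs_expi mulr1 {1}/cabs/= expr0n addr0 sqrtr_sqr ger0_norm//; lra.
have t5 : c * (1 - cabs z) <= (s - 1) / 2 * (1 - cabs z) by rewrite ler_pM2r.
have t6 : 0 < (s - 1) * (1 - cabs z) by rewrite mulr_gt0//; lra.
lra.
Qed.

Definition maximal_level E (k : nat) (c : R) : set R :=
  [set th | ((2^-1 ^+ k.+1)%:E < HL_maximal (\1_E) (th + c))%E].

(* The maximal function on the circle is read off the line through the three translates. *)

Definition circle_level E (k : nat) : set R :=
  @period R `&` (maximal_level E k 0 `|` maximal_level E k (2 * pi) `|`
    maximal_level E k (- (2 * pi))).

Lemma measurable_maximal_level E k c : measurable E -> (leb E < +oo)%E ->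
  measurable (maximal_level E k c).
Proof.
move=> mE Efin.
have mf : measurable_fun [set: RT] (fun x : RT => x + c : RT) by apply: measurable_funD.
have := mf measurableT _ (measurable_maximal_indic (2^-1 ^+ k.+1) mE Efin).
by rewrite setTI.
Qed.

Lemma measurable_circle_level E k : measurable E -> (leb E < +oo)%E ->
  measurable (circle_level E k).
Proof.
move=> mE Efin; have m c := measurable_maximal_level k c mE Efin.
apply: measurableI; first exact: measurable_period.
by apply: measurableU => //; apply: measurableU.
Qed.

Lemma maximal_level_le E k c (v : R) : measurable E -> leb E = v%:E ->
  (leb (maximal_level E k c) <= (6 * 2 ^+ k * v)%:E)%E.
Proof.
move=> mE Ev; have Efin : (leb E < +oo)%E by rewrite Ev ltry.
have t0 : (0 : R) < 2^-1 ^+ k.+1 by rewrite exprn_gt0// invr_gt0.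
rewrite (lebesgue_measure_translation c (measurable_maximal_indic (2^-1 ^+ k.+1) mE Efin)).
apply: (le_trans (maximal_indic_le mE Efin t0)).
rewrite Ev -EFinM lee_fin exprVn invrK exprS le_eqVlt; apply/orP; left; apply/eqP; ring.
Qed.

Lemma circle_level_le E k (v : R) : measurable E -> leb E = v%:E ->
  (leb (circle_level E k) <= (18 * 2 ^+ k * v)%:E)%E.
Proof.
move=> mE Ev; have Efin : (leb E < +oo)%E by rewrite Ev ltry.
have m c := measurable_maximal_level k c mE Efin.
have b c := maximal_level_le k c mE Ev.
have m2 := measurableU _ _ (m 0) (m (2 * pi)).
apply: (@le_trans _ _ (leb (maximal_level E k 0 `|` maximal_level E k (2 * pi) `|`
    maximal_level E k (- (2 * pi))))).
  by apply: lebesgue_measure_mono => x [].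
apply: (le_trans (measureU2 leb m2 (m _))).
apply: (le_trans (leeD (le_trans (measureU2 leb (m _) (m _)) (leeD (b _) (b _))) (b _))).
by rewrite -!EFinD lee_fin le_eqVlt; apply/orP; left; apply/eqP; ring.
Qed.

(** Seen from any point of the narrow arc, the wide arc lies in an interval of comparable length.
    The density of [E] in the wide arc therefore bounds the maximal function below on all of the
    narrow arc, and k records its dyadic size. *)
Lemma viewing_arc_level s s' : 1 < s -> s <= s' -> exists2 K : R, 0 < K &
  forall E z, measurable E -> E `<=` @period R -> disk z ->
  exists k : nat, (leb (E `&` viewing_arc s' z) <=
    (K * 2^-1 ^+ k)%:E * leb (circle_level E k `&` viewing_arc s z))%E.
Proof.
move=> s1 ss'; set c := Num.min 1 ((s - 1) / 2).
have c0 : 0 < c by rewrite lt_min ltr01 divr_gt0//; lra.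
have s'0 : 0 < s' by lra.
exists (54 * s' / c); first by rewrite divr_gt0// mulr_gt0.
move=> E z mE EP zd; have := zd; rewrite /disk/= => z1.
set h := 1 - cabs z; have h0 : 0 < h by rewrite /h; lra.
have Efin : (leb E < +oo)%E.
  by apply: le_lt_trans (lebesgue_measure_period_le EP) _; rewrite ltry.
have mub : (leb (E `&` viewing_arc s' z) <= (48 * (s' * h))%:E)%E.
  apply: le_trans (viewing_arc_le zd s'0); exact: lebesgue_measure_mono.
have mge : (0 <= leb (E `&` viewing_arc s' z))%E by exact: measure_ge0.
case mE' : (leb (E `&` viewing_arc s' z)) mub mge => [m| |]//.
rewrite !lee_fin => mub m0.
have sh0 : 0 < s' * h by rewrite mulr_gt0.
move: m0; rewrite le_eqVlt => /orP[/eqP <-|m0].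
  exists 0%N; rewrite mule_ge0// lee_fin mulr_ge0 ?exprn_ge0 ?invr_ge0//.
  by rewrite divr_ge0 ?mulr_ge0 ?ltW.
(* 54 is 3 balls times their length 18 in units of s'h; since m is at most 48 s'h, the density is
   below 1 and [geometric_layer] applies. *)
pose r := m / (54 * (s' * h)).
have sh54 : 0 < 54 * (s' * h) by rewrite mulr_gt0.
have [||k /andP[k1 k2]] := @geometric_layer R 2^-1 1 r.
- by apply/andP; split; lra.
- by rewrite divr_gt0//= ler_pdivrMr//; lra.
rewrite mulr1 in k1; rewrite mulr1 in k2.
exists k.
set t := 2^-1 ^+ k.+1 in k1.
have t0 : 0 < t by rewrite exprn_gt0// invr_gt0.
(* Chords between the two arcs are at most 2s'h, hence angles at most 8s'h; 9 makes the open balls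
   contain them. *)
pose rho := 9 * (s' * h).
have rho0 : 0 < rho by rewrite mulr_gt0.
(* If all three translated averages at th were at most t = 2^(-k-1), then m would be at most 54 s'h
   t, contrary to the choice of k. *)
have sub : viewing_arc s z `<=` circle_level E k.
  move=> th [thP [_ hth]]; split => //; apply: contrapT => nth_.
  have small a : ~ maximal_level E k a th -> (leb (E `&` ball (th + a)%R rho) <= (t * (rho *+ 2))%:E)%E.
    move=> na; rewrite leNgt; apply/negP => hlt; apply: na.
    exact: (@maximal_indic_ge _ E (th + a) rho t mE rho0 hlt).
  have n0 : ~ maximal_level E k 0 th by move=> n; apply: nth_; left; left.
  have n1 : ~ maximal_level E k (2 * pi) th by move=> n; apply: nth_; left; right.
  have n2 : ~ maximal_level E k (- (2 * pi)) th by move=> n; apply: nth_; right.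
  have mB a : measurable (E `&` ball (th + a) rho).
    by apply: measurableI => //; exact: measurable_ball.
  have cov : E `&` viewing_arc s' z `<=` (E `&` ball (th + 0) rho) `|`
     (E `&` ball (th + 2 * pi) rho) `|` (E `&` ball (th + - (2 * pi)) rho).
    move=> th' [Eth' [th'P [_ hth']]].
    rewrite cdist_unit ?cabs_expi// -/h in hth; rewrite cdist_unit ?cabs_expi// -/h in hth'.
    have dd : cabs (csub (cexpi th') (cexpi th)) <= 2 * (s' * h).
      have := csub_triangle (cexpi th') z (cexpi th); rewrite (csubC z).
      have : s * h <= s' * h by rewrite ler_pM2r.
      lra.
    have mkB a u : `|th' - th - u| <= 4 * (2 * (s' * h)) -> a = u -> ball (th + a) rho th'.
      move=> hu ->; rewrite /ball/= distrC.
      have -> : th' - (th + u) = th' - th - u by ring.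
      by rewrite /rho; lra.
    have [u|u|u] := arc_le_chord th'P thP dd.
    - by left; left; split => //; apply: (mkB 0 0); rewrite ?subr0.
    - by left; right; split => //; exact: (mkB _ (2 * pi)).
    - by right; split => //; apply: (mkB _ (- (2 * pi))) => //; rewrite opprK.
  have : (m%:E <= (3 * (t * (rho *+ 2)))%:E)%E.
    rewrite -mE'; apply: (le_trans (lebesgue_measure_mono cov)).
    apply: (le_trans (measureU2 leb (measurableU _ _ (mB 0) (mB (2 * pi))) (mB _))).
    apply: (le_trans (leeD (le_trans (measureU2 leb (mB _) (mB _))
      (leeD (small _ n0) (small _ n1))) (small _ n2))).
    by rewrite -!EFinD lee_fin; lra.
  rewrite lee_fin leNgt => /negP; apply.
  have -> : 3 * (t * (rho *+ 2)) = t * (54 * (s' * h)) by rewrite /rho; ring.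
  by rewrite -ltr_pdivlMr.
rewrite (_ : circle_level E k `&` viewing_arc s z = viewing_arc s z); last exact/setIidPr.
have p0 : 0 < 54 * s' / c * 2^-1 ^+ k.
  by rewrite mulr_gt0 ?exprn_gt0 ?invr_gt0// divr_gt0// mulr_gt0.
apply: (@le_trans _ _ ((54 * s' / c * 2^-1 ^+ k)%:E * (c * h)%:E)%E); last first.
  by rewrite lee_pmul2l// viewing_arc_ge.
rewrite -EFinM lee_fin.
have -> : 54 * s' / c * 2^-1 ^+ k * (c * h) = 2^-1 ^+ k * (54 * (s' * h)).
  by field; rewrite gt_eqF.
by rewrite -ler_pdivrMr.
Qed.

Lemma cone_average_aperture (q s s' : R) : 1 < q -> 1 < s -> s <= s' ->
  exists2 K : R, 0 < K & forall (F : C -> R) (N : R), (forall z, disk z -> 0 <= F z) ->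
    measurable_fun (@disk R) (fun z => (F z)%:E) -> 0 < N ->
    (forall lam : R, 0 < lam ->
      (leb (@period R `&` [set th | (lam%:E < cone_average F s th)%E]) <= ((N / lam) `^ q)%:E)%E) ->
    forall lam : R, 0 < lam ->
      (lam%:E * leb (@period R `&` [set th | (lam%:E < cone_average F s' th)%E]) `^ q^-1 <=
        (K * N)%:E)%E.
Proof.
move=> q1 s1 ss'; have [K1 K10 hK1] := viewing_arc_level s1 ss'.
have [K2 K20 hK2] := @weak_integral_le _ RT R leb q q1.
have q0 : 0 < q by lra.
have qi0 : 0 < q^-1 by rewrite invr_gt0.
have h0 : (0 : R) < 2^-1 by rewrite invr_gt0.
pose y : R := 2^-1 `^ q^-1.
have y0 : 0 <= y by exact: powR_ge0.
have y1 : y < 1 by apply: powR_lt1 => //; apply/andP; split; lra.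
pose K := K1 * K2 * 18 * 18 `^ (- q^-1) / (1 - y).
have K0 : 0 < K by rewrite /K divr_gt0 ?subr_gt0// !mulr_gt0// powR_gt0.
exists K => // F N F0 mF N0 hN lam lam0.
have mA s0 := measurable_cone_average F0 mF s0.
set E := @period R `&` _.
have mE : measurable E by apply: emeasurable_fun_o_infty; [exact: measurable_period|exact: mA].
have EP : E `<=` @period R by move=> th [].
have Ele := lebesgue_measure_period_le EP.
have Ege : (0 <= leb E)%E by exact: measure_ge0.
case Ev : (leb E) Ele Ege => [v| |]// _; rewrite lee_fin => v0.
have Efin : (leb E < +oo)%E by rewrite Ev ltry.
move: v0; rewrite le_eqVlt => /orP[/eqP <-|v0].
  by rewrite poweR0r ?gt_eqF// mule0 lee_fin ltW// mulr_gt0.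
have mL k := measurable_circle_level k mE Efin.
have LP k : circle_level E k `<=` @period R by move=> th [].
have LA k : (\int[leb]_(th in circle_level E k) cone_average F s th <=
    (K2 * (N * (18 * 2 ^+ k * v) `^ (- q^-1) * (18 * 2 ^+ k * v)))%:E)%E.
  apply: hK2 => //.
  - exact: mL.
  - exact: (measurable_funS (@measurable_period R) (LP k) (mA s)).
  - by move=> th _; exact: cone_average_ge0.
  - by rewrite !mulr_gt0// exprn_gt0.
  - exact: circle_level_le.
  move=> l l0; apply: le_trans (hN l l0); apply: lebesgue_measure_mono.
  by move=> th [[? _] ?].
have mterm s0 E0 : measurable E0 -> E0 `<=` @period R ->
    measurable_fun (@disk R) (fun z => ((F z)%:E * leb (E0 `&` viewing_arc s0 z))%E).
  move=> mE0 E0P; apply: emeasurable_funM => //.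
  by apply: measurable_funTS; exact: measurable_arc_measure.
have term0 s0 E0 z : disk z -> (0 <= (F z)%:E * leb (E0 `&` viewing_arc s0 z))%E.
  by move=> zd; rewrite mule_ge0// lee_fin F0.
pose cc k := K1 * 2^-1 ^+ k.
have cc0 k : 0 <= cc k by rewrite mulr_ge0 ?exprn_ge0 ?ltW.
have main : ((lam * v)%:E <= (K * N * (v `^ (- q^-1) * v))%:E)%E.
  apply: (@le_trans _ _ (\int[leb]_(th in E) cone_average F s' th)%E).
    rewrite EFinM -Ev -integral_cst//; apply: ge0_le_integral => //.
    - by move=> th _; rewrite lee_fin ltW.
    - exact: (measurable_funS (@measurable_period R) EP (mA s')).
    - by move=> th [_ /= /ltW].
  rewrite integral_cone_average//.
  apply: (@le_trans _ _ (\int[@area R]_(z in @disk R) \sum_(0 <= k <oo)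
     ((cc k)%:E * ((F z)%:E * leb (circle_level E k `&` viewing_arc s z))))%E).
    apply: ge0_le_integral => //.
    - exact: measurable_disk.
    - by move=> z zd; exact: term0.
    - exact: mterm.
    - apply: ge0_emeasurable_sum => [k z zd _|k _].
        by rewrite mule_ge0 ?lee_fin//; exact: term0.
      by apply: measurable_funeM; exact: mterm.
    (* The level k depends on z; bounding one term by the sum over all levels avoids a measurable
       selection. *)
    move=> z zd; have [k hk] := hK1 E z mE EP zd.
    apply: (@le_trans _ _ ((cc k)%:E * ((F z)%:E * leb (circle_level E k `&` viewing_arc s z)))%E).
      rewrite muleCA lee_wpmul2l ?lee_fin//; exact: F0.
    have tge i : (0 <= (cc i)%:E * ((F z)%:E * leb (circle_level E i `&` viewing_arc s z)))%E.
      by rewrite mule_ge0 ?lee_fin//; exact: term0.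
    apply: le_trans (nneseries_lim_ge k.+1 _); last by move=> *; exact: tge.
    by rewrite big_nat_recr//= leeDr//; apply: sume_ge0 => *; exact: tge.
  rewrite integral_nneseries//; last 3 first.
  - exact: measurable_disk.
  - by move=> k; apply: measurable_funeM; exact: mterm.
  - by move=> k z zd; rewrite mule_ge0 ?lee_fin//; exact: term0.
  apply: (@le_trans _ _ (\sum_(0 <= k <oo)
     (K * (1 - y) * N * (v `^ (- q^-1) * v) * y ^+ k)%:E)%E); last first.
    apply: (le_trans (nneseries_geometric_le _ _)).
    - have y1' : 0 < 1 - y by rewrite subr_gt0.
      exact: ltW (mulr_gt0 (mulr_gt0 (mulr_gt0 K0 y1') N0) (mulr_gt0 (powR_gt0 _ v0) v0)).
    - by rewrite y0 y1.
    - rewrite lee_fin le_eqVlt; apply/orP; left; apply/eqP; field.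
      by rewrite gt_eqF// subr_gt0.
  apply: lee_nneseries => [k _ _|k _].
    apply: integral_ge0 => z zd; rewrite mule_ge0 ?lee_fin//; exact: term0.
  rewrite ge0_integralZl_EFin//; last 3 first.
  - exact: measurable_disk.
  - by move=> z zd; exact: term0.
  - exact: mterm.
  rewrite -integral_cone_average//.
  apply: (@le_trans _ _ ((cc k)%:E * (K2 * (N * (18 * 2 ^+ k * v) `^ (- q^-1) * (18 * 2 ^+ k * v)))%:E)%E).
    by rewrite lee_wpmul2l ?lee_fin//; exact: LA.
  rewrite -EFinM lee_fin le_eqVlt; apply/orP; left; apply/eqP.
  have k2 : 0 < (2 : R) ^+ k by rewrite exprn_gt0.
  (* The factor 2^k from the size of the level set cancels the 2^(-k) of [cc]; what remains is y^k =
     2^(-k/q), which is summable. *)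
  have -> : (18 * 2 ^+ k * v) `^ (- q^-1) = 18 `^ (- q^-1) * y ^+ k * v `^ (- q^-1).
    rewrite powRM ?mulr_ge0 ?ltW// powRM ?ltW//; congr (_ * _ * _).
    by rewrite powR_exprn// /y -(powR_inv1 (ler0n R 2)) -powRrM mulN1r.
  rewrite /cc /K exprVn; field.
  by rewrite !gt_eqF// subr_gt0.
rewrite poweR_EFin -EFinM lee_fin.
have vq : 0 < v `^ q^-1 by rewrite powR_gt0.
have vv : v `^ (- q^-1) = (v `^ q^-1)^-1 by rewrite powRN.
move: main; rewrite lee_fin vv => main.
(* Cancels v^(1-1/q), which is legitimate because v = |E| is positive and finite. *)
rewrite -(@ler_pM2r _ (v / v `^ q^-1)) ?divr_gt0//.
have -> : lam * v `^ q^-1 * (v / v `^ q^-1) = lam * v by field; rewrite gt_eqF.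
by rewrite (mulrC v).
Qed.

End Aperture.

(** * From Bergman disks to the weak type inequality *)

Section PointwiseDomination.
Variable R : realType.
Notation C := (R * R)%type.
Notation RT := (measurableTypeR R).
Implicit Types (z w xi : C).

Lemma square_in_disk (e : R) z w : 0 < e < 1 -> disk z -> square z (e / 8 * (1 - cabs z)) w ->
  [/\ 1 - cabs w <= 2 * (1 - cabs z), 1 - cabs z <= 2 * (1 - cabs w) &
      cabs (csub z w) <= e / 4 * (1 - cabs z)].
Proof.
rewrite /disk/= => /andP[e0 e1] z1; rewrite /square/= !in_itv/= -!ler_distl => -[w1 w2].
have d : cabs (csub w z) <= e / 4 * (1 - cabs z).
  by apply: (le_trans (cabs_le_norms _)); rewrite /csub/=; lra.
have d4 : e / 4 * (1 - cabs z) <= 4^-1 * (1 - cabs z) by rewrite ler_pM2r; lra.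
have t1 := cabs_le_csub w z; have t2 := cabs_le_csub z w; rewrite csubC in t2.
by split; [lra|lra|rewrite csubC].
Qed.

(** Heights in the square differ by a factor of at most 2, so |xi-w| is below (2s + 1/2)(1-|w|). The
    second conclusion, centred at [w], is what the exchange of integrations requires. *)
Lemma square_cone (e s : R) z w xi : 0 < e < 1 -> 1 < s -> cabs xi = 1 -> lusin_cone s xi z ->
  square z (e / 8 * (1 - cabs z)) w ->
  lusin_cone (2 * s + 1) xi w /\ cball w (e * (1 - cabs w)) z.
Proof.
move=> e01 s1 x1 [zd hz] wz; have [h1 h2 h3] := square_in_disk e01 zd wz.
move: e01 => /andP[e0 e1]; rewrite /disk/= in zd.
rewrite cdist_unit// in hz.
split; last first.
  rewrite /cball/=; apply: (le_trans h3).
  have : e / 4 * (1 - cabs z) <= e / 4 * (2 * (1 - cabs w)) by rewrite ler_pM2l// divr_gt0.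
  have : 0 < e * (1 - cabs w) by rewrite mulr_gt0//; lra.
  lra.
split; first by rewrite /disk/=; lra.
rewrite cdist_unit//; apply: (le_lt_trans (csub_triangle xi z w)).
have : s * (1 - cabs z) <= s * (2 * (1 - cabs w)) by rewrite ler_pM2l//; lra.
have : e / 4 * (1 - cabs z) <= 4^-1 * (1 - cabs z) by rewrite ler_pM2r; lra.
lra.
Qed.

(** With h = 1-|z|, one power of h comes from the weight and two from the area of the square; they
    move inside as (1-|w|)^(-3) at the cost of 2^3. The other factor 8 of 64 comes from
    [sub_mean_value] with half its radius. *)
Lemma sub_mean_value_weighted (e : R) (f : C -> C) z : 0 < e < 1 -> analytic_on_disk f -> disk z ->
  ((cabs (f z) / (1 - cabs z))%:E <= (64 / (e / 8) ^+ 2)%:E *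
    \int[@area R]_(w in square z (e / 8 * (1 - cabs z))) (cabs (f w) * (1 - cabs w) `^ (-3))%:E)%E.
Proof.
move=> e01 af zd; have := e01 => /andP[e0 e1]; have := zd; rewrite /disk/= => z1.
set kap := e / 8; set h := 1 - cabs z.
have kap0 : 0 < kap by rewrite divr_gt0.
have h0 : 0 < h by rewrite /h; lra.
have kh0 : 0 < kap * h / 2 by rewrite divr_gt0// mulr_gt0.
have sq := square_in_disk e01 zd; rewrite -/kap -/h in sq.
have sqd w : square z (kap * h) w -> disk w by move=> /sq[_ h2 _]; rewrite /disk/=; lra.
have mS : measurable (square z (kap * h)) by exact: measurable_square.
have mfw c : measurable_fun (square z (kap * h)) (fun w => (cabs (f w) * (1 - cabs w) `^ c)%:E).
  by apply: measurable_funS (measurable_area_integrand c af); [exact: measurable_disk|exact: sqd].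
have mf : measurable_fun (square z (kap * h)) (fun w => (cabs (f w))%:E).
  apply/measurable_EFinP; apply: measurable_funS (measurable_analytic af) => //; exact: measurable_disk.
have e2 : 2 * (kap * h / 2) = kap * h by field.
have := @sub_mean_value R f z (kap * h / 2) kh0; rewrite e2 => smv.
have {}smv : (((kap * h / 2) ^+ 2 / 2 * cabs (f z))%:E <=
    \int[@area R]_(w in square z (kap * h)) (cabs (f w))%:E)%E.
  apply: smv => x y hx hy; apply: af; apply: sqd.
  by rewrite /square/= !in_itv/= -!ler_distl.
set I := (\int[_]_(w in _) _)%E.
have {}smv : (((kap * h / 2) ^+ 2 / 2 * cabs (f z))%:E <= (8 * h ^+ 3)%:E * I)%E.
  apply: (le_trans smv); rewrite /I -ge0_integralZl_EFin//; last 3 first.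
  - by move=> w _; rewrite lee_fin mulr_ge0 ?cabs_ge0 ?powR_ge0.
  - exact: mfw.
  - by rewrite mulr_ge0// exprn_ge0// ltW.
  apply: ge0_le_integral => //.
  - by move=> w _; rewrite lee_fin cabs_ge0.
  - by apply: measurable_funeM; exact: mfw.
  move=> w /sq[h1 h2 _]; rewrite -EFinM lee_fin.
  have hw : 0 < 1 - cabs w by lra.
  have -> : (1 - cabs w) `^ (-3) = ((1 - cabs w) ^+ 3)^-1.
    by rewrite powRN powR_mulrn//; exact: ltW.
  have hw3 : 0 < (1 - cabs w) ^+ 3 by rewrite exprn_gt0.
  have -> : 8 * h ^+ 3 * (cabs (f w) / (1 - cabs w) ^+ 3) = cabs (f w) * ((2 * h) ^+ 3 / (1 - cabs w) ^+ 3).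
    by field; rewrite gt_eqF.
  rewrite ler_peMr ?cabs_ge0// ler_pdivlMr// mul1r.
  by rewrite lerXn2r// nnegrE ?ltW// mulr_gt0.
have c0 : 0 < (8 * h ^+ 3)^-1 * (64 / kap ^+ 2).
  by rewrite mulr_gt0// ?invr_gt0 ?divr_gt0 ?mulr_gt0 ?exprn_gt0.
have p0 : 0 < 64 / kap ^+ 2 / (8 * h ^+ 3) by rewrite !divr_gt0 ?mulr_gt0 ?exprn_gt0.
have := smv; rewrite -(@lee_pmul2l _ (64 / kap ^+ 2 / (8 * h ^+ 3))%:E)//.
rewrite -EFinM muleA -EFinM.
have -> : 64 / kap ^+ 2 / (8 * h ^+ 3) * (8 * h ^+ 3) = 64 / kap ^+ 2.
  by field; rewrite !gt_eqF.
suff -> : 64 / kap ^+ 2 / (8 * h ^+ 3) * ((kap * h / 2) ^+ 2 / 2 * cabs (f z)) = cabs (f z) / h by [].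
by field; rewrite !gt_eqF.
Qed.

Lemma mu_cone_le_area_cone (mu : {measure set C -> \bar R}) (e K alpha s : R) :
  0 < e < 1 -> 0 < K -> 1 < s -> (mu (@disk R) < +oo)%E ->
  (forall a, disk a ->
    (mu (cball a (e * (1 - cabs a))) <= (K * (1 - cabs a) `^ (alpha + 2))%:E)%E) ->
  exists2 K' : R, 0 < K' & forall (f : C -> C) xi, analytic_on_disk f -> cabs xi = 1 ->
    (mu_cone_integral mu s f xi <= K'%:E * area_cone_integral (2 * s + 1) alpha f xi)%E.
Proof.
move=> e01 K0 s1 fin hmu; have := e01 => /andP[e0 e1]; have pi0 := pi_gt0 R.
have k0 : 0 < e / 8 by rewrite divr_gt0.
pose c1 := 64 / (e / 8) ^+ 2.
have c10 : 0 < c1 by rewrite divr_gt0// exprn_gt0.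
exists (c1 * (K * pi)); first by apply: mulr_gt0 => //; exact: mulr_gt0.
move=> f xi af x1.
(* The restriction to the disk is a finite measure, as Tonelli requires; [mu] itself is arbitrary
   outside the disk. *)
pose nu := mfrestr (@measurable_disk R) fin.
pose G z := (cabs (f z) / (1 - cabs z))%:E.
set Gam := lusin_cone s xi.
have mGam : measurable Gam by exact: measurable_lusin_cone.
have -> : mu_cone_integral mu s f xi = (\int[nu]_(z in Gam) G z)%E.
  apply: eq_measure_integral => A mA AG; transitivity (mu (A `&` @disk R)); last by [].
  by rewrite setIidl// => z /AG[].
pose gD := (fun w => (cabs (f w) * (1 - cabs w) `^ (-3))%:E) \_ (@disk R).
have gD0 w : (0 <= gD w)%E.
  by rewrite /gD patchE; case: ifPn => // _; rewrite lee_fin mulr_ge0 ?cabs_ge0 ?powR_ge0.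
have mgD : measurable_fun [set: RT * RT] gD.
  by apply/(measurable_restrictT _ (@measurable_disk R)); exact: measurable_area_integrand.
pose S : set (C * (RT * RT)) := [set p | Gam p.1 /\ square p.1 (e / 8 * (1 - cabs p.1)) p.2].
have mS : measurable S.
  have m1 : measurable_fun [set: C * (RT * RT)] (fun p => p.1 : C) by exact: measurable_fst.
  have m2 : measurable_fun [set: C * (RT * RT)] (fun p => p.2 : C) by exact: measurable_snd.
  have m11 : measurable_fun [set: C * (RT * RT)] (fun p => p.1.1 : R).
    exact: (measurableT_comp (@measurable_plane_fst R) m1).
  have m12 : measurable_fun [set: C * (RT * RT)] (fun p => p.1.2 : R).
    exact: (measurableT_comp (@measurable_plane_snd R) m1).
  have m21 : measurable_fun [set: C * (RT * RT)] (fun p => p.2.1 : R).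
    exact: (measurableT_comp (@measurable_plane_fst R) m2).
  have m22 : measurable_fun [set: C * (RT * RT)] (fun p => p.2.2 : R).
    exact: (measurableT_comp (@measurable_plane_snd R) m2).
  have ma : measurable_fun [set: C * (RT * RT)] (fun p => e / 8 * (1 - cabs (p.1 : C))).
    apply: measurable_funM => //; apply: measurable_funB => //.
    exact: (measurableT_comp (@measurable_cabs R) m1).
  have -> : S = (Gam `*` setT) `&`
     ([set p | `|p.2.1 - p.1.1| <= e / 8 * (1 - cabs (p.1 : C))] `&`
      [set p | `|p.2.2 - p.1.2| <= e / 8 * (1 - cabs (p.1 : C))]).
    by apply/seteqP; split => [p [h1 []]|p [[h1 _] [/=]]];
      rewrite /= ?in_itv/= ?ler_distl => h2 h3; split => //; split; rewrite /= ?in_itv/= ?ler_distl.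
  apply: measurableI; first exact: measurableX.
  by apply: measurableI; apply: measurable_set_le => //;
    apply: measurableT_comp => //; apply: measurable_funB.
pose H (p : C * (RT * RT)) := ((\1_S p)%:E * gD p.2)%E.
have H0 p : (0 <= H p)%E by rewrite /H mule_ge0// lee_fin.
have mH : measurable_fun [set: C * (RT * RT)] H.
  apply: emeasurable_funM.
    by apply/measurable_EFinP; exact: measurable_indic.
  exact: (measurableT_comp mgD (@measurable_snd _ _ _ _)).
have mHF := @measurable_fun_fubini_tonelli_F _ _ C (RT * RT)%type R (@area R) H mH H0.
have mHG := @measurable_fun_fubini_tonelli_G _ _ C (RT * RT)%type R nu H mH H0.
have HI z : Gam z -> (\int[@area R]_w H (z, w) =
    \int[@area R]_(w in square z (e / 8 * (1 - cabs z))) (cabs (f w) * (1 - cabs w) `^ (-3))%:E)%E.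
  move=> zG; rewrite [RHS]integral_mkcond; apply: eq_integral => w _.
  rewrite /H indicE /gD !patchE.
  have [wz|wz] := pselect (square z (e / 8 * (1 - cabs z)) w).
    have [[wd _] _] := square_cone e01 s1 x1 zG wz; have wd' : disk w by [].
    by rewrite (mem_set wz) (mem_set wd') mem_set ?mul1e.
  by rewrite (memNset wz) memNset ?mul0e// => -[].
apply: (@le_trans _ _ (\int[nu]_z (c1%:E * \int[@area R]_w H (z, w)))%E).
  rewrite integral_mkcond; apply: ge0_le_integral => //.
  - move=> z _; rewrite patchE; case: ifPn => // /set_mem [zd _].
    by rewrite lee_fin divr_ge0 ?cabs_ge0// subr_ge0 ltW.
  - apply/(measurable_restrictT _ mGam).
    by apply: measurable_funS (measurable_mu_integrand af); [exact: measurable_disk|move=> z []].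
  - by apply: measurable_funeM; exact: mHF.
  move=> z _; rewrite patchE; case: ifPn => [/set_mem zG|_].
    by rewrite HI//; have [zd _] := zG; exact: sub_mean_value_weighted.
  have c1E : (0 <= c1%:E)%E by rewrite lee_fin ltW.
  by apply: (mule_ge0 c1E); exact: integral_ge0.
rewrite ge0_integralZl_EFin//; last 2 first.
- by move=> z _; exact: integral_ge0.
- exact: ltW.
rewrite (EFinM c1 (K * pi)) -[leRHS]muleA lee_pmul2l ?lte_fin//.
rewrite (@fubini_tonelli _ _ C (RT * RT)%type R nu (@area R) H mH H0).
set Gam' := lusin_cone (2 * s + 1) xi.
have mGam' : measurable Gam' by exact: measurable_lusin_cone.
have mG' c : measurable_fun Gam' (fun w => (cabs (f w) * (1 - cabs w) `^ c)%:E).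
  by apply: measurable_funS (measurable_area_integrand c af); [exact: measurable_disk|move=> z []].
have -> : ((K * pi)%:E * area_cone_integral (2 * s + 1) alpha f xi =
    \int[@area R]_(w in Gam') (K * (cabs (f w) * (1 - cabs w) `^ (alpha - 1)))%:E)%E.
  have -> : area_cone_integral (2 * s + 1) alpha f xi =
      (\int[@area R]_(w in Gam') (cabs (f w) * (1 - cabs w) `^ (alpha - 1) / pi)%:E)%E by [].
  have cancel_pi u : K * pi * (u / pi) = K * u.
    by rewrite -mulrA (mulrC pi) divfK// gt_eqF.
  rewrite -ge0_integralZl_EFin//.
  - by apply: eq_integral => w _; rewrite -EFinM cancel_pi.
  - by move=> w _; rewrite lee_fin divr_ge0 ?mulr_ge0 ?cabs_ge0 ?powR_ge0// ltW.
  - under eq_fun do rewrite EFinM muleC.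
    by apply: measurable_funeM; exact: mG'.
  - by rewrite mulr_ge0// ltW.
rewrite [leRHS]integral_mkcond; apply: ge0_le_integral => //.
- by move=> w _; apply: integral_ge0.
- apply/(measurable_restrictT _ mGam').
  by under eq_fun do rewrite EFinM; apply: measurable_funeM; exact: mG'.
move=> w _.
have mY : measurable (ysection S w) by exact: measurable_ysection.
have -> : (\int[nu]_z H (z, w) = gD w * nu (ysection S w))%E.
  have <- : (\int[nu]_z (\1_(ysection S w) z)%:E = nu (ysection S w))%E.
    by rewrite integral_indic// setIT.
  have gfin : gD w = (fine (gD w))%:E.
    by rewrite fineK// /gD patchE; case: ifPn.
  rewrite gfin -ge0_integralZl_EFin//.
  - apply: eq_integral => z _; rewrite -gfin /H muleC; congr (_ * _%:E)%E.
    by rewrite !indicE mem_ysection.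
  - by apply/measurable_EFinP; exact: measurable_indic.
  - by rewrite -lee_fin -gfin.
(* A single point in the section already puts [w] in the wide cone, and the whole section lies in
   the ball around [w], to which the hypothesis on [mu] applies. *)
have [[z zS]|ne] := pselect (exists z, ysection S w z); last first.
  have Y0 : ysection S w = set0 by apply/seteqP; split => // z zS; apply: ne; exists z.
  have -> : nu (ysection S w) = 0%E by rewrite Y0; exact: measure0.
  rewrite mule0 patchE; case: ifPn => // _.
  by rewrite lee_fin mulr_ge0 ?mulr_ge0 ?cabs_ge0 ?powR_ge0// ltW.
have YS z' : ysection S w z' -> Gam' w /\ cball w (e * (1 - cabs w)) z'.
  by rewrite /ysection/= inE => -[/= zG zw]; exact: (square_cone e01 s1 x1 zG zw).
have [wG _] := YS z zS; have [wd _] := wG; have wd' : disk w by [].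
rewrite patchE (mem_set wG) /gD patchE (mem_set wd').
apply: (@le_trans _ _ ((cabs (f w) * (1 - cabs w) `^ (-3))%:E *
    (K * (1 - cabs w) `^ (alpha + 2))%:E)%E).
  rewrite lee_wpmul2l ?lee_fin ?mulr_ge0 ?cabs_ge0 ?powR_ge0//.
  have -> : nu (ysection S w) = mu (ysection S w `&` @disk R) by [].
  apply: le_trans (hmu w wd'); apply: le_measure; rewrite ?inE.
  - by apply: measurableI => //; exact: measurable_disk.
  - exact: measurable_cball.
  - by move=> z' [/YS[]].
rewrite -EFinM lee_fin le_eqVlt; apply/orP; left; apply/eqP.
have hw : 0 < 1 - cabs w by rewrite subr_gt0.
have -> : (1 - cabs w) `^ (alpha - 1) = (1 - cabs w) `^ (-3) * (1 - cabs w) `^ (alpha + 2).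
  rewrite -powRD; last by rewrite (gt_eqF hw) implybT.
  by congr (_ `^ _); ring.
ring.
Qed.

End PointwiseDomination.

(** * The weak type inequality from the ball condition *)

Section SufficiencyOfBalls.
Variable R : realType.
Notation C := (R * R)%type.
Notation leb := (@lebesgue_measure R).

Lemma weak_norm_distribution (q N : R) (g : C -> \bar R) : 1 < q -> 0 < N ->
  (weakLq_norm q g <= N%:E)%E -> forall lam : R, 0 < lam ->
  (circle_measure [set xi | (lam%:E < `|g xi|)%E] <= ((N / lam) `^ q)%:E)%E.
Proof.
move=> q1 N0 hN lam lam0; have q0 : 0 < q by lra.
set D := circle_measure _.
have hD : (lam%:E * D `^ q^-1 <= N%:E)%E.
  by apply: le_trans hN; apply: ereal_sup_ubound; exists lam.
have D0 : (0 <= D)%E by exact: circle_measure_ge0.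
have Dle : (D <= (2 * pi)%:E)%E by apply: lebesgue_measure_period_le => th [].
case: D D0 Dle hD => [r| |]//; rewrite lee_fin => r0 _.
rewrite poweR_EFin -EFinM !lee_fin mulrC -ler_pdivlMr// => h.
have -> : r = (r `^ q^-1) `^ q by rewrite -powRrM mulVf ?gt_eqF// powRr1.
by apply: powR_le_mono => //; [exact: ltW|exact: powR_ge0].
Qed.

Lemma cone_of_balls (mu : {measure set C -> \bar R}) (q e K alpha s : R) :
  1 < q -> 0 < e < 1 -> 0 < K -> 1 < s -> -1 < alpha ->
  (forall a, disk a ->
    (mu (cball a (e * (1 - cabs a))) <= (K * (1 - cabs a) `^ (alpha + 2))%:E)%E) ->
  exists2 K' : R, 0 < K' & forall f : C -> C, analytic_on_disk f ->
    (weakLq_norm q (mu_cone_integral mu s f) <=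
      K'%:E * weakLq_norm q (area_cone_integral s alpha f))%E.
Proof.
move=> q1 e01 K0 s1 al1 hmu; have pi0 := pi_gt0 R.
have fin : (mu (@disk R) < +oo)%E.
  have [|Kc Kc0 hc] := carleson_of_balls e01 K0 _ hmu; first lra.
  have p2 : 0 < 2 * pi :> R by rewrite mulr_gt0.
  have mb a := measurable_carleson_box a p2 (lexx (2 * pi)).
  apply: (@le_lt_trans _ _ (mu (carleson_box 0 (2 * pi) `|` carleson_box pi (2 * pi)))).
    apply: le_measure; rewrite ?inE; [exact: measurable_disk|exact: measurableU|].
    by move=> z /disk_in_two_boxes[]; [left|right].
  apply: (le_lt_trans (measureU2 mu (mb _) (mb _))).
  apply: (le_lt_trans (leeD (hc _ _ p2 (lexx _)) (hc _ _ p2 (lexx _)))).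
  by rewrite -EFinD ltry.
have [K1 K10 hK1] := mu_cone_le_area_cone e01 K0 s1 fin hmu.
have [|K2 K20 hK2] := @cone_average_aperture R q s (2 * s + 1) q1 s1; first lra.
have K120 : 0 < K1 * K2 by rewrite mulr_gt0.
exists (K1 * K2) => // f af.
set X := weakLq_norm q (area_cone_integral s alpha f).
have X0 : (0 <= X)%E.
  apply: (@le_trans _ _ (1%:E * (circle_measure [set xi | (1%:E <
      `|area_cone_integral s alpha f xi|)%E]) `^ q^-1)%E).
    by rewrite mul1e poweR_ge0.
  by apply: ereal_sup_ubound; exists 1 => //=.
case XE : X X0 => [x| |]// x0; last by rewrite gt0_muley ?lte_fin// leey.
rewrite lee_fin in x0.
apply/lee_addgt0Pr => d d0.
(* [cone_average_aperture] needs a positive bound and x may be 0, so the estimate is proved up to an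
   arbitrary d > 0. *)
pose N := x + d / (K1 * K2).
have N0 : 0 < N by rewrite ltr_wpDl// divr_gt0.
rewrite -EFinM -EFinD.
have -> : K1 * K2 * x + d = K1 * (K2 * N) by rewrite /N; field; rewrite !gt_eqF.
have hN : (X <= N%:E)%E by rewrite XE lee_fin lerDl ltW// divr_gt0.
pose F z := cabs (f z) * (1 - cabs z) `^ (alpha - 1) / pi.
have F0 z : disk z -> 0 <= F z.
  by move=> _; rewrite divr_ge0 ?mulr_ge0 ?cabs_ge0 ?powR_ge0// ltW.
have mF : measurable_fun (@disk R) (fun z => (F z)%:E).
  under eq_fun do rewrite /F mulrC EFinM.
  by apply: measurable_funeM; exact: measurable_area_integrand.
have dist (l : R) : 0 < l -> (leb (@period R `&` [set th | (l%:E < cone_average F s th)%E]) <=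
    ((N / l) `^ q)%:E)%E.
  move=> l0; apply: le_trans (weak_norm_distribution q1 N0 hN l0).
  apply: lebesgue_measure_mono => th [thP hl]; split => //=.
  by rewrite gee0_abs ?area_cone_integral_ge0.
apply: ge_ereal_sup => _ [lam /= lam0 <-].
(* By the pointwise domination, level [lam] of the [mu]-integral lies in level [lam / K1] of the
   wide-cone area integral. *)
have l0 : 0 < lam / K1 by rewrite divr_gt0.
have {}hK2 := hK2 F N F0 mF N0 dist (lam / K1) l0.
have -> : lam%:E = (K1%:E * (lam / K1)%:E)%E by rewrite -EFinM mulrC divfK ?gt_eqF.
rewrite -muleA [leRHS]EFinM lee_pmul2l ?lte_fin//.
apply: le_trans hK2; rewrite lee_pmul2l ?lte_fin//.
apply: gt0_ler_poweR; rewrite ?in_itv/= ?leey ?andbT.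
- by rewrite invr_ge0; lra.
- exact: circle_measure_ge0.
- exact: measure_ge0.
apply: lebesgue_measure_mono => th [thP hl]; split => //=.
have m0 : (0 <= mu_cone_integral mu s f (cexpi th))%E.
  apply: integral_ge0 => z [zd _]; rewrite lee_fin divr_ge0 ?cabs_ge0// subr_ge0 ltW//.
move: hl; rewrite /= -EFinM mulrC divfK ?gt_eqF// gee0_abs// => hl.
rewrite -(@lte_pmul2l _ K1%:E)// -EFinM mulrC divfK ?gt_eqF//.
by apply: (lt_le_trans hl); exact: (hK1 f (cexpi th) af (cabs_expi th)).
Qed.

End SufficiencyOfBalls.

Theorem theorem1 (R : realType) (q alpha sigma : R)
    (mu : {measure set (R * R)%type -> \bar R}) (t : R) :
  1 < q -> -1 < alpha -> 1 < sigma -> 0 < t ->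
  let cond_a := exists2 C : R, 0 < C &
      forall f : R * R -> R * R, analytic_on_disk f ->
        (weakLq_norm q (mu_cone_integral mu sigma f)
         <= C%:E * weakLq_norm q (area_cone_integral sigma alpha f))%E in
  let cond_b := exists2 C : R, 0 < C &
      forall z : R * R, disk z ->
        (mu (bergman_disk z t) <= (C * (1 - cabs z) `^ (alpha + 2))%:E)%E in
  let cond_c := exists2 C : R, 0 < C &
      forall a l : R, 0 < l -> l <= 2 * pi ->
        (mu (carleson_box a l) <= (C * l `^ (alpha + 2))%:E)%E in
  (cond_a <-> cond_b) /\ (cond_b <-> cond_c).
Proof.
move=> q1 al1 s1 t0 cond_a cond_b cond_c.
have [e e01 he] := @bergman_disk_contains_ball R t t0.
have balls (K : R) : (forall z, disk z ->
      (mu (bergman_disk z t) <= (K * (1 - cabs z) `^ (alpha + 2))%:E)%E) ->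
    forall a, disk a ->
      (mu (cball a (e * (1 - cabs a))) <= (K * (1 - cabs a) `^ (alpha + 2))%:E)%E.
  move=> hb a ad; apply: le_trans (hb a ad); apply: le_measure; rewrite ?inE.
  - exact: measurable_cball.
  - exact: measurable_bergman_disk.
  - by move=> w; exact: he.
split; split.
- exact: bergman_of_cone.
- by move=> [K K0 hb]; exact: (cone_of_balls q1 e01 K0 s1 al1 (balls K hb)).
- move=> [K K0 hb]; apply: (carleson_of_balls e01 K0 _ (balls K hb)); lra.
- move=> [K K0 hc]; apply: (bergman_of_carleson t0 K0 _ hc); lra.
Qed.
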